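(* Let $p\in(1,\infty)$, $\alpha>0$, and let $\mu$ be a positive Borel measure on $(0,\infty)$ such that $\mu((0,1))=0$ and $\sup_{n\in\mathbb{N}}\int_{1}^{\infty}t^{-(n+1)}\,d\mu(t)<\infty$. Then the Hausdorff operator $\mathcal{H}_{\mu}$ is compact on $F^{p}_{\alpha}$ if and only if $$\lim_{n\to\infty}\int_{1}^{\infty}\frac{1}{t^{n+1}}\,d\mu(t)=0.$$
   Context: $\mathbb{N}=\{0,1,2,\dots\}$. For $1\le p<\infty$ and $\alpha>0$, the Fock space $F^p_\alpha$ is the Banach space of entire functions $f$ with $\|f\|_{p,\alpha}^p=\frac{\alpha p}{2\pi}\int_{\mathbb{C}}|f(z)e^{-\frac{\alpha}{2}|z|^2}|^p\,dA(z)<\infty$, where $dA$ is Lebesgue area measure. For a positive Borel measure $\mu$ on $(0,\infty)$, the Hausdorff operator is $\mathcal{H}_{\mu}(f)(z)=\int_{0}^{\infty}\frac{1}{t}f\left(\frac{z}{t}\right)d\mu(t)$, $z\in\mathbb{C}$. *)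

(* Defs.v *)
From HB Require Import structures.
From mathcomp Require Import all_boot all_order all_algebra.
From mathcomp Require Import all_classical all_reals all_analysis.
From mathcomp Require Import complex.
Set Implicit Arguments. Unset Strict Implicit. Unset Printing Implicit Defensive.
Import Order.TTheory GRing.Theory Num.Theory.
Import numFieldNormedType.Exports.
Local Open Scope classical_set_scope.
Local Open Scope ring_scope.
Local Open Scope complex_scope.

Definition entire (R : realType) (f : R[i] -> R[i]) : Prop :=
  forall z : R[i], derivable (f : R[i]^o -> R[i]^o) z 1.

Definition fock_integrand (R : realType) (p alpha : R) (f : R[i] -> R[i])
  (xy : R * R) : R :=
  (ComplexField.Normc.normc (f (xy.1 +i* xy.2)) * expR (- (alpha / 2) * (xy.1 ^+ 2 + xy.2 ^+ 2))) `^ p.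

Definition fock_integral (R : realType) (p alpha : R) (f : R[i] -> R[i]) : \bar R :=
  (\int[(@lebesgue_measure R) \x (@lebesgue_measure R)]_xy
     (fock_integrand p alpha f xy)%:E)%E.

Definition in_fock (R : realType) (p alpha : R) (f : R[i] -> R[i]) : Prop :=
  entire f /\ (fock_integral p alpha f < +oo)%E.

Definition fock_norm (R : realType) (p alpha : R) (f : R[i] -> R[i]) : R :=
  (alpha * p / (2 * pi) * fine (fock_integral p alpha f)) `^ p^-1.

Definition hausdorff (R : realType) (mu : {measure set R -> \bar R})
  (f : R[i] -> R[i]) (z : R[i]) : R[i] :=
  (Rintegral mu `]0, +oo[ (fun t => t^-1 * complex.Re (f (z / t%:C))))
  +i* (Rintegral mu `]0, +oo[ (fun t => t^-1 * complex.Im (f (z / t%:C)))).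

Definition hausdorff_defined (R : realType) (mu : {measure set R -> \bar R})
  (f : R[i] -> R[i]) : Prop :=
  forall z : R[i],
    mu.-integrable `]0, +oo[ (fun t => (t^-1 * ComplexField.Normc.normc (f (z / t%:C)))%:E).

Definition hausdorff_compact_on_fock (R : realType) (p alpha : R)
  (mu : {measure set R -> \bar R}) : Prop :=
  (forall f, in_fock p alpha f ->
     hausdorff_defined mu f /\ in_fock p alpha (hausdorff mu f)) /\
  (forall u : nat -> R[i] -> R[i],
     (forall k, in_fock p alpha (u k)) ->
     (exists M : R, forall k, fock_norm p alpha (u k) <= M) ->
     exists (phi : nat -> nat) (g : R[i] -> R[i]),
       {homo phi : m n / (m < n)%N >-> (m < n)%N} /\
       in_fock p alpha g /\
       (fun k => fock_norm p alpha
          (fun z => hausdorff mu (u (phi k)) z - g z)) @ \oo --> 0).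

(* Main.v *)
Require Import Defs.
From HB Require Import structures.
From mathcomp Require Import all_boot all_order all_algebra.
From mathcomp Require Import all_classical all_reals all_analysis.
From mathcomp Require Import measurable_realfun complex.
From mathcomp Require Import ring lra.
Import Order.TTheory GRing.Theory Num.Theory.
Import numFieldNormedType.Exports.
Local Open Scope classical_set_scope.
Local Open Scope ring_scope.
Set Implicit Arguments.
Unset Strict Implicit.
Unset Printing Implicit Defensive.

(* On monomials the operator is diagonal: H (z ^ n) = c_n z ^ n, where
   c_n = int t ^ -(n+1) dmu.

   If H is compact, apply it to the normalized monomials e_n. They tend to 0
   pointwise, since the norm of z ^ n beats K ^ n for every K. Hence any limit of
   a subsequence of H e_n = c_n e_n vanishes by Fatou's lemma, so c_n is small
   for some n; as c_n decreases with n, it tends to 0.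

   Conversely, c_n -> 0 forces mu {1} = 0, so that only dilations f (z / t) with
   t > 1 enter H. Let u_k be bounded in the Fock space. By Montel's theorem and
   Fatou's lemma a subsequence converges pointwise to some f in the space. For
   each t > 1 the Gaussian weight dominates the dilations of u_k - f uniformly
   in k, so their norms tend to 0; these norms are also bounded uniformly in t.
   As t^-1 dmu is a finite measure, Hoelder's inequality, Tonelli's theorem and
   dominated convergence in t give H u_k -> H f in norm.

   The complex analysis rests on Goursat's theorem for rectangles. The contour
   integral of 1 / (w - z) is only bounded below, never evaluated: up to this
   nonzero factor Cauchy's formula still yields the Taylor estimates behind
   Montel's theorem. *)

(** The sharp pointwise bound for Fock functions, with exponent alpha/2 |z|^2, is replaced by one
    with exponent (1 + eps) alpha/2 |z|^2. The loss is affordable because a dilation by t > 1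
    divides the exponent by t^2; at t = 1 nothing is gained, so an atom of mu at 1 has to be
    excluded. As t tends to 1 the resulting Gaussian majorants degenerate, and the uniform bound on
    dilated norms therefore comes from a change of variables for t <= 2 and from growth for t > 2.
    The growth bound itself is Cauchy's formula on a rectangle whose edges lie on lines where the
    Fock integrand has a controlled integral. mu is an arbitrary measure; the case n = 0 of the
    moment bound makes t^-1 dmu finite on ]1, +oo[, hence mu sigma-finite there, as Tonelli's
    theorem requires. Constants are not optimized: estimating a complex integral costs a factor 2, a
    difference of Fock functions a factor 2^p. *)

Local Notation normc := ComplexField.Normc.normc.
Local Notation Re := complex.Re.
Local Notation Im := complex.Im.

(** * Modulus and componentwise integration of complex-valued functions *)

Section complex_norm.
Context {R : realType}.
Implicit Types (z w : R[i]) (x y : R).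

Lemma ReD z w : Re (z + w) = Re z + Re w. Proof. by case: z; case: w. Qed.
Lemma ImD z w : Im (z + w) = Im z + Im w. Proof. by case: z; case: w. Qed.
Lemma ReN z : Re (- z) = - Re z. Proof. by case: z. Qed.
Lemma ImN z : Im (- z) = - Im z. Proof. by case: z. Qed.
Lemma ReM z w : Re (z * w) = Re z * Re w - Im z * Im w.
Proof. by case: z; case: w. Qed.
Lemma ImM z w : Im (z * w) = Re z * Im w + Im z * Re w.
Proof. by case: z; case: w. Qed.
Lemma ReV z : Re z^-1 = Re z / (Re z ^+ 2 + Im z ^+ 2). Proof. by case: z. Qed.
Lemma ImV z : Im z^-1 = - (Im z / (Re z ^+ 2 + Im z ^+ 2)).
Proof. by case: z. Qed.

Lemma complex_ext z w : Re z = Re w -> Im z = Im w -> z = w.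
Proof. by case: z => a b; case: w => c d /= -> ->. Qed.

Lemma normc_sqrt z : normc z = Num.sqrt (Re z ^+ 2 + Im z ^+ 2).
Proof. by case: z. Qed.

Lemma normc_ge0 z : 0 <= normc z.
Proof. by rewrite normc_sqrt sqrtr_ge0. Qed.

Lemma sqr_normcE z : normc z ^+ 2 = Re z ^+ 2 + Im z ^+ 2.
Proof. by rewrite normc_sqrt sqr_sqrtr// addr_ge0 ?sqr_ge0. Qed.

Lemma normc_eq0 z : (normc z == 0) = (z == 0).
Proof.
apply/eqP/eqP => [/ComplexField.Normc.eq0_normc//|->].
exact: ComplexField.Normc.normc0.
Qed.

Lemma normc_gt0 z : (0 < normc z) = (z != 0).
Proof. by rewrite lt_neqAle normc_ge0 andbT eq_sym normc_eq0. Qed.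

Lemma normcD z w : normc (z + w) <= normc z + normc w.
Proof. exact: le_normcD. Qed.

Lemma normcopp z : normc (- z) = normc z.
Proof. exact: normcN. Qed.

Lemma normcBC z w : normc (z - w) = normc (w - z).
Proof. by rewrite -normcopp opprB. Qed.

Lemma normcB z w : normc (z - w) <= normc z + normc w.
Proof. by rewrite -(normcopp w); exact: normcD. Qed.

Lemma normcX z n : normc (z ^+ n) = normc z ^+ n.
Proof.
elim: n => [|n IH]; first by rewrite !expr0 ComplexField.Normc.normc1.
by rewrite !exprS ComplexField.Normc.normcM IH.
Qed.

Lemma Re_le_normc z : `|Re z| <= normc z.
Proof. by rewrite normc_sqrt -sqrtr_sqr ler_wsqrtr// lerDl sqr_ge0. Qed.

Lemma Im_le_normc z : `|Im z| <= normc z.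
Proof. by rewrite normc_sqrt -sqrtr_sqr ler_wsqrtr// lerDr sqr_ge0. Qed.

Lemma normc_le z : normc z <= `|Re z| + `|Im z|.
Proof.
rewrite -(@ler_pXn2r _ 2)// ?nnegrE ?normc_ge0 ?addr_ge0// sqr_normcE sqrrD.
by rewrite !real_normK ?num_real// lerD2r lerDl mulrn_wge0 ?mulr_ge0.
Qed.

Lemma normc_real x : normc x%:C%C = `|x|.
Proof. by rewrite normc_sqrt /= expr0n addr0 sqrtr_sqr. Qed.

Lemma scale_real_complex x z : x%:C%C * z = (x * Re z +i* (x * Im z))%C.
Proof. by case: z => a b; apply: complex_ext => /=; rewrite mul0r ?subr0 ?addr0. Qed.

Lemma complex_scale x z : z * x%:C%C = ((Re z * x) +i* (Im z * x))%C.
Proof. by case: z => a b; apply: complex_ext => /=; rewrite mulr0 ?subr0 ?add0r. Qed.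

Lemma real_complexV x : (x%:C%C)^-1 = (x^-1)%:C%C :> R[i].
Proof. by rewrite fmorphV. Qed.

End complex_norm.

Section complex_integral.
Context {d : measure_display} {T : measurableType d} {R : realType}.
Variables (mu : {measure set T -> \bar R}) (D : set T).
Hypothesis mD : measurable D.
Implicit Types (g : T -> R[i]) (h : T -> R).

Definition cintegrable g :=
  mu.-integrable D (EFin \o (fun x => Re (g x))) /\
  mu.-integrable D (EFin \o (fun x => Im (g x))).

(** Componentwise, in the shape of [hausdorff], so that the operator becomes a [cintegral] by
    comparing real and imaginary parts. *)
Definition cintegral g : R[i] :=
  (Rintegral mu D (fun x => Re (g x)) +i* Rintegral mu D (fun x => Im (g x)))%C.

Lemma cintegrableD g1 g2 : cintegrable g1 -> cintegrable g2 ->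
  cintegrable (fun x => g1 x + g2 x).
Proof.
move=> [r1 i1] [r2 i2]; split.
  apply: (eq_integrable mD _ _ _ (integrableD mD r1 r2)) => x _ /=.
  by rewrite ReD.
apply: (eq_integrable mD _ _ _ (integrableD mD i1 i2)) => x _ /=.
by rewrite ImD.
Qed.

Lemma cintegralD g1 g2 : cintegrable g1 -> cintegrable g2 ->
  cintegral (fun x => g1 x + g2 x) = cintegral g1 + cintegral g2.
Proof.
move=> [r1 i1] [r2 i2]; apply: complex_ext => /=.
  by rewrite -RintegralD//; apply: eq_Rintegral => x _; rewrite ReD.
by rewrite -RintegralD//; apply: eq_Rintegral => x _; rewrite ImD.
Qed.

Lemma cintegrableZ k g : cintegrable g -> cintegrable (fun x => k * g x).
Proof.
move=> [r i]; split.
  apply: (eq_integrable mD _ _ _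
    (integrableB mD (integrableZl mD (Re k) r) (integrableZl mD (Im k) i))) => x _ /=.
  by rewrite ReM.
apply: (eq_integrable mD _ _ _
  (integrableD mD (integrableZl mD (Re k) i) (integrableZl mD (Im k) r))) => x _ /=.
by rewrite ImM.
Qed.

Lemma cintegralZ k g : cintegrable g ->
  cintegral (fun x => k * g x) = k * cintegral g.
Proof.
move=> [r i]; apply: complex_ext; rewrite /cintegral ?ReM ?ImM /=.
  rewrite -!RintegralZl// -RintegralB//.
  - by apply: eq_Rintegral => x _; rewrite ReM.
  - exact: (integrableZl mD (Re k) r).
  - exact: (integrableZl mD (Im k) i).
rewrite -!RintegralZl// -RintegralD//.
- by apply: eq_Rintegral => x _; rewrite ImM.
- exact: (integrableZl mD (Re k) i).
- exact: (integrableZl mD (Im k) r).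
Qed.

Lemma cintegrableN g : cintegrable g -> cintegrable (fun x => - g x).
Proof.
by move=> /(cintegrableZ (-1)); under eq_fun do rewrite mulN1r.
Qed.

Lemma cintegralN g : cintegrable g ->
  cintegral (fun x => - g x) = - cintegral g.
Proof.
move=> ig; rewrite -mulN1r -cintegralZ//; congr cintegral.
by apply/funext => x; rewrite mulN1r.
Qed.

Lemma cintegrableB g1 g2 : cintegrable g1 -> cintegrable g2 ->
  cintegrable (fun x => g1 x - g2 x).
Proof. by move=> i1 i2; apply: cintegrableD => //; exact: cintegrableN. Qed.

Lemma cintegralB g1 g2 : cintegrable g1 -> cintegrable g2 ->
  cintegral (fun x => g1 x - g2 x) = cintegral g1 - cintegral g2.
Proof.
move=> i1 i2; rewrite cintegralD//; last exact: cintegrableN.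
by rewrite cintegralN.
Qed.

Lemma dominated_cintegrable g h :
  measurable_fun D (fun x => Re (g x)) -> measurable_fun D (fun x => Im (g x)) ->
  mu.-integrable D (EFin \o h) -> (forall x, D x -> normc (g x) <= h x) ->
  cintegrable g.
Proof.
move=> mr mi ih gh; split.
  apply: le_integrable ih => //; first exact/measurable_EFinP.
  move=> x Dx /=; rewrite lee_fin (le_trans (Re_le_normc _))//.
  by rewrite (le_trans (gh _ Dx))// ler_norm.
apply: le_integrable ih => //; first exact/measurable_EFinP.
move=> x Dx /=; rewrite lee_fin (le_trans (Im_le_normc _))//.
by rewrite (le_trans (gh _ Dx))// ler_norm.
Qed.

(** The real and imaginary parts are bounded separately by the integral of h, whence the factor
    2. *)
Lemma le_normc_cintegral g h : cintegrable g -> mu.-integrable D (EFin \o h) ->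
  (forall x, D x -> normc (g x) <= h x) ->
  normc (cintegral g) <= 2 * Rintegral mu D h.
Proof.
move=> [r i] ih gh; rewrite (le_trans (normc_le _))// mulr_natl mulr2n lerD//=.
  rewrite (le_trans (le_normr_Rintegral _ _))//.
  apply: le_Rintegral => //; first exact: (integrable_abse r).
  by move=> x Dx; rewrite (le_trans (Re_le_normc _))// gh.
rewrite (le_trans (le_normr_Rintegral _ _))//.
apply: le_Rintegral => //; first exact: (integrable_abse i).
by move=> x Dx; rewrite (le_trans (Im_le_normc _))// gh.
Qed.

End complex_integral.

(** * Goursat's theorem and Cauchy's formula *)

Section complex_curves.
Context {R : realType}.
Implicit Types (g : R -> R[i]) (k : R[i]) (a b c x y : R).

Definition ccontinuous g :=
  continuous (fun x => Re (g x)) /\ continuous (fun x => Im (g x)).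

Lemma ccontinuous_cst k : ccontinuous (fun=> k).
Proof. by split => x; exact: cvg_cst. Qed.

Lemma ccontinuousD g1 g2 : ccontinuous g1 -> ccontinuous g2 ->
  ccontinuous (fun x => g1 x + g2 x).
Proof.
move=> [r1 i1] [r2 i2]; split => x.
  under eq_fun do rewrite ReD; exact: (cvgD (r1 x) (r2 x)).
under eq_fun do rewrite ImD; exact: (cvgD (i1 x) (i2 x)).
Qed.

Lemma ccontinuousM g1 g2 : ccontinuous g1 -> ccontinuous g2 ->
  ccontinuous (fun x => g1 x * g2 x).
Proof.
move=> [r1 i1] [r2 i2]; split => x.
  under eq_fun do rewrite ReM.
  exact: (cvgB (cvgM (r1 x) (r2 x)) (cvgM (i1 x) (i2 x))).
under eq_fun do rewrite ImM.
exact: (cvgD (cvgM (r1 x) (i2 x)) (cvgM (i1 x) (r2 x))).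
Qed.

Lemma ccontinuousB g1 g2 : ccontinuous g1 -> ccontinuous g2 ->
  ccontinuous (fun x => g1 x - g2 x).
Proof.
move=> c1 c2; under eq_fun do rewrite -mulN1r.
by apply: ccontinuousD => //; apply: ccontinuousM => //; exact: ccontinuous_cst.
Qed.

Lemma ccontinuousV g : (forall x, g x != 0) -> ccontinuous g ->
  ccontinuous (fun x => (g x)^-1).
Proof.
move=> g0 [r i].
have n0 x : Re (g x) ^+ 2 + Im (g x) ^+ 2 != 0.
  by rewrite -sqr_normcE sqrf_eq0 normc_eq0.
have V x : (Re (g x0) ^+ 2 + Im (g x0) ^+ 2)^-1 @[x0 --> x] -->
    (Re (g x) ^+ 2 + Im (g x) ^+ 2)^-1.
  apply: cvgV; first exact: n0.
  exact: (cvgD (cvgM (r x) (r x)) (cvgM (i x) (i x))).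
split => x.
  under eq_fun do rewrite ReV; exact: (cvgM (r x) (V x)).
under eq_fun do rewrite ImV; exact: (cvgN (cvgM (i x) (V x))).
Qed.

Lemma ccontinuous_hline y : ccontinuous (fun x => (x +i* y)%C).
Proof. by split => x; [exact: cvg_id|exact: cvg_cst]. Qed.

Lemma ccontinuous_vline x : ccontinuous (fun y => (x +i* y)%C).
Proof. by split => y; [exact: cvg_cst|exact: cvg_id]. Qed.

(** An integral over a set, without orientation: it is 0 for b < a, so later statements carry
    [a <= b] and orientation is encoded by signs. *)
Definition seg a b g := cintegral (@lebesgue_measure R) `[a, b] g.

Lemma continuous_itv_integrable a b (f : R -> R) : continuous f ->
  (@lebesgue_measure R).-integrable `[a, b] (EFin \o f).
Proof.
move=> cf; apply: continuous_compact_integrable; first exact: segment_compact.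
exact: continuous_subspaceT.
Qed.

Lemma seg_integrable a b g : ccontinuous g ->
  cintegrable (@lebesgue_measure R) `[a, b] g.
Proof. by move=> [r i]; split; exact: continuous_itv_integrable. Qed.

Lemma segD a b g1 g2 : ccontinuous g1 -> ccontinuous g2 ->
  seg a b (fun x => g1 x + g2 x) = seg a b g1 + seg a b g2.
Proof. by move=> c1 c2; rewrite /seg cintegralD//; exact: seg_integrable. Qed.

Lemma segB a b g1 g2 : ccontinuous g1 -> ccontinuous g2 ->
  seg a b (fun x => g1 x - g2 x) = seg a b g1 - seg a b g2.
Proof. by move=> c1 c2; rewrite /seg cintegralB//; exact: seg_integrable. Qed.

Lemma segZ a b k g : ccontinuous g ->
  seg a b (fun x => k * g x) = k * seg a b g.
Proof. by move=> c1; rewrite /seg cintegralZ//; exact: seg_integrable. Qed.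

Lemma Rintegral_itv_cat a b c (f : R -> R) : continuous f -> a <= b -> b <= c ->
  Rintegral (@lebesgue_measure R) `[a, c] f =
  Rintegral (@lebesgue_measure R) `[a, b] f + Rintegral (@lebesgue_measure R) `[b, c] f.
Proof.
move=> cf ab bc.
have := @Rintegral_itvB R f (BLeft a) (BRight c) b
  (continuous_itv_integrable _ _ cf).
rewrite !bnd_simp ab bc => /(_ isT isT) /eqP.
rewrite subr_eq addrC => /eqP ->; congr (_ + _).
rewrite Rintegral_itv_obnd_cbnd//.
apply: integrableS (continuous_itv_integrable b c cf) => //=.
exact: subset_itv_oc_cc.
Qed.

Lemma seg_cat a b c g : ccontinuous g -> a <= b -> b <= c ->
  seg a c g = seg a b g + seg b c g.
Proof.
by move=> [r i] ab bc; apply: complex_ext;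
  rewrite /= (@Rintegral_itv_cat a b c).
Qed.

Lemma fine_lebesgue_itv a b : a <= b ->
  fine (@lebesgue_measure R `[a, b]%classic) = b - a.
Proof.
move=> ab; rewrite lebesgue_measure_itv/= lte_fin; case: ltP => // ba.
by rewrite /= (@le_anti _ _ a b) ?subrr// ab.
Qed.

Lemma seg_cst a b k : a <= b -> seg a b (fun=> k) = (b - a)%:C%C * k.
Proof.
move=> ab; rewrite scale_real_complex; apply: complex_ext => /=;
  by rewrite Rintegral_cst//= fine_lebesgue_itv// mulrC.
Qed.

Lemma seg_bound a b g K : a <= b -> ccontinuous g ->
  (forall x, a <= x -> x <= b -> normc (g x) <= K) ->
  normc (seg a b g) <= 2 * K * (b - a).
Proof.
move=> ab cg gK.
have := @le_normc_cintegral _ _ _ (@lebesgue_measure R) `[a, b] _ g (cst K)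
  (seg_integrable a b cg).
rewrite Rintegral_cst//= fine_lebesgue_itv// mulrA; apply => //.
  by apply: continuous_itv_integrable => x; exact: cvg_cst.
by move=> x; rewrite /= in_itv/= => /andP[]; exact: gK.
Qed.

End complex_curves.

Section contour.
Context {R : realType}.
Implicit Types (f : R[i] -> R[i]) (z w k : R[i]) (a b c d : R).

(** Continuity and, below, differentiability are phrased with real moduli, since the norm of [R[i]]
    takes its values in [R[i]]. [cderivable] is the quotient-free affine approximation that
    Goursat's argument consumes. *)
Definition pcontinuous f := forall z (e : R), 0 < e ->
  exists2 r : R, 0 < r &
    forall w, normc (w - z) < r -> normc (f w - f z) < e.

Definition cderivable f z := exists k, forall e : R, 0 < e ->
  exists2 r : R, 0 < r & forall w, normc (w - z) < r ->
    normc (f w - f z - k * (w - z)) <= e * normc (w - z).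

Lemma pcontinuous_comp f g : pcontinuous f -> ccontinuous g ->
  ccontinuous (fun x => f (g x)).
Proof.
move=> cf [gr gi].
have near_g x (e : R) : 0 < e -> \forall y \near x, normc (f (g y) - f (g x)) < e.
  move=> e0; have [r r0 fr] := cf (g x) e e0.
  have r2 : 0 < r / 2 by rewrite divr_gt0.
  have /cvgrPdist_lt/(_ _ r2) H1 := gr x.
  have /cvgrPdist_lt/(_ _ r2) H2 := gi x.
  near=> y; apply: fr; rewrite normcBC (le_lt_trans (normc_le _))//.
  rewrite (splitr r) ReD ReN ImD ImN ltrD//.
    by near: y; exact: H1.
  by near: y; exact: H2.
split => x; apply/cvgrPdist_lt => e e0; near=> y.
  rewrite -ReN -ReD (le_lt_trans (Re_le_normc _))// normcBC.
  by near: y; exact: near_g.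
rewrite -ImN -ImD (le_lt_trans (Im_le_normc _))// normcBC.
by near: y; exact: near_g.
Unshelve. all: by end_near. Qed.

(** The counterclockwise integral along the boundary of the rectangle [a, b] x [c, d]: bottom minus
    top, plus i times right minus left. *)
Definition contour a b c d f : R[i] :=
  seg a b (fun x => f (x +i* c)%C) - seg a b (fun x => f (x +i* d)%C) +
  'i%C * (seg c d (fun y => f (b +i* y)%C) - seg c d (fun y => f (a +i* y)%C)).

(** Continuity along the four lines carrying the edges. The Cauchy kernel has it when its pole is
    inside the rectangle, although it is not [pcontinuous]. *)
Definition edge_continuous a b c d f :=
  [/\ ccontinuous (fun x => f (x +i* c)%C), ccontinuous (fun x => f (x +i* d)%C),
      ccontinuous (fun y => f (b +i* y)%C) & ccontinuous (fun y => f (a +i* y)%C)].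

Lemma pcontinuous_edge a b c d f : pcontinuous f -> edge_continuous a b c d f.
Proof.
by move=> cf; split; apply: (pcontinuous_comp cf);
  by [exact: ccontinuous_hline|exact: ccontinuous_vline].
Qed.

Lemma contourD a b c d f1 f2 : edge_continuous a b c d f1 ->
  edge_continuous a b c d f2 ->
  contour a b c d (fun z => f1 z + f2 z) = contour a b c d f1 + contour a b c d f2.
Proof. by move=> [? ? ? ?] [? ? ? ?]; rewrite /contour !segD//; ring. Qed.

Lemma contourB a b c d f1 f2 : edge_continuous a b c d f1 ->
  edge_continuous a b c d f2 ->
  contour a b c d (fun z => f1 z - f2 z) = contour a b c d f1 - contour a b c d f2.
Proof. by move=> [? ? ? ?] [? ? ? ?]; rewrite /contour !segB//; ring. Qed.

Lemma contourZ a b c d k f : edge_continuous a b c d f ->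
  contour a b c d (fun z => k * f z) = k * contour a b c d f.
Proof. by move=> [? ? ? ?]; rewrite /contour !segZ//; ring. Qed.

Lemma edge_continuousD a b c d f1 f2 : edge_continuous a b c d f1 ->
  edge_continuous a b c d f2 -> edge_continuous a b c d (fun z => f1 z + f2 z).
Proof. by move=> [? ? ? ?] [? ? ? ?]; split; exact: ccontinuousD. Qed.

Lemma edge_continuousB a b c d f1 f2 : edge_continuous a b c d f1 ->
  edge_continuous a b c d f2 -> edge_continuous a b c d (fun z => f1 z - f2 z).
Proof. by move=> [? ? ? ?] [? ? ? ?]; split; exact: ccontinuousB. Qed.

Lemma edge_continuousM a b c d f1 f2 : edge_continuous a b c d f1 ->
  edge_continuous a b c d f2 -> edge_continuous a b c d (fun z => f1 z * f2 z).
Proof. by move=> [? ? ? ?] [? ? ? ?]; split; exact: ccontinuousM. Qed.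

Lemma edge_continuous_cst a b c d k : edge_continuous a b c d (fun=> k).
Proof. by split; exact: ccontinuous_cst. Qed.

Lemma edge_continuous_id a b c d : edge_continuous a b c d id.
Proof. by split; [exact: ccontinuous_hline..|exact: ccontinuous_vline|exact: ccontinuous_vline]. Qed.

Lemma edge_continuousV a b c d z : a < Re z < b -> c < Im z < d ->
  edge_continuous a b c d (fun w => (w - z)^-1).
Proof.
move=> /andP[az zb] /andP[cz zd]; split; apply: ccontinuousV => [x|];
  (try by apply: ccontinuousB; by [exact: ccontinuous_hline|
     exact: ccontinuous_vline|exact: ccontinuous_cst]);
  rewrite subr_eq0; apply/eqP => E; move: az zb cz zd;
  by rewrite -E /= ltxx.
Qed.

Definition on_edges a b c d w :=
  ((a <= Re w <= b) && ((Im w == c) || (Im w == d))) ||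
  ((c <= Im w <= d) && ((Re w == a) || (Re w == b))).

Lemma contour_bound a b c d f K : a <= b -> c <= d -> edge_continuous a b c d f ->
  (forall w, on_edges a b c d w -> normc (f w) <= K) ->
  normc (contour a b c d f) <= 4 * K * ((b - a) + (d - c)).
Proof.
move=> ab cd [e1 e2 e3 e4] fK.
have B1 : normc (seg a b (fun x => f (x +i* c)%C)) <= 2 * K * (b - a).
  apply: seg_bound => // x ax xb; apply: fK.
  by rewrite /on_edges /= ax xb eqxx.
have B2 : normc (seg a b (fun x => f (x +i* d)%C)) <= 2 * K * (b - a).
  apply: seg_bound => // x ax xb; apply: fK.
  by rewrite /on_edges /= ax xb eqxx orbT.
have B3 : normc (seg c d (fun y => f (b +i* y)%C)) <= 2 * K * (d - c).
  apply: seg_bound => // x ax xb; apply: fK.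
  by rewrite /on_edges /= ax xb eqxx !orbT.
have B4 : normc (seg c d (fun y => f (a +i* y)%C)) <= 2 * K * (d - c).
  apply: seg_bound => // x ax xb; apply: fK.
  by rewrite /on_edges /= ax xb eqxx !orbT.
rewrite /contour (le_trans (normcD _ _))// ComplexField.Normc.normcM.
have -> : normc ('i%C : R[i]) = 1.
  by rewrite normc_sqrt /= expr0n expr1n add0r sqrtr1.
rewrite mul1r.
have := lerD (le_trans (normcB _ _) (lerD B1 B2)) (le_trans (normcB _ _) (lerD B3 B4)).
move=> /le_trans; apply; lra.
Qed.

Lemma contour_cat_x a m b c d f : pcontinuous f -> a <= m -> m <= b ->
  contour a b c d f = contour a m c d f + contour m b c d f.
Proof.
move=> cf am mb; have [e1 e2 _ _] := pcontinuous_edge a b c d cf.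
by rewrite /contour (seg_cat e1 am mb) (seg_cat e2 am mb); ring.
Qed.

Lemma contour_cat_y a b c m d f : pcontinuous f -> c <= m -> m <= d ->
  contour a b c d f = contour a b c m f + contour a b m d f.
Proof.
move=> cf am mb; have [_ _ e1 e2] := pcontinuous_edge a b c d cf.
by rewrite /contour (seg_cat e1 am mb) (seg_cat e2 am mb); ring.
Qed.

(** On opposite edges the integrands differ by a constant, and the two resulting terms, -i k (d -
    c)(b - a) and i k (b - a)(d - c), cancel. No antiderivative is involved. *)
Lemma contour_affine a b c d k0 k : a <= b -> c <= d ->
  contour a b c d (fun w => k0 + k * w) = 0.
Proof.
move=> ab cd.
have [e1 e2 e3 e4] : edge_continuous a b c d (fun w => k0 + k * w).
  apply: edge_continuousD; first exact: edge_continuous_cst.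
  by apply: edge_continuousM; [exact: edge_continuous_cst|exact: edge_continuous_id].
rewrite /contour -!segB//.
have -> : (fun x => k0 + k * (x +i* c)%C - (k0 + k * (x +i* d)%C)) =
    (fun=> k * (0 +i* (c - d))%C).
  by apply/funext => x; rewrite opprD addrACA subrr add0r -mulrBr;
    congr (_ * _); apply: complex_ext => //=; rewrite subrr.
have -> : (fun x => k0 + k * (b +i* x)%C - (k0 + k * (a +i* x)%C)) =
    (fun=> k * (b - a)%:C%C).
  by apply/funext => x; rewrite opprD addrACA subrr add0r -mulrBr;
    congr (_ * _); apply: complex_ext => //=; rewrite subrr.
rewrite !seg_cst//.
have -> : (0 +i* (c - d))%C = - ('i%C * (d - c)%:C%C) :> R[i].
  by apply: complex_ext => /=; ring.
ring.
Qed.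

(** Affine functions have zero contour integral, so only the deviation from one of them counts. *)
Lemma contour_near_affine a b c d f k0 k K : a <= b -> c <= d -> pcontinuous f ->
  (forall w, a <= Re w <= b -> c <= Im w <= d -> normc (f w - (k0 + k * w)) <= K) ->
  normc (contour a b c d f) <= 4 * K * ((b - a) + (d - c)).
Proof.
move=> ab cd cf fK; have ef := pcontinuous_edge a b c d cf.
have ea : edge_continuous a b c d (fun w => k0 + k * w).
  apply: edge_continuousD; first exact: edge_continuous_cst.
  by apply: edge_continuousM; [exact: edge_continuous_cst|exact: edge_continuous_id].
rewrite -[contour _ _ _ _ _]subr0 -(contour_affine k0 k ab cd) -contourB//.
apply: contour_bound => //; first exact: edge_continuousB.
move=> w; rewrite /on_edges => /orP[] /andP[/andP[w1 w2]] /orP[]/eqP E; apply: fK;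
  by rewrite ?E ?w1 ?w2 ?lexx ?ab ?cd.
Qed.

(** Every left endpoint lies below every right endpoint, so the supremum of the left endpoints is in
    all the intervals. *)
Lemma nested_itv (u : nat -> R) (l : R) :
  (forall n, u n <= u n.+1) ->
  (forall n, u n.+1 + l / 2 ^+ n.+1 <= u n + l / 2 ^+ n) -> 0 <= l ->
  exists x, forall n, u n <= x <= u n + l / 2 ^+ n.
Proof.
move=> ui ud l0.
have uh : {homo u : n m / (n <= m)%N >-> n <= m}.
  exact: homo_leq (@lexx _ _) (@le_trans _ _) ui.
have udh n m : (n <= m)%N -> u m + l / 2 ^+ m <= u n + l / 2 ^+ n.
  elim: m => [|m IH]; first by rewrite leqn0 => /eqP ->.
  by rewrite leq_eqVlt => /predU1P[->//|/IH]; exact: le_trans.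
have ub n m : u m <= u n + l / 2 ^+ n.
  have [nm|/ltnW mn] := leqP n m.
    by apply: le_trans (udh _ _ nm); rewrite lerDl divr_ge0// exprn_ge0.
  by rewrite (le_trans (uh _ _ mn))// lerDl divr_ge0// exprn_ge0.
exists (sup (range u)) => n; apply/andP; split.
  apply: ub_le_sup; last by exists n.
  by exists (u n + l / 2 ^+ n) => _ [m _ <-].
by apply: ge_sup; [exists (u 0%N); exists 0%N|move=> _ [m _ <-]].
Qed.

Lemma half_pow_small (l e : R) : 0 < e -> exists n, l / 2 ^+ n < e.
Proof.
move=> e0; have : l / 2 ^+ n @[n --> \oo] --> (0 : R).
  rewrite -[X in _ --> X](mulr0 l); apply: cvgM; first exact: cvg_cst.
  under eq_fun do rewrite -exprVn.
  by apply: cvg_expr; rewrite ger0_norm ?invr_ge0// invf_lt1// ltr1n.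
move=> /cvgrPdist_lt/(_ _ e0) [n _ /(_ n (leqnn n))/=].
by rewrite sub0r normrN => H; exists n; exact: le_lt_trans (ler_norm _) H.
Qed.

(* The bound [e * (semi-perimeter) ^ 2] is additive under quadrisection, and
   unlike the area it does not degenerate for flat rectangles. *)
Lemma goursat_quadrisection (e : R) a c l1 l2 f : 0 <= l1 -> 0 <= l2 -> pcontinuous f ->
  e * (l1 + l2) ^+ 2 < normc (contour a (a + l1) c (c + l2) f) ->
  exists a' c', [/\ a <= a', a' <= a + l1 / 2, c <= c', c' <= c + l2 / 2 &
  e * (l1 / 2 + l2 / 2) ^+ 2 <
    normc (contour a' (a' + l1 / 2) c' (c' + l2 / 2) f)].
Proof.
move=> l10 l20 cf; apply: contraPP => /forallNP H.
have l10' : 0 <= l1 / 2 by rewrite divr_ge0.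
have l20' : 0 <= l2 / 2 by rewrite divr_ge0.
have Q a' c' : a <= a' -> a' <= a + l1 / 2 -> c <= c' -> c' <= c + l2 / 2 ->
    normc (contour a' (a' + l1 / 2) c' (c' + l2 / 2) f) <= e * (l1 / 2 + l2 / 2) ^+ 2.
  move=> h1 h2 h3 h4; rewrite leNgt; apply/negP => h5.
  by move: (H a') => /forallNP/(_ c'); apply; split.
have E1 : a + l1 / 2 + l1 / 2 = a + l1 by lra.
have E2 : c + l2 / 2 + l2 / 2 = c + l2 by lra.
have := Q a c (lexx _) _ (lexx _) _; rewrite !lerDl => /(_ l10' l20') Q1.
have := Q (a + l1 / 2) c _ (lexx _) (lexx _) _; rewrite !lerDl E1 => /(_ l10' l20') Q2.
have := Q a (c + l2 / 2) (lexx _) _ _ (lexx _); rewrite !lerDl E2 => /(_ l10' l20') Q3.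
have := Q (a + l1 / 2) (c + l2 / 2) _ (lexx _) _ (lexx _).
rewrite !lerDl E1 E2 => /(_ l10' l20') Q4.
apply/negP; rewrite -leNgt.
have h1 : l1 / 2 <= l1 by lra.
have h2 : l2 / 2 <= l2 by lra.
rewrite (@contour_cat_x a (a + l1 / 2)) ?lerDl ?lerD2l//.
rewrite (@contour_cat_y a _ c (c + l2 / 2)) ?lerDl ?lerD2l//.
rewrite (@contour_cat_y (a + l1 / 2) _ c (c + l2 / 2)) ?lerDl ?lerD2l//.
apply: le_trans (normcD _ _) _.
apply: le_trans (lerD (normcD _ _) (normcD _ _)) _.
have := lerD (lerD Q1 Q3) (lerD Q2 Q4).
by move=> /le_trans; apply; lra.
Qed.

(** If the integral exceeded e times the squared semi-perimeter, quadrisection would give nested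
    rectangles that all do so; near their common point f is affine up to a small multiple of the
    distance, and this distance is at most the semi-perimeter, a contradiction. *)
Theorem goursat a b c d f : a <= b -> c <= d -> pcontinuous f ->
  (forall w, a <= Re w <= b -> c <= Im w <= d -> cderivable f w) ->
  contour a b c d f = 0.
Proof.
move=> ab cd cf df.
set l1 := b - a; set l2 := d - c.
have l10 : 0 <= l1 by rewrite subr_ge0.
have l20 : 0 <= l2 by rewrite subr_ge0.
suff main (e : R) : 0 < e -> normc (contour a b c d f) <= e * (l1 + l2) ^+ 2.
  apply/eqP; rewrite -normc_eq0 eq_le normc_ge0 andbT.
  apply/ler_addgt0Pr => e e0; rewrite add0r.
  have L0 : 0 < (l1 + l2) ^+ 2 + 1 by rewrite ltr_wpDl ?sqr_ge0.
  have := main (e / ((l1 + l2) ^+ 2 + 1)) (divr_gt0 e0 L0).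
  move=> /le_trans; apply; rewrite -mulrA ler_piMr ?(ltW e0)//.
  by rewrite mulrC ler_pdivrMr// mul1r lerDl.
move=> e0; rewrite leNgt; apply/negP => bad0.
pose bad n (q : R * R) := e * (l1 / 2 ^+ n + l2 / 2 ^+ n) ^+ 2 <
  normc (contour q.1 (q.1 + l1 / 2 ^+ n) q.2 (q.2 + l2 / 2 ^+ n) f).
have half l n : l / 2 ^+ n / 2 = l / 2 ^+ n.+1 :> R.
  by rewrite exprS invfM mulrA mulrAC.
(* A choice function sends the lower left corner of a bad rectangle of generation n to that of a bad
   quarter; for other inputs its value is arbitrary. *)
have [s Hs] : exists s : nat * (R * R) -> R * R, forall nq,
    bad nq.1 nq.2 -> [/\ bad nq.1.+1 (s nq), nq.2.1 <= (s nq).1,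
      (s nq).1 <= nq.2.1 + l1 / 2 ^+ nq.1.+1, nq.2.2 <= (s nq).2 &
      (s nq).2 <= nq.2.2 + l2 / 2 ^+ nq.1.+1].
  suff /choice[s Hs] : forall nq : nat * (R * R), exists q : R * R,
    bad nq.1 nq.2 -> [/\ bad nq.1.+1 q, nq.2.1 <= q.1,
      q.1 <= nq.2.1 + l1 / 2 ^+ nq.1.+1, nq.2.2 <= q.2 &
      q.2 <= nq.2.2 + l2 / 2 ^+ nq.1.+1] by exists s.
  move=> [n [u v]]; have [|nb] := pselect (bad n (u, v)); last by exists (0, 0).
  move=> /goursat_quadrisection[]//; try by rewrite divr_ge0// exprn_ge0.
  move=> u' [v' [h1 h2 h3 h4 h5]]; exists (u', v') => _ /=.
  by move: h2 h4 h5; rewrite !half => h2 h4 h5; split.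
pose q := fix q n := if n is m.+1 then s (m, q m) else (a, c).
have qbad n : bad n (q n).
  elim: n => [|n IH]; last by have [] := Hs (n, q n) IH.
  rewrite /bad /= expr0 !divr1.
  have -> : a + l1 = b by rewrite /l1 addrC subrK.
  by have -> : c + l2 = d by rewrite /l2 addrC subrK.
have qs n : [/\ (q n).1 <= (q n.+1).1, (q n.+1).1 <= (q n).1 + l1 / 2 ^+ n.+1,
   (q n).2 <= (q n.+1).2 & (q n.+1).2 <= (q n).2 + l2 / 2 ^+ n.+1].
  by have [] := Hs (n, q n) (qbad n).
have [x Hx] := @nested_itv (fun n => (q n).1) l1 (fun n => let: And4 h _ _ _ := qs n in h)
  (fun n => ltac:(have [_ h _ _] := qs n; move: h; rewrite -half; lra)) l10.
have [y Hy] := @nested_itv (fun n => (q n).2) l2 (fun n => let: And4 _ _ h _ := qs n in h)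
  (fun n => ltac:(have [_ _ _ h] := qs n; move: h; rewrite -half; lra)) l20.
have [k Hk] : cderivable f (x +i* y)%C.
  apply: df => /=.
    by have := Hx 0%N; rewrite /= expr0 divr1 /l1 addrC subrK.
  by have := Hy 0%N; rewrite /= expr0 divr1 /l2 addrC subrK.
(* The quarter offsets the factor 4 in [contour_near_affine]. *)
have [r r0 {}Hk] := Hk (e / 4) ltac:(by rewrite divr_gt0).
have [n Hn] := half_pow_small (l1 + l2) r0.
have := qbad n; rewrite /bad; apply/negP; rewrite -leNgt.
set u := (q n).1; set v := (q n).2; set s1 := l1 / 2 ^+ n; set s2 := l2 / 2 ^+ n.
have s10 : 0 <= s1 by rewrite divr_ge0// exprn_ge0.
have s20 : 0 <= s2 by rewrite divr_ge0// exprn_ge0.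
have -> : e * (s1 + s2) ^+ 2 =
  4 * (e / 4 * (s1 + s2)) * ((u + s1 - u) + (v + s2 - v)) by field.
apply: (@contour_near_affine _ _ _ _ _ (f (x +i* y)%C - k * (x +i* y)%C) k) => //;
  rewrite ?lerDl//.
move=> w wx wy; have := Hx n; have := Hy n; rewrite -/u -/v -/s1 -/s2 => yv xu.
have -> : f w - (f (x +i* y)%C - k * (x +i* y)%C + k * w) =
  f w - f (x +i* y)%C - k * (w - (x +i* y)%C) by ring.
have dw : normc (w - (x +i* y)%C) <= s1 + s2.
  rewrite (le_trans (normc_le _))// ReD ImD ReN ImN /= lerD// ler_norml; lra.
apply: le_trans (Hk _ _) _.
  by rewrite (le_lt_trans dw)// /s1 /s2 -mulrDl.
by rewrite ler_wpM2l// divr_ge0// ltW.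
Qed.

(** Goursat's theorem kills the four rectangles surrounding a small square centred at z. On the
    square f is bounded by continuity at z, so its contribution is proportional to the side and can
    be made arbitrarily small. *)
Lemma goursat_removable a b c d f z : a < Re z < b -> c < Im z < d ->
  pcontinuous f -> (forall w, w != z -> cderivable f w) ->
  contour a b c d f = 0.
Proof.
move=> /andP[az zb] /andP[cz zd] cf df.
have [r r0 fr] := cf z 1 ltr01.
have cornerless (h : R) : 0 < h -> a <= Re z - h -> Re z + h <= b ->
    c <= Im z - h -> Im z + h <= d ->
    contour a b c d f =
    contour (Re z - h) (Re z + h) (Im z - h) (Im z + h) f.
  move=> h0 h1 h2 h3 h4.
  have off a' b' c' d' : a' <= b' -> c' <= d' ->
      [\/ b' < Re z, Re z < a', d' < Im z | Im z < c'] ->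
      contour a' b' c' d' f = 0.
    move=> ab' cd' out; apply: goursat => // w w1 w2; apply: df.
    by apply/eqP => E; move: w1 w2; rewrite E => w1 w2; case: out; lra.
  have O1 : contour a (Re z - h) c d f = 0.
    by apply: off; [lra|lra|constructor 1; lra].
  have O2 : contour (Re z + h) b c d f = 0.
    by apply: off; [lra|lra|constructor 2; lra].
  have O3 : contour (Re z - h) (Re z + h) c (Im z - h) f = 0.
    by apply: off; [lra|lra|constructor 3; lra].
  have O4 : contour (Re z - h) (Re z + h) (Im z + h) d f = 0.
    by apply: off; [lra|lra|constructor 4; lra].
  rewrite (@contour_cat_x a (Re z - h))//; last by lra.
  rewrite (@contour_cat_x (Re z - h) (Re z + h))//; last by lra.
  rewrite (@contour_cat_y _ (Re z + h) c (Im z - h))//; last by lra.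
  rewrite (@contour_cat_y _ (Re z + h) (Im z - h) (Im z + h))//; last by lra.
  by rewrite O1 O2 O3 O4 !add0r !addr0.
pose K := normc (f z) + 1.
have K0 : 0 < K by rewrite ltr_wpDl ?normc_ge0.
apply/eqP; rewrite -normc_eq0 eq_le normc_ge0 andbT.
apply/ler_addgt0Pr => e e0; rewrite add0r.
(* The square has side 2h. The first four terms keep it inside the rectangle, r / 4 keeps it where f
   stays within 1 of f z, and e / (16 K) brings the bound 4 K (2h + 2h) below e. *)
pose h := Num.min (Num.min (Num.min (Re z - a) (b - Re z)) (Num.min (Im z - c) (d - Im z)))
            (Num.min (r / 4) (e / (16 * K))).
have h0 : 0 < h.
  by rewrite !lt_min !subr_gt0 az zb cz zd !divr_gt0// mulr_gt0.
have : h <= h by [].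
rewrite {2}/h !le_min => /andP[/andP[/andP[h1 h2] /andP[h3 h4]] /andP[h5 h6]].
rewrite (cornerless h) //; try by lra.
apply: (@le_trans _ _ (4 * K * ((Re z + h - (Re z - h)) + (Im z + h - (Im z - h))))).
  apply: contour_bound; try lra; first exact: pcontinuous_edge.
  move=> w ew.
  have wz : normc (w - z) < r.
    rewrite (le_lt_trans (normc_le _))// ReD ImD ReN ImN.
    apply: (@le_lt_trans _ _ (h + h)); last by lra.
    move: ew; rewrite /on_edges => /orP[] /andP[/andP[? ?]] /orP[] /eqP E;
      by rewrite lerD// ler_norml; lra.
  have := fr _ wz; rewrite /K => /ltW H.
  rewrite -(subrK (f z) (f w)) (le_trans (normcD _ _))// addrC lerD2l.
  exact: H.
have -> : 4 * K * ((Re z + h - (Re z - h)) + (Im z + h - (Im z - h))) = h * (16 * K).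
  by ring.
by rewrite -ler_pdivlMr// mulr_gt0.
Qed.

End contour.

Section holomorphy.
Context {R : realType}.
Implicit Types (f : R[i] -> R[i]) (z w h k : R[i]) (a b c d : R).

Lemma norm_complexE z : `|z| = (normc z)%:C%C.
Proof. by []. Qed.

Lemma complex_pos_real (e : R[i]) : 0 < e -> exists2 r : R, 0 < r & e = r%:C%C.
Proof.
rewrite ltcE /= => /andP[/eqP e0 r0]; exists (Re e) => //.
by apply: complex_ext => //=; rewrite e0.
Qed.

(** The bridge to the definition of [entire]. There the radii and tolerances are positive elements
    of [R[i]]; these are real by [complex_pos_real], so both notions use the same discs. *)
Lemma cderivable_derivable f z :
  cderivable f z <-> derivable (f : R[i]^o -> R[i]^o) z 1.
Proof.
split=> [[k Hk]|/cvg_ex[k /= Hk]].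
  apply/cvg_ex; exists k; apply/cvgrPdist_le => /= _/complex_pos_real[e e0 ->].
  have [r r0 {}Hk] := Hk e e0.
  rewrite near_withinE; apply/nbhs_ballP; exists r%:C%C => /=; first by rewrite ltcR.
  move=> h; rewrite /ball /= sub0r normrN norm_complexE ltcR => hr h0.
  rewrite norm_complexE lecR.
  have := Hk (h + z); rewrite addrK => /(_ hr) H.
  have -> : k - h^-1 *: (f (h *: 1 + z) - f z) =
      - h^-1 * (f (h + z) - f z - k * h).
    transitivity (k - h^-1 * (f (h * 1 + z) - f z)); first by [].
    by rewrite mulr1; field; exact: h0.
  rewrite ComplexField.Normc.normcM normcopp ComplexField.Normc.normcV mulrC.
  by rewrite ler_pdivrMr// normc_gt0.
exists k => e e0.
have e0' : 0 < e%:C%C :> R[i] by rewrite ltcR.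
move/cvgrPdist_le : Hk => /(_ _ e0'); rewrite near_withinE.
move=> /nbhs_ballP[_/complex_pos_real[r r0 ->]] H.
exists r => // w wr; have [->|wz] := eqVneq w z.
  by rewrite !subrr mulr0 subr0 ComplexField.Normc.normc0 mulr0.
have := H (w - z); rewrite /ball /= sub0r normrN !norm_complexE ltcR lecR.
rewrite subr_eq0 => /(_ wr wz).
rewrite /GRing.scale /= mulr1 subrK => {}H.
have -> : f w - f z - k * (w - z) = (w - z) * - (k - (w - z)^-1 * (f w - f z)).
  by field; rewrite subr_eq0.
by rewrite ComplexField.Normc.normcM normcopp mulrC ler_wpM2r// normc_ge0.
Qed.

Lemma entireP f : entire f <-> forall z, cderivable f z.
Proof. by split=> H z; apply/cderivable_derivable; exact: H. Qed.

Lemma cderivable_lipschitz f z : cderivable f z ->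
  exists2 M : R, 0 < M & exists2 r : R, 0 < r &
    forall w, normc (w - z) < r -> normc (f w - f z) <= M * normc (w - z).
Proof.
move=> [k /(_ 1 ltr01)[r r0 H]]; exists (normc k + 1).
  by rewrite ltr_wpDl ?normc_ge0.
exists r => // w /H {}H; rewrite -(subrK (k * (w - z)) (f w - f z)).
by rewrite (le_trans (normcD _ _))// ComplexField.Normc.normcM mulrDl addrC lerD2l.
Qed.

Lemma entire_pcontinuous f : entire f -> pcontinuous f.
Proof.
move=> /entireP df z e e0; have [M M0 [r r0 H]] := cderivable_lipschitz (df z).
exists (Num.min r (e / M)); first by rewrite lt_min r0 divr_gt0.
move=> w; rewrite lt_min => /andP[/H{}H]; rewrite ltr_pdivlMr// mulrC.
exact: le_lt_trans.
Qed.

Lemma entireB f1 f2 : entire f1 -> entire f2 -> entire (fun z => f1 z - f2 z).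
Proof. by move=> e1 e2 z; apply: derivableB. Qed.

Section difference_quotient.
Variables (f : R[i] -> R[i]) (z k : R[i]).
Hypothesis Hk : forall e : R, 0 < e ->
  exists2 r : R, 0 < r & forall w, normc (w - z) < r ->
    normc (f w - f z - k * (w - z)) <= e * normc (w - z).
Hypothesis fe : entire f.

(** With the derivative as its value at z it is continuous there, which is what [goursat_removable]
    asks for. *)
Definition diffquot w := if w == z then k else (f w - f z) / (w - z).

Lemma diffquot_derivable w : w != z -> cderivable diffquot w.
Proof.
move=> wz; apply/cderivable_derivable.
pose g (u : R[i]^o) : R[i]^o := (f u - f z) * (u - z)^-1.
have dg : derivable g w 1.
  have i1 : derivable (fun u : R[i]^o => u - z : R[i]^o) w 1.
    by apply: derivableB; [exact: derivable_id|exact: derivable_cst].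
  apply: derivableM.
    by apply: derivableB; [exact: fe|exact: derivable_cst].
  by apply: derivableV => //; rewrite subr_eq0.
move/cderivable_derivable : dg => [l Hl]; apply/cderivable_derivable.
exists l => e /Hl[r r0 {}Hl]; exists (Num.min r (normc (w - z))).
  by rewrite lt_min r0 normc_gt0 subr_eq0.
move=> u; rewrite lt_min => /andP[/Hl + uwz].
have uz : u != z.
  by apply: contraTneq uwz => ->; rewrite normcBC ltxx.
by rewrite /diffquot (negbTE wz) (negbTE uz) /g.
Qed.

Lemma diffquot_continuous : pcontinuous diffquot.
Proof.
move=> w e e0; have [->|wz] := eqVneq w z; last first.
  have [M M0 [r r0 H]] := cderivable_lipschitz (diffquot_derivable wz).
  exists (Num.min r (e / M)); first by rewrite lt_min r0 divr_gt0.
  move=> u; rewrite lt_min => /andP[/H{}H]; rewrite ltr_pdivlMr// mulrC.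
  exact: le_lt_trans.
have e2 : 0 < e / 2 by rewrite divr_gt0.
have [r r0 H] := Hk e2; exists r => // u uz; rewrite /diffquot eqxx.
case: eqVneq => [_|uz']; first by rewrite subrr ComplexField.Normc.normc0.
rewrite -(mulfK _ k (x := u - z)) ?subr_eq0// -mulrBl ComplexField.Normc.normcM.
rewrite ComplexField.Normc.normcV ltr_pdivrMr ?normc_gt0 ?subr_eq0//.
rewrite (le_lt_trans (H _ uz))// ltr_pM2r ?normc_gt0 ?subr_eq0//.
by rewrite ltr_pdivrMr// ltr_pMr// ltr1n.
Qed.

End difference_quotient.

(** The difference of the two sides is the contour integral of the difference quotient of f at z,
    whose singularity is removable. *)
Theorem cauchy_formula a b c d f z : a < Re z < b -> c < Im z < d -> entire f ->
  contour a b c d (fun w => f w * (w - z)^-1) =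
  f z * contour a b c d (fun w => (w - z)^-1).
Proof.
move=> zab zcd fe; have [k Hk] := (entireP f).1 fe z.
have iv := edge_continuousV zab zcd.
have fc := pcontinuous_edge a b c d (entire_pcontinuous fe).
rewrite -contourZ//; apply/eqP; rewrite -subr_eq0 -contourB; last 2 first.
- exact: edge_continuousM.
- by apply: edge_continuousM => //; exact: edge_continuous_cst.
have <- := goursat_removable zab zcd (diffquot_continuous Hk fe)
  (@diffquot_derivable f z k fe).
apply/eqP; move: zab zcd => /andP[az zb] /andP[cz zd]; rewrite /contour.
have E w : w != z -> f w * (w - z)^-1 - f z * (w - z)^-1 = diffquot f z k w.
  by move=> wz; rewrite /diffquot (negbTE wz) mulrBl.
congr (seg a b _ - seg a b _ + _ * (seg c d _ - seg c d _)); apply/funext => x;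
  apply: E; apply/eqP => E; move: az zb cz zd; by rewrite -E /= ltxx.
Qed.

(* The inward unit steps in the four hypotheses keep every edge at distance
   between 1 and 3 from [z]; all four edge contributions to the imaginary part
   are nonnegative and the right one alone is at least 1/4. *)
Lemma winding_lower_bound a b c d z :
  Re z - 2 <= a <= Re z - 1 -> Re z + 1 <= b <= Re z + 2 ->
  Im z - 2 <= c <= Im z - 1 -> Im z + 1 <= d <= Im z + 2 ->
  1 / 4 <= normc (contour a b c d (fun w => (w - z)^-1)).
Proof.
move=> /andP[a1 a2] /andP[b1 b2] /andP[c1 c2] /andP[d1 d2].
have zab : a < Re z < b by apply/andP; split; lra.
have zcd : c < Im z < d by apply/andP; split; lra.
have [[_ i1] [_ i2] [r3 _] [r4 _]] := edge_continuousV zab zcd.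
apply: le_trans (Im_le_normc _); apply: le_trans (ler_norm _).
rewrite /contour ImD ImD ImN ImM ReD ReN /= mul0r mul1r add0r.
set S1 := Rintegral _ _ _; set S2 := Rintegral _ _ _.
set S3 := Rintegral _ _ _; set S4 := Rintegral _ _ _.
have den x y : 0 <= Re (((x +i* y)%C - z : R[i])) ^+ 2 + Im ((x +i* y)%C - z) ^+ 2.
  by rewrite addr_ge0 ?sqr_ge0.
have S1p : 0 <= S1.
  apply: Rintegral_ge0 => x _; rewrite ImV -mulNr divr_ge0//.
  by rewrite ImD ImN /=; lra.
have S2p : 0 <= - S2.
  rewrite -[- S2]mulN1r /S2 -RintegralZl//; last exact: continuous_itv_integrable.
  apply: Rintegral_ge0 => x _; rewrite ImV mulN1r opprK divr_ge0//.
  by rewrite ImD ImN /=; lra.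
have S4p : 0 <= - S4.
  rewrite -[- S4]mulN1r /S4 -RintegralZl//; last exact: continuous_itv_integrable.
  apply: Rintegral_ge0 => x _; rewrite ReV mulN1r -mulNr divr_ge0//.
  by rewrite ReD ReN /=; lra.
have S3p : 1 / 4 <= S3.
  apply: (@le_trans _ _ (1 / 8 * (d - c))); first by lra.
  rewrite -(@fine_lebesgue_itv _ c d) ?(le_trans _ d1)//; last by lra.
  rewrite -Rintegral_cst//; apply: le_Rintegral => //.
  - by apply: continuous_itv_integrable => x; exact: cvg_cst.
  - exact: continuous_itv_integrable.
  - move=> y; rewrite /= in_itv/= => /andP[cy yd].
    rewrite ReV ReD ImD ReN ImN /= ler_pdivlMr; last first.
      by rewrite ltr_wpDr ?sqr_ge0// exprn_gt0//; lra.
    have : (b - Re z) ^+ 2 <= 4.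
      have : 0 <= (2 - (b - Re z)) * (2 + (b - Re z)) by rewrite mulr_ge0//; lra.
      by lra.
    have : (y - Im z) ^+ 2 <= 4.
      have : 0 <= (2 - (y - Im z)) * (2 + (y - Im z)) by rewrite mulr_ge0//; lra.
      by lra.
    lra.
lra.
Qed.

End holomorphy.

(** * Taylor estimates and Montel's theorem *)

Section taylor.
Context {R : realType}.
Implicit Types (f g : R[i] -> R[i]) (z w h k : R[i]) (a b c d K : R).

Lemma eq_contour a b c d f g :
  (forall w, [\/ Im w = c, Im w = d, Re w = b | Re w = a] -> f w = g w) ->
  contour a b c d f = contour a b c d g.
Proof.
move=> fg; rewrite /contour.
by congr (seg a b _ - seg a b _ + _ * (seg c d _ - seg c d _)); apply/funext => x;
  apply: fg; [constructor 1|constructor 2|constructor 3|constructor 4].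
Qed.

Section unit_square.
Variables z : R[i].
Let a := Re z - 1. Let b := Re z + 1. Let c := Im z - 1. Let d := Im z + 1.

Lemma unit_square_edge w : on_edges a b c d w -> 1 <= normc (w - z) <= 2.
Proof.
rewrite /on_edges /a /b /c /d => H; apply/andP; split.
  move: H => /orP[] /andP[_ /orP[]] /eqP E.
  - by apply: le_trans (Im_le_normc _); rewrite ImD ImN E addrAC subrr add0r normrN1.
  - by apply: le_trans (Im_le_normc _); rewrite ImD ImN E addrAC subrr add0r normr1.
  - by apply: le_trans (Re_le_normc _); rewrite ReD ReN E addrAC subrr add0r normrN1.
  - by apply: le_trans (Re_le_normc _); rewrite ReD ReN E addrAC subrr add0r normr1.
rewrite (le_trans (normc_le _))// ReD ImD ReN ImN (_ : 2 = 1 + 1)// lerD// ler_norml;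
  move: H => /orP[] /andP[/andP[? ?]] /orP[] /eqP E; rewrite ?E; lra.
Qed.

Lemma near_center h : normc h <= 1 / 2 ->
  a < Re (z + h) < b /\ c < Im (z + h) < d.
Proof.
move=> hh; have := le_trans (Re_le_normc h) hh; have := le_trans (Im_le_normc h) hh.
rewrite !ler_norml /a /b /c /d ReD ImD => /andP[? ?] /andP[? ?].
by split; lra.
Qed.

Lemma unit_square_contour_bound g K : edge_continuous a b c d g ->
  (forall w, 1 <= normc (w - z) <= 2 -> normc (g w) <= K) ->
  normc (contour a b c d g) <= 16 * K.
Proof.
move=> ge gK; apply: le_trans (contour_bound _ _ ge _) _.
- by rewrite /a /b; lra.
- by rewrite /c /d; lra.
- by move=> w /unit_square_edge; exact: gK.
- by rewrite /a /b /c /d; lra.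
Qed.

Let V w := (w - z)^-1.

(** With u = w - z this integrates the identity 1/(u - h) = 1/u + h/u^2 + h^2/(u^2 (u - h)) against
    g. *)
Lemma cauchy_kernel_expansion g h : edge_continuous a b c d g -> normc h <= 1 / 2 ->
  contour a b c d (fun w => g w * (w - (z + h))^-1) =
  contour a b c d (fun w => g w * V w) +
  h * contour a b c d (fun w => g w * (V w * V w)) +
  h ^+ 2 * contour a b c d (fun w => g w * (V w * V w * (w - (z + h))^-1)).
Proof.
move=> ge hh.
have [z1 z2] := near_center hh.
have [] := near_center (h := 0); first by rewrite ComplexField.Normc.normc0.
rewrite addr0 => z3 z4.
have e1 := edge_continuousV z1 z2.
have e2 := edge_continuousV z3 z4.
have e3 := edge_continuousM e2 e2.
have e4 := edge_continuousM ge (edge_continuousM e3 e1).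
have e5 := edge_continuousM ge e3.
have e6 := edge_continuousM ge e2.
rewrite -!contourZ// -!contourD//.
- apply: eq_contour => w ew.
  have n1 : w - z != 0.
    rewrite subr_eq0; apply/eqP => E.
    by move: ew z3 z4; rewrite E => -[] ->; rewrite !ltxx ?andbF.
  have n2 : w - (z + h) != 0.
    rewrite subr_eq0; apply/eqP => E.
    by move: ew z1 z2; rewrite E => -[] ->; rewrite !ltxx ?andbF.
  move: n1 n2; rewrite /V opprD addrA; move: (w - z) => u n1 n2.
  by field; apply/andP; split.
- by apply: edge_continuousD => //; apply: edge_continuousM => //;
    exact: edge_continuous_cst.
- by apply: edge_continuousM => //; exact: edge_continuous_cst.
- by apply: edge_continuousM => //; exact: edge_continuous_cst.
Qed.

Lemma kernel_bounds w h : 1 <= normc (w - z) <= 2 -> normc h <= 1 / 2 ->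
  [/\ normc (V w) <= 1, normc (V w * V w) <= 1 &
      normc (V w * V w * (w - (z + h))^-1) <= 2].
Proof.
move=> /andP[w1 w2] hh.
have V1 : normc (V w) <= 1.
  by rewrite ComplexField.Normc.normcV invf_le1// (lt_le_trans ltr01).
have V0 := normc_ge0 (V w).
have V2 : normc (V w * V w) <= 1.
  by rewrite ComplexField.Normc.normcM mulr_ile1.
split => //; rewrite ComplexField.Normc.normcM -[2]mul1r ler_pM ?normc_ge0//.
have D : 1 / 2 <= normc (w - (z + h)).
  have := normcD (w - (z + h)) h.
  have -> : w - (z + h) + h = w - z by ring.
  lra.
rewrite ComplexField.Normc.normcV -[leRHS]invrK lef_pV2 ?posrE ?invr_gt0//; lra.
Qed.

(** The kernel is expanded to second order on both sides of Cauchy's formula at z + h, for f on the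
    left and for the constant 1 on the right, and the formula at z is subtracted. Division by the
    winding integral k0 costs a factor 4: this gives 256 = 4 * 64 at first order and 4 * 4160,
    rounded up to 20000, at second order. *)
Lemma second_order_estimate f K : entire f -> (forall w, normc (w - z) <= 2 -> normc (f w) <= K) ->
  exists G, forall h, normc h <= 1 / 2 ->
    normc (f (z + h) - f z) <= 256 * K * normc h /\
    normc (f (z + h) - f z - h * G) <= 20000 * K * normc h ^+ 2.
Proof.
move=> fe fK.
have h00 : normc (0 : R[i]) <= 1 / 2 by rewrite ComplexField.Normc.normc0.
have K0 : 0 <= K.
  by apply: le_trans (normc_ge0 _) (fK z _); rewrite subrr ComplexField.Normc.normc0.
have fc := pcontinuous_edge a b c d (entire_pcontinuous fe).
have c1 : edge_continuous a b c d (fun=> 1 : R[i]) by exact: edge_continuous_cst.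
have [z3 z4] := near_center h00; rewrite addr0 in z3 z4.
have e2 := edge_continuousV z3 z4.
have e3 := edge_continuousM e2 e2.
pose k0 := contour a b c d (fun w => 1 * V w).
pose k1 := contour a b c d (fun w => 1 * (V w * V w)).
pose A1 := contour a b c d (fun w => f w * (V w * V w)).
have k0E : k0 = contour a b c d V.
  by congr contour; apply/funext => w; rewrite mul1r.
have k0n : 1 / 4 <= normc k0.
  by rewrite k0E; apply: winding_lower_bound; apply/andP; split; rewrite /a /b /c /d; lra.
have k00 : k0 != 0 by rewrite -normc_gt0; lra.
have fK' w : 1 <= normc (w - z) <= 2 -> normc (f w) <= K by move=> /andP[_]; exact: fK.
have k1n : normc k1 <= 16.
  rewrite -[leRHS]mulr1; apply: unit_square_contour_bound.
    exact: edge_continuousM.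
  by move=> w /(kernel_bounds (h := 0))/(_ h00)[_ H _]; rewrite mul1r.
have A1n : normc A1 <= 16 * K.
  apply: unit_square_contour_bound; first exact: edge_continuousM.
  move=> w w12; have [_ H _] := kernel_bounds w12 h00.
  rewrite ComplexField.Normc.normcM -[leRHS]mulr1 ler_pM ?normc_ge0//.
  exact: fK'.
(* The derivative of f at z, namely the coefficient of h divided by the winding integral. *)
exists ((A1 - f z * k1) / k0) => h hh.
have [z1 z2] := near_center hh.
have e1 := edge_continuousV z1 z2.
pose r1 := contour a b c d (fun w => 1 * (V w * V w * (w - (z + h))^-1)).
pose rf := contour a b c d (fun w => f w * (V w * V w * (w - (z + h))^-1)).
have r1n : normc r1 <= 32.
  rewrite (_ : 32 = 16 * 2); last by ring.
  apply: unit_square_contour_bound.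
    by apply: edge_continuousM => //; exact: edge_continuousM.
  by move=> w /kernel_bounds/(_ hh)[_ _ H]; rewrite mul1r.
have rfn : normc rf <= 32 * K.
  rewrite (_ : 32 * K = 16 * (K * 2)); last by ring.
  apply: unit_square_contour_bound.
    by apply: edge_continuousM => //; exact: edge_continuousM.
  move=> w w12; have [_ _ H] := kernel_bounds w12 hh.
  by rewrite ComplexField.Normc.normcM ler_pM ?normc_ge0// fK'.
have C0 := cauchy_formula z3 z4 fe.
have Ch := cauchy_formula z1 z2 fe.
rewrite (cauchy_kernel_expansion fc hh) in Ch.
have Ck : contour a b c d (fun w => (w - (z + h))^-1) = k0 + h * k1 + h ^+ 2 * r1.
  rewrite -(cauchy_kernel_expansion c1 hh); congr contour.
  by apply/funext => w; rewrite mul1r.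
rewrite Ck C0 -/V -k0E -/A1 -/rf in Ch.
have nh0 := normc_ge0 h.
have fhK : normc (f (z + h)) <= K.
  apply: fK; rewrite addrAC subrr add0r (le_trans hh)//.
  by rewrite ler_pdivrMr// -natrM ler1n.
(* Cauchy's formula at z + h, from which f z * k0 is subtracted. *)
have D1 : (f (z + h) - f z) * k0 =
    h * (A1 + h * rf - f (z + h) * (k1 + h * r1)).
  move/eqP : Ch; rewrite -subr_eq0 => /eqP Ch; apply/eqP.
  by rewrite -subr_eq0 -oppr_eq0 -[X in _ == X]Ch; apply/eqP; ring.
have part K1 x y : normc x <= K1 * 16 -> normc y <= K1 * 32 -> normc (x + h * y) <= 32 * K1.
  move=> xn yn; apply: le_trans (normcD _ _) _; rewrite ComplexField.Normc.normcM.
  have H : normc h * normc y <= 1 / 2 * (K1 * 32) by rewrite ler_pM ?normc_ge0.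
  clear -xn H; lra.
have B1 : normc (A1 + h * rf - f (z + h) * (k1 + h * r1)) <= 64 * K.
  apply: le_trans (normcB _ _) _; rewrite ComplexField.Normc.normcM.
  have p1 := part K A1 rf; have p2 := part 1 k1 r1; rewrite !mul1r in p2.
  have H1 : normc (f (z + h)) * normc (k1 + h * r1) <= K * (32 * 1).
    by rewrite ler_pM ?normc_ge0// p2.
  have H2 : normc (A1 + h * rf) <= 32 * K by apply: p1; rewrite mulrC.
  clear -H1 H2; lra.
have ndiv x y : x * k0 = y -> normc x <= 4 * normc y.
  move=> <-; rewrite ComplexField.Normc.normcM.
  have H : normc x * (1 / 4) <= normc x * normc k0 by rewrite ler_wpM2l ?normc_ge0.
  clear -H; lra.
have L : normc (f (z + h) - f z) <= 256 * K * normc h.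
  apply: le_trans (ndiv _ _ D1) _; rewrite ComplexField.Normc.normcM.
  have H : normc h * normc (A1 + h * rf - f (z + h) * (k1 + h * r1)) <= normc h * (64 * K).
    by rewrite ler_wpM2l.
  clear -H; lra.
split => //.
(* In the k1 term f (z + h) is traded for f z; the error is of second order by the estimate [L]. *)
have D2 : (f (z + h) - f z - h * ((A1 - f z * k1) / k0)) * k0 =
    h ^+ 2 * (rf - f (z + h) * r1) - (f (z + h) - f z) * (h * k1).
  have -> : (f (z + h) - f z - h * ((A1 - f z * k1) / k0)) * k0 =
     (f (z + h) - f z) * k0 - h * (A1 - f z * k1) by field.
  by rewrite D1; ring.
apply: le_trans (ndiv _ _ D2) _.
have M1 : normc (h ^+ 2 * (rf - f (z + h) * r1)) <= normc h ^+ 2 * (64 * K).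
  rewrite ComplexField.Normc.normcM normcX ler_wpM2l ?exprn_ge0//.
  apply: le_trans (normcB _ _) _; rewrite ComplexField.Normc.normcM.
  have H : normc (f (z + h)) * normc r1 <= K * 32 by rewrite ler_pM ?normc_ge0.
  clear -H rfn; lra.
have M2 : normc ((f (z + h) - f z) * (h * k1)) <= 256 * K * normc h * (normc h * 16).
  by rewrite !ComplexField.Normc.normcM ler_pM ?mulr_ge0 ?normc_ge0// ler_wpM2l.
have M := le_trans (normcB _ _) (lerD M1 M2).
have E : normc h ^+ 2 * (64 * K) + 256 * K * normc h * (normc h * 16) =
   4160 * K * normc h ^+ 2 by ring.
have P : 0 <= K * normc h ^+ 2 by rewrite mulr_ge0 ?exprn_ge0.
rewrite E in M; clear -M P; lra.
Qed.

End unit_square.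

(* A derivative-free form of the second order Taylor estimate: it passes to
   pointwise limits and to integral means of functions. *)
Definition slope_estimate (C : R) f z := forall h h',
  normc h <= 1 / 2 -> normc h' <= 1 / 2 ->
  normc (h' * (f (z + h) - f z) - h * (f (z + h') - f z)) <=
    C * normc h * normc h' * (normc h + normc h').

(** The unknown derivative drops out of the combination h' * (increment at h) - h * (increment at
    h'). *)
Lemma entire_slope_estimate f z K : entire f ->
  (forall w, normc (w - z) <= 2 -> normc (f w) <= K) ->
  slope_estimate (20000 * K) f z.
Proof.
move=> fe fK; have [G HG] := second_order_estimate fe fK.
move=> h h' hh hh'; have [_ E] := HG h hh; have [_ E'] := HG h' hh'.
have -> : h' * (f (z + h) - f z) - h * (f (z + h') - f z) =
  h' * (f (z + h) - f z - h * G) - h * (f (z + h') - f z - h' * G) by ring.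
apply: le_trans (normcB _ _) _; rewrite !ComplexField.Normc.normcM.
apply: le_trans (lerD (ler_wpM2l (normc_ge0 h') E) (ler_wpM2l (normc_ge0 h) E')) _.
by rewrite le_eqVlt; apply/orP; left; apply/eqP; ring.
Qed.

(** The image of [U] clusters at a point of the compact interval [-M, M], and an ultrafilter
    converges to each of its cluster points. *)
Lemma bounded_ultra_limit_real (U : set_system nat) (x : nat -> R) (M : R) :
  UltraFilter U -> (forall n, `|x n| <= M) ->
  exists l, forall e : R, 0 < e -> U [set n | `|x n - l| < e].
Proof.
move=> FU xM; have FP := @ultra_proper _ _ FU.
have := @segment_compact R (- M) M; rewrite /compact /=.
move=> /(_ (x @ U) (fmap_proper_filter x FP)).
have xU : (x @ U) `[- M, M]%classic.
  by rewrite /fmap /=; apply: filterE => n; rewrite /= in_itv/= -ler_norml.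
move=> /(_ xU)[l [_ Cl]]; exists l => e e0.
have [//|H] := in_ultra_setVsetC [set n | `|x n - l| < e] FU.
have [y [/= Hy ly]] := Cl [set y | ~ (`|y - l| < e)] (ball l e) H (nbhsx_ballx _ _ e0).
by exfalso; apply: Hy; move: ly; rewrite /ball /= distrC.
Qed.

Lemma bounded_ultra_limit (U : set_system nat) (x : nat -> R[i]) (M : R) :
  UltraFilter U -> (forall n, normc (x n) <= M) ->
  exists l, forall e : R, 0 < e -> U [set n | normc (x n - l) < e].
Proof.
move=> FU xM; have FP := @ultra_proper _ _ FU.
have [l1 H1] := @bounded_ultra_limit_real U (fun n => Re (x n)) M FU
  (fun n => le_trans (Re_le_normc _) (xM n)).
have [l2 H2] := @bounded_ultra_limit_real U (fun n => Im (x n)) M FU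
  (fun n => le_trans (Im_le_normc _) (xM n)).
exists (l1 +i* l2)%C => e e0.
have e2 : 0 < e / 2 by rewrite divr_gt0.
apply: filterS (filterI (H1 _ e2) (H2 _ e2)) => n [/= L1 L2].
rewrite (le_lt_trans (normc_le _))// ReD ImD ReN ImN /= (splitr e).
exact: ltrD.
Qed.

(** Divided by h h', the estimate says that two difference quotients differ by at most C (|h| +
    |h'|). The quotients along a null sequence are thus bounded; their limit along an ultrafilter is
    the derivative, and every quotient at h is within C |h| of it. *)
Lemma slope_estimate_cderivable (C : R) f z : slope_estimate C f z -> cderivable f z.
Proof.
move=> fC.
(* Starting at 1/2 keeps all increments in the range of the slope estimate. *)
pose u (n : nat) : R[i] := ((n.+2%:R)^-1 : R)%:C%C.
have un n : normc (u n) = n.+2%:R^-1 by rewrite normc_real ger0_norm// invr_ge0.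
have u0 n : u n != 0 by rewrite -normc_gt0 un invr_gt0.
have uh n : normc (u n) <= 1 / 2.
  by rewrite un div1r lef_pV2 ?posrE// ler_nat.
have C0 : 0 <= C.
  have := le_trans (normc_ge0 _) (fC (u 0%N) (u 0%N) (uh 0%N) (uh 0%N)).
  have i2 : 0 < 2%:R^-1 :> R by rewrite invr_gt0.
  by rewrite un -!mulrA pmulr_lge0// !mulr_gt0// addr_gt0.
pose s (h : R[i]) := (f (z + h) - f z) / h.
have sE h h' : h != 0 -> h' != 0 -> normc h <= 1 / 2 -> normc h' <= 1 / 2 ->
    normc (s h - s h') <= C * (normc h + normc h').
  move=> h0 h'0 hh hh'; have := fC h h' hh hh'.
  have -> : h' * (f (z + h) - f z) - h * (f (z + h') - f z) = h * h' * (s h - s h').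
    by rewrite /s; field; rewrite h0 h'0.
  rewrite !ComplexField.Normc.normcM.
  have -> : C * normc h * normc h' * (normc h + normc h') =
    normc h * normc h' * (C * (normc h + normc h')) by ring.
  by rewrite ler_pM2l// mulr_gt0// normc_gt0.
have [U [FU oU]] := @ultraFilterLemma nat \oo _.
have FP := @ultra_proper _ _ FU.
have sb n : normc (s (u n)) <= normc (s (u 0%N)) + C.
  rewrite -(subrK (s (u 0%N)) (s (u n))) (le_trans (normcD _ _))// addrC lerD2l.
  apply: le_trans (sE _ _ (u0 _) (u0 _) (uh _) (uh _)) _.
  rewrite ler_piMr//; have := uh n; have := uh 0%N; lra.
have [k Hk] := bounded_ultra_limit FU sb.
have sk h : h != 0 -> normc h <= 1 / 2 -> normc (s h - k) <= C * normc h.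
  move=> h0 hh; apply/ler_addgt0Pr => e e0.
  have e2 : 0 < e / 2 by rewrite divr_gt0.
  have [N HN] : exists N, C / N.+2%:R <= e / 2.
    have [N HN] : exists N, C / (e / 2) < N.+2%:R.
      exists (Num.truncn (C / (e / 2))); apply: lt_trans (truncnS_gt _) _.
      by rewrite ltr_nat.
    by exists N; rewrite ler_pdivrMr// mulrC -ler_pdivrMr// ltW.
  have UN : U [set n | (N <= n)%N] by apply: oU; exists N.
  have [n [/= Nn skn]] := filter_ex (filterI UN (Hk _ e2)).
  rewrite -(subrKA (s (u n)) (s h)) (le_trans (normcD _ _))//.
  have := sE _ _ h0 (u0 n) hh (uh n); rewrite un mulrDr => H.
  have : C / n.+2%:R <= e / 2.
    apply: le_trans HN; rewrite ler_wpM2l// lef_pV2 ?posrE// ler_nat.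
    by rewrite !ltnS.
  move=> H2; apply: le_trans (lerD H (ltW skn)) _.
  by rewrite -addrA lerD2l [leRHS]splitr lerD2r.
exists k => e e0; exists (Num.min (1 / 2) (e / (C + 1))).
  by rewrite lt_min !divr_gt0// ltr_wpDl.
move=> w; rewrite lt_min => /andP[/ltW wh we].
have [->|wz] := eqVneq w z.
  by rewrite !subrr mulr0 subr0 ComplexField.Normc.normc0 mulr0.
have wz' : w - z != 0 by rewrite subr_eq0.
have -> : f w - f z - k * (w - z) = (s (w - z) - k) * (w - z).
  by rewrite /s (addrC z) subrK; field.
rewrite ComplexField.Normc.normcM ler_wpM2r ?normc_ge0//.
apply: le_trans (sk _ wz' wh) _.
move: we; rewrite ltr_pdivlMr ?ltr_wpDl// => we.
have := normc_ge0 (w - z); lra.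
Qed.

Lemma slope_estimate_entire (C : R[i] -> R) f :
  (forall z, slope_estimate (C z) f z) -> entire f.
Proof. by move=> fC; apply/entireP => z; exact: slope_estimate_cderivable (fC z). Qed.

End taylor.

Section montel.
Context {R : realType}.
Implicit Types (f g : R[i] -> R[i]) (z w h : R[i]).

Lemma rational_complex_dense z (r : R) : 0 < r ->
  exists q : rat * rat, normc ((ratr q.1 +i* ratr q.2)%C - z) < r.
Proof.
move=> r0; have itv (x : R) : x - r / 2 < x + r / 2.
  by rewrite ltrD2l -subr_gt0 opprK -splitr.
have [q1 /=] := rat_in_itvoo (itv (Re z)); rewrite in_itv/= => /andP[? ?].
have [q2 /=] := rat_in_itvoo (itv (Im z)); rewrite in_itv/= => /andP[? ?].
exists (q1, q2) => /=; rewrite (le_lt_trans (normc_le _))// ReD ImD ReN ImN /=.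
by rewrite [ltRHS]splitr ltrD// ltr_norml; lra.
Qed.

(** Only the values at z, z + h and z + h' occur, so closeness of u n to g at three points is
    enough. *)
Lemma slope_estimate_limit (U : set_system nat) (u : nat -> R[i] -> R[i]) g (C : R) z :
  ProperFilter U -> (forall n, slope_estimate C (u n) z) ->
  (forall w (e : R), 0 < e -> U [set n | normc (u n w - g w) < e]) ->
  slope_estimate C g z.
Proof.
move=> FU uC ug h h' hh hh'; apply/ler_addgt0Pr => e e0.
have e2 : 0 < e / 2 by rewrite divr_gt0.
have [n /= [[H1 H2] H3]] := filter_ex
  (filterI (filterI (ug (z + h) _ e2) (ug (z + h') _ e2)) (ug z _ e2)).
have -> : h' * (g (z + h) - g z) - h * (g (z + h') - g z) =
  h' * (u n (z + h) - u n z) - h * (u n (z + h') - u n z) +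
  (h * ((u n (z + h') - g (z + h')) - (u n z - g z)) -
   h' * ((u n (z + h) - g (z + h)) - (u n z - g z))) by ring.
apply: le_trans (normcD _ _) _; apply: lerD; first exact: uC.
apply: le_trans (normcB _ _) _; rewrite !ComplexField.Normc.normcM.
have D (x y k : R[i]) : normc k <= 1 / 2 -> normc x < e / 2 -> normc y < e / 2 ->
    normc k * normc (x - y) <= e / 2.
  move=> kk xe ye; rewrite -[leRHS]mulrC -[2^-1]mul1r ler_pM ?normc_ge0//.
  by rewrite (le_trans (normcB _ _))// [leRHS]splitr lerD// ltW.
by rewrite [leRHS]splitr lerD// D.
Qed.

(** An ultrafilter finer than [\oo] yields a limit g at all points simultaneously, so no diagonal
    argument is needed to define it; g is entire by the slope estimate. A genuine subsequence is
    then selected to approach g at the Gaussian rationals, and the uniform Lipschitz bound of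
    [second_order_estimate] extends convergence to every point. *)
Lemma montel (u : nat -> R[i] -> R[i]) (K : R -> R) :
  (forall n, entire (u n)) ->
  (forall n z r, normc z <= r -> normc (u n z) <= K r) ->
  exists (phi : nat -> nat) (g : R[i] -> R[i]),
    [/\ {homo phi : m n / (m < n)%N >-> (m < n)%N}, entire g &
        forall z, normc (u (phi n) z - g z) @[n --> \oo] --> (0 : R)].
Proof.
move=> ue uK.
have uK' z n w : normc (w - z) <= 2 -> normc (u n w) <= K (normc z + 2).
  by move=> wz; apply: uK; rewrite -(subrK z w) (le_trans (normcD _ _))// addrC lerD2l.
have [U [FU oU]] := @ultraFilterLemma nat \oo _.
have FP := @ultra_proper _ _ FU.
have /choice[g Hg] : forall z, exists gz, forall e : R, 0 < e ->
    U [set n | normc (u n z - gz) < e].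
  by move=> z; apply: (@bounded_ultra_limit _ _ _ (K (normc z))) => // n; exact: uK.
have ge : entire g.
  apply: (@slope_estimate_entire _ (fun z => 20000 * K (normc z + 2))) => z.
  apply: (slope_estimate_limit FP _ Hg) => n.
  by apply: entire_slope_estimate => // w; exact: uK'.
(* An enumeration of the Gaussian rationals; codes of nothing are sent to 0. *)
pose q n : R[i] := if @unpickle (rat * rat)%type n is Some q
  then (ratr q.1 +i* ratr q.2)%C else 0.
pose close m k := forall n, (n <= m)%N -> normc (u k (q n) - g (q n)) < m.+1%:R^-1.
(* Given a stage m and the previous index p, a later index is picked at which u is within 1/(m+1) of
   g at the first m+1 rational points. *)
have /choice[s Hs] : forall mp : nat * nat, exists k, (mp.2 < k)%N /\ close mp.1 k.
  move=> [m p] /=.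
  have Up : U [set n | (p < n)%N] by apply: oU; exists p.+1.
  have Uc : U [set k | forall i : 'I_m.+1, normc (u k (q i) - g (q i)) < m.+1%:R^-1].
    by apply: filter_forall => i; apply: Hg; rewrite invr_gt0.
  have [k [/= pk ck]] := filter_ex (filterI Up Uc); exists k; split => // n nm.
  by have := ck (Ordinal (nm : (n < m.+1)%N)).
pose phi := fix phi m := if m is m'.+1 then s (m, phi m') else s (0%N, 0%N).
exists phi, g; split => //.
  by apply: homo_ltn => [a b c|n]; [exact: ltn_trans|case: (Hs (n.+1, phi n))].
have phic m : close m (phi m).
  by case: m => [|m]; [case: (Hs (0%N, 0%N))|case: (Hs (m.+1, phi m))].
move=> z; apply/cvgrPdist_lt => e e0.
have e3 : 0 < e / 3 by rewrite divr_gt0.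
have [r r0 gr] := entire_pcontinuous ge z e3.
have K0 : 0 <= K (normc z + 2).
  by apply: le_trans (normc_ge0 _) (uK' z 0%N z _); rewrite subrr ComplexField.Normc.normc0.
have L0 : 0 < 256 * K (normc z + 2) + 1.
  by move: K0; clear; lra.
(* A rational point this close to z serves three ends: continuity of g, the range of
   [second_order_estimate], and a variation of every u n below e / 3. *)
pose r' := Num.min (Num.min r (1 / 2)) (e / 3 / (256 * K (normc z + 2) + 1)).
have r'0 : 0 < r' by rewrite !lt_min r0 !divr_gt0.
have [qq Hqq] := rational_complex_dense z r'0.
have [n qn] : exists n, q n = (ratr qq.1 +i* ratr qq.2)%C.
  by exists (pickle qq); rewrite /q pickleK.
move: Hqq; rewrite -qn !lt_min => /andP[/andP[qr q1]].
rewrite ltr_pdivlMr// => q2.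
have [N HN] : exists N, N.+1%:R^-1 < e / 3.
  exists (Num.truncn (e / 3)^-1); rewrite -[ltRHS]invrK ltf_pV2 ?posrE ?invr_gt0//.
  exact: truncnS_gt.
exists (maxn n N) => // m; rewrite /= geq_max => /andP[nm Nm].
rewrite sub0r normrN ger0_norm ?normc_ge0//.
have [G /(_ (q n - z) (ltW q1))[+ _]] := second_order_estimate (ue (phi m)) (@uK' z (phi m)).
rewrite (addrC z) subrK => A1.
have A2 := phic m n nm.
have A3 := gr _ qr.
have A4 : m.+1%:R^-1 < e / 3.
  by apply: le_lt_trans HN; rewrite lef_pV2 ?posrE// ler_nat.
have -> : u (phi m) z - g z = (u (phi m) (q n) - g (q n)) + (g (q n) - g z)
   - (u (phi m) (q n) - u (phi m) z) by ring.
apply: le_lt_trans (normcB _ _) _.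
apply: le_lt_trans (lerD (normcD _ _) (lexx _)) _.
have A5 : normc (u (phi m) (q n) - u (phi m) z) < e / 3.
  apply: le_lt_trans A1 (le_lt_trans _ q2).
  by rewrite mulrC ler_wpM2l ?normc_ge0// lerDl.
have -> : e = e / 3 + e / 3 + e / 3 by field.
by apply: ltrD => //; apply: ltrD => //; exact: lt_trans A4.
Qed.

End montel.

(** * Integrals over the plane and growth of Fock functions *)

Section plane_measurability.
Context {R : realType}.
Implicit Types (F : R * R -> R) (f : R[i] -> R[i]).

Definition continuous2 F := forall p (e : R), 0 < e -> exists2 r : R, 0 < r &
  forall q, `|q.1 - p.1| < r -> `|q.2 - p.2| < r -> `|F q - F p| < e.

(** The set where F exceeds a is the union of the countably many rational boxes it contains, and
    boxes are measurable for the product structure. *)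
Lemma continuous2_measurable F : continuous2 F -> measurable_fun setT F.
Proof.
move=> cF; apply: (measurability _ (RGenOInfty.measurableE R)).
move=> _ [_ [a ->] <-]; rewrite setTI.
pose box (q : (rat * rat) * (rat * rat)) : set (R * R) :=
  `]ratr q.1.1, ratr q.1.2[%classic `*` `]ratr q.2.1, ratr q.2.2[%classic.
pose O := F @^-1` `]a, +oo[.
pose G n : set (R * R) := if @unpickle ((rat * rat) * (rat * rat))%type n is Some q
  then (if `[< box q `<=` O >] then box q else set0) else set0.
suff -> : F @^-1` `]a, +oo[ = \bigcup_n G n.
  apply: bigcupT_measurable => n; rewrite /G; case: unpickle => // q.
  by case: ifP => // _; exact: measurableX.
apply/seteqP; split=> [[x y] /= Fxy|p [n _]]; last first.
  by rewrite /G; case: unpickle => // q; case: ifPn => // /asboolP; apply.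
have ea : 0 < F (x, y) - a by move: Fxy; rewrite in_itv/= andbT subr_gt0.
have [r r0 Hr] := cF (x, y) _ ea.
have i1 (t : R) : t - r < t by rewrite ltrBlDr ltrDl.
have i2 (t : R) : t < t + r by rewrite ltrDl.
have [q1 /=] := rat_in_itvoo (i1 x); rewrite in_itv/= => /andP[a1 a2].
have [q2 /=] := rat_in_itvoo (i2 x); rewrite in_itv/= => /andP[a3 a4].
have [q3 /=] := rat_in_itvoo (i1 y); rewrite in_itv/= => /andP[a5 a6].
have [q4 /=] := rat_in_itvoo (i2 y); rewrite in_itv/= => /andP[a7 a8].
exists (pickle ((q1, q2), (q3, q4))); first exact: I.
rewrite /G pickleK asboolT; first by split; rewrite /= in_itv/= ?a2 ?a3 ?a6 ?a7.
move=> [x' y'] [] /=; rewrite !in_itv/= => /andP[b1 b2] /andP[b3 b4].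
rewrite /O /= in_itv/= andbT.
have := Hr (x', y'); rewrite /= !ltr_norml => H.
have /andP[+ _] : - (F (x, y) - a) < F (x', y') - F (x, y) < F (x, y) - a.
  by apply: H; apply/andP; split; lra.
lra.
Qed.

(** Stated for a general 1-Lipschitz L so as to cover [normc], [Re] and [Im] at once. *)
Lemma lipschitz_comp_measurable f (L : R[i] -> R) : pcontinuous f ->
  (forall z w, `|L z - L w| <= normc (z - w)) ->
  measurable_fun setT (fun xy : R * R => L (f (xy.1 +i* xy.2)%C)).
Proof.
move=> cf L1; apply: continuous2_measurable => -[x y] e e0.
have [r r0 fr] := cf (x +i* y)%C e e0; exists (r / 2); first by rewrite divr_gt0.
move=> [x' y'] /= xx yy; apply: le_lt_trans (L1 _ _) _; apply: fr.
by rewrite (le_lt_trans (normc_le _))// ReD ImD ReN ImN /= [ltRHS]splitr ltrD.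
Qed.

Lemma normc_lipschitz (z w : R[i]) : `|normc z - normc w| <= normc (z - w).
Proof.
rewrite ler_norml; apply/andP; split.
  rewrite lerNl opprB lerBlDr normcBC -[X in normc X <= _](subrK z w).
  exact: normcD.
by rewrite lerBlDr -[X in normc X <= _](subrK w z) normcD.
Qed.

Lemma Re_lipschitz (z w : R[i]) : `|Re z - Re w| <= normc (z - w).
Proof. by rewrite -ReN -ReD Re_le_normc. Qed.

Lemma Im_lipschitz (z w : R[i]) : `|Im z - Im w| <= normc (z - w).
Proof. by rewrite -ImN -ImD Im_le_normc. Qed.

Lemma measurable_gauss_weight (k : R) :
  measurable_fun setT (fun xy : R * R => expR (k * (xy.1 ^+ 2 + xy.2 ^+ 2))).
Proof.
apply: measurableT_comp => //; apply: measurable_funM => //.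
by apply: measurable_funD; apply: measurable_funX;
  [exact: measurable_fst|exact: measurable_snd].
Qed.

Lemma measurable_fock_integrand (p alpha : R) f : pcontinuous f ->
  measurable_fun setT (fock_integrand p alpha f).
Proof.
move=> cf; rewrite /fock_integrand.
apply: (measurableT_comp (f := fun x : R => x `^ p)); first exact: measurable_powR.
apply: measurable_funM; last exact: measurable_gauss_weight.
exact: (lipschitz_comp_measurable cf normc_lipschitz).
Qed.

Lemma fock_integrand_ge0 (p alpha : R) f xy : 0 <= fock_integrand p alpha f xy.
Proof. exact: powR_ge0. Qed.

End plane_measurability.

Section lebesgue_scaling.
Context {R : realType}.
Local Notation leb := (@lebesgue_measure R).
Local Open Scope ereal_scope.

(** The image of Lebesgue measure under x -> x s, multiplied by s, gives half-open intervals their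
    length, so it is Lebesgue measure by uniqueness. *)
Lemma integral_lebesgue_scale (s : R) (G : R -> \bar R) : (0 < s)%R ->
  measurable_fun setT G -> (forall x, 0 <= G x) ->
  \int[leb]_x G (x * s)%R = (s^-1)%:E * \int[leb]_x G x.
Proof.
move=> s0 mG G0.
pose phi (x : measurableTypeR R) : measurableTypeR R := (x * s)%R.
have ms : measurable_fun setT phi.
  by apply: measurable_funM.
pose sn : {nonneg R} := NngNum (ltW s0).
pose P := measure_function_pushforward__canonical__measure_function_Measure leb ms.
pose m :=
  measure_function_mscale__canonical__measure_function_Measure sn P.
have mE A : measurable A -> leb A = m A.
  apply: lebesgue_measure_unique => _ [[a b] _ <-] /=.
  rewrite /m /= /mscale /= /pushforward.
  have -> : phi @^-1` `]a, b]%classic = `](a / s)%R, (b / s)%R]%classic.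
    apply/seteqP; split=> x /=; rewrite !in_itv/= ltr_pdivrMr// ler_pdivlMr//.
  rewrite !lebesgue_measure_itv/= !lte_fin ltr_pM2r ?invr_gt0//.
  case: ifP => _; last by rewrite mule0.
  by rewrite -!EFinB -EFinM mulrC -mulrBl divfK ?gt_eqF.
have -> : \int[leb]_x G x = \int[m]_x G x.
  by apply: eq_measure_integral => A mA _; exact: mE.
rewrite /m (ge0_integral_mscale _ _ sn)//= (ge0_integral_pushforward ms)//.
rewrite muleA -EFinM mulVf ?gt_eqF// mul1e preimage_setT.
by apply: eq_integral.
Qed.

End lebesgue_scaling.

Section plane_integrals.
Context {R : realType}.
Local Notation leb := (@lebesgue_measure R).
Local Open Scope ereal_scope.

Lemma integral2_scale (s : R) (F : R * R -> \bar R) : (0 < s)%R ->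
  measurable_fun setT F -> (forall xy, 0 <= F xy) ->
  \int[leb \x leb]_xy F (xy.1 * s, xy.2 * s)%R =
    (s^-1 ^+ 2)%:E * \int[leb \x leb]_xy F xy.
Proof.
move=> s0 mF F0.
have mFs : measurable_fun setT (fun xy : R * R => F (xy.1 * s, xy.2 * s)%R).
  apply: measurableT_comp mF _; apply: measurable_fun_pair.
    by apply: measurable_funM => //; exact: measurable_fst.
  by apply: measurable_funM => //; exact: measurable_snd.
rewrite fubini_tonelli1// /fubini_F /=.
under eq_integral => x _.
  rewrite (@integral_lebesgue_scale _ s (fun y => F (x * s, y)%R))//; last first.
    exact: measurable_fun_pair2.
  over.
rewrite ge0_integralZl//; last 3 first.
- apply: (@measurableT_comp _ _ _ _ _ _ (fubini_F leb F)).
    exact: measurable_fun_fubini_tonelli_F.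
  by apply: measurable_funM.
- by move=> x _; exact: integral_ge0.
- by rewrite lee_fin invr_ge0 ltW.
rewrite (@integral_lebesgue_scale _ s (fun x => \int[leb]_y F (x, y)))//; last 2 first.
- exact: measurable_fun_fubini_tonelli_F.
- by move=> x; exact: integral_ge0.
by rewrite muleA -EFinM -expr2 fubini_tonelli1.
Qed.

Lemma integral_gauss_lty (k : R) : (0 < k)%R ->
  \int[leb]_x (expR (- k * x ^+ 2))%:E < +oo.
Proof.
move=> k0; have s0 : (0 < Num.sqrt k)%R by rewrite sqrtr_gt0.
have -> : \int[leb]_x (expR (- k * x ^+ 2))%:E =
    \int[leb]_x ((EFin \o @gauss_fun R) (x * Num.sqrt k)%R).
  apply: eq_integral => x _ /=; rewrite /gauss_fun exprMn sqr_sqrtr ?ltW//.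
  by rewrite mulNr mulrC.
rewrite integral_lebesgue_scale//; last 2 first.
- by apply/measurable_EFinP; exact: measurable_gauss_fun.
- by move=> x; rewrite lee_fin gauss_fun_ge0.
by rewrite /= integralT_gauss -EFinM ltry.
Qed.

Lemma integral2_gauss_lty (k : R) : (0 < k)%R ->
  \int[leb \x leb]_xy (expR (- k * (xy.1 ^+ 2 + xy.2 ^+ 2)))%:E < +oo.
Proof.
move=> k0; have := integral_gauss_lty k0.
set I := \int[leb]_x _ => Ioo.
have m1 : measurable_fun setT (fun x : R => (expR (- k * x ^+ 2))%:E).
  apply/measurable_EFinP; apply: measurableT_comp => //.
  by apply: measurable_funM => //; exact: exprn_measurable.
have I0 : 0 <= I by apply: integral_ge0 => x _; rewrite lee_fin expR_ge0.
have If : I \is a fin_num by rewrite ge0_fin_numE.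
pose g (xy : R * R) := (expR (- k * (xy.1 ^+ 2 + xy.2 ^+ 2)))%:E.
have mg : measurable_fun setT g.
  by apply/measurable_EFinP; exact: measurable_gauss_weight.
have g0 xy : 0 <= g xy by rewrite lee_fin expR_ge0.
have -> : \int[leb \x leb]_xy g xy = \int[leb]_x fubini_F leb g x.
  exact: fubini_tonelli1.
rewrite /fubini_F /g /=.
under eq_integral => x _.
  under eq_integral => y _ do rewrite mulrDr expRD EFinM.
  rewrite ge0_integralZl// muleC -/I; over.
rewrite ge0_integralZl//.
by rewrite -/I -(fineK If) -EFinM ltry.
Qed.

(** If G exceeded J + 1 on all of [t, t + 1], its integral would exceed J. With G the integral of
    the Fock integrand along a line, this places an edge of a contour on a line that is under
    control. *)
Lemma good_line (G : R -> \bar R) (J t : R) : measurable_fun setT G ->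
  (forall x, 0 <= G x) -> \int[leb]_x G x <= J%:E ->
  exists2 c : R, (t <= c <= t + 1)%R & G c <= (J + 1)%:E.
Proof.
move=> mG G0 GJ; apply: contrapT => H.
have HG c : (t <= c <= t + 1)%R -> (J + 1)%:E <= G c.
  move=> tc; rewrite leNgt; apply/negP => Gc; apply: H; exists c => //.
  exact: ltW.
have J0 : 0 <= J%:E by apply: le_trans GJ; exact: integral_ge0.
have : \int[leb]_(x in `[t, (t + 1)%R]) (J + 1)%:E <= J%:E.
  apply: le_trans GJ.
  apply: (@le_trans _ _ (\int[leb]_(x in `[t, (t + 1)%R]) G x)); last first.
    exact: ge0_subset_integral.
  apply: ge0_le_integral => //.
    by move=> x _; rewrite lee_fin addr_ge0.
  exact: measurable_funTS.
rewrite integral_cst//= lebesgue_measure_itv/= lte_fin ltrDl ltr01.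
by rewrite -EFinD -EFinM lee_fin addrAC subrr add0r mulr1 gerDl ler10.
Qed.

Lemma seg_dominated (a b E J : R) (phi : R -> R) (g : R -> R[i]) :
  (a <= b)%R -> (b <= a + 4)%R -> (0 <= E)%R ->
  measurable_fun setT phi -> (forall x, 0 <= phi x)%R ->
  \int[leb]_x (phi x)%:E <= J%:E ->
  ccontinuous g ->
  (forall x, (a <= x)%R -> (x <= b)%R -> (normc (g x) <= E * (1 + phi x))%R) ->
  (normc (seg a b g) <= 2 * E * (4 + J))%R.
Proof.
move=> ab b4 E0 mphi phi0 phiJ cg gphi.
have phiab : \int[leb]_(x in `[a, b]) (phi x)%:E <= J%:E.
  apply: le_trans phiJ; apply: ge0_subset_integral => //.
  - exact/measurable_EFinP.
  - by move=> x _; rewrite lee_fin.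
have ic : leb.-integrable `[a, b] (EFin \o cst (1 : R)%R).
  by apply: continuous_itv_integrable => x; exact: cvg_cst.
have iphi : leb.-integrable `[a, b] (EFin \o phi).
  apply/integrableP; split; first by apply: measurable_funTS; exact/measurable_EFinP.
  under eq_integral => x _ do rewrite /= ger0_norm//.
  by apply: le_lt_trans phiab _; rewrite ltry.
have is_ : leb.-integrable `[a, b] (EFin \o (fun x => 1 + phi x)%R).
  exact: (integrableD _ ic iphi).
have ih : leb.-integrable `[a, b] (EFin \o (fun x => E * (1 + phi x))%R).
  exact: (integrableZl _ E is_).
apply: le_trans (le_normc_cintegral _ (seg_integrable a b cg) ih _) _ => //.
  by move=> x; rewrite /= in_itv/= => /andP[]; exact: gphi.
rewrite -mulrA ler_wpM2l// RintegralZl// ler_wpM2l//.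
rewrite (RintegralD _ ic iphi)// Rintegral_cst// fine_lebesgue_itv// mul1r.
apply: lerD; first by rewrite lerBlDr addrC.
rewrite /Rintegral -lee_fin fineK//.
by rewrite ge0_fin_numE ?(le_lt_trans phiab) ?ltry//; apply: integral_ge0 => x _; rewrite lee_fin.
Qed.

End plane_integrals.

Section fock_growth.
Context {R : realType}.
Local Notation leb := (@lebesgue_measure R).
Variables (p alpha : R).
Hypotheses (p1 : 1 < p) (alpha0 : 0 < alpha).

Lemma fock_integral_ge0 f : (0 <= fock_integral p alpha f)%E.
Proof. by apply: integral_ge0 => xy _; rewrite lee_fin fock_integrand_ge0. Qed.

(** Young's inequality 2 x d <= eps x^2 + eps^-1 d^2 for d = t - x. It is the source of the loss 1 +
    eps in the growth exponent. *)
Lemma sqr_shift_le (eps x t : R) : 0 < eps -> `|t - x| <= 2 ->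
  t ^+ 2 <= (1 + eps) * x ^+ 2 + (1 + eps^-1) * 4.
Proof.
move=> e0 tx; have : (t - x) ^+ 2 <= 4.
  by rewrite -real_normK ?num_real// (_ : 4 = 2 ^+ 2) ?lerXn2r// ?nnegrE//; ring.
set d := t - x => d4; have -> : t = x + d by rewrite /d addrC subrK.
have : 0 <= eps^-1 * (eps * x - d) ^+ 2 by rewrite mulr_ge0 ?invr_ge0 ?sqr_ge0 ?ltW.
have -> : eps^-1 * (eps * x - d) ^+ 2 = eps * x ^+ 2 - 2 * x * d + eps^-1 * d ^+ 2.
  by field; rewrite gt_eqF.
have : (1 + eps^-1) * d ^+ 2 <= (1 + eps^-1) * 4.
  by rewrite ler_wpM2l// addr_ge0// invr_ge0 ltW.
lra.
Qed.

(** The weighted modulus m satisfies m <= 1 + m^p, as p > 1: either m <= 1 or m <= m^p. *)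
Lemma normc_le_fock_integrand f (w : R[i]) :
  normc (f w) <= expR (alpha / 2 * (Re w ^+ 2 + Im w ^+ 2)) *
     (1 + fock_integrand p alpha f (Re w, Im w)).
Proof.
rewrite /fock_integrand /=.
have -> : (Re w +i* Im w)%C = w by case: w.
set q := Re w ^+ 2 + Im w ^+ 2.
set m := normc (f w) * expR (- (alpha / 2) * q).
have -> : normc (f w) = expR (alpha / 2 * q) * m.
  by rewrite /m mulrCA -expRD mulNr subrr expR0 mulr1.
rewrite ler_wpM2l ?expR_ge0//.
have m0 : 0 <= m by rewrite mulr_ge0 ?normc_ge0 ?expR_ge0.
have [m1|m1] := leP m 1; first by rewrite (le_trans m1)// lerDl powR_ge0.
rewrite -[leLHS]add0r lerD// -[leLHS]powRr1// ler_powR// ltW//.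
Qed.

(** Cauchy's formula is applied to a rectangle with sides at distance between 1 and 2 from z, placed
    by [good_line]. Each of the four edges contributes at most 2 E (5 + J), and the lower bound 1/4
    for the winding integral turns 8 into 32. *)
Theorem fock_growth (eps : R) f (z : R[i]) J : 0 < eps -> entire f ->
  (fock_integral p alpha f <= J%:E)%E ->
  normc (f z) <= 32 * (5 + J) * expR (alpha / 2 * (1 + eps^-1) * 8) *
     expR (alpha / 2 * (1 + eps) * normc z ^+ 2).
Proof.
move=> e0 fe fJ.
set Phi := fock_integrand p alpha f.
have cf := entire_pcontinuous fe.
have mP : measurable_fun setT Phi by exact: measurable_fock_integrand.
have mPE : measurable_fun setT (EFin \o Phi) by exact/measurable_EFinP.
have P0 xy : (0 <= (EFin \o Phi) xy)%E by rewrite lee_fin fock_integrand_ge0.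
(* A bound for the inverse Gaussian weight on the box of half-width 2 around z; 8 is twice the 4 of
   [sqr_shift_le], once for each coordinate. *)
pose E := expR (alpha / 2 * ((1 + eps) * normc z ^+ 2 + (1 + eps^-1) * 8)).
have E0 : 0 <= E by rewrite expR_ge0.
have J0 : 0 <= J by rewrite -lee_fin; apply: le_trans fJ; exact: fock_integral_ge0.
have inbox w : `|Re w - Re z| <= 2 -> `|Im w - Im z| <= 2 ->
    normc (f w) <= E * (1 + Phi (Re w, Im w)).
  move=> wz1 wz2; apply: le_trans (normc_le_fock_integrand _ _) _.
  rewrite ler_wpM2r ?addr_ge0 ?fock_integrand_ge0//.
  rewrite ler_expR ler_wpM2l ?divr_ge0 ?(ltW alpha0)// sqr_normcE.
  have := sqr_shift_le e0 wz1; have := sqr_shift_le e0 wz2.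
  move=> H1 H2; apply: le_trans (lerD H2 H1) _.
  by rewrite le_eqVlt; apply/orP; left; apply/eqP; ring.
pose G c := (\int[leb]_x (Phi (x, c))%:E)%E.
pose F c := (\int[leb]_y (Phi (c, y))%:E)%E.
have GJ : (\int[leb]_c G c <= J%:E)%E.
  by have <- : fock_integral p alpha f = (\int[leb]_c G c)%E :=
    @fubini_tonelli2 _ _ _ _ R leb leb (EFin \o Phi) mPE P0.
have FJ : (\int[leb]_c F c <= J%:E)%E.
  by have <- : fock_integral p alpha f = (\int[leb]_c F c)%E :=
    @fubini_tonelli1 _ _ _ _ R leb leb (EFin \o Phi) mPE P0.
have mG : measurable_fun setT G.
  exact: (@measurable_fun_fubini_tonelli_G _ _ _ _ R leb (EFin \o Phi) mPE P0).
have mF : measurable_fun setT F.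
  exact: (@measurable_fun_fubini_tonelli_F _ _ _ _ R leb (EFin \o Phi) mPE P0).
have G0 c : (0 <= G c)%E by apply: integral_ge0 => x _; exact: P0 (x, c).
have F0 c : (0 <= F c)%E by apply: integral_ge0 => x _; exact: P0 (c, x).
have [a /andP[a1 a2] Fa] := good_line (Re z - 2) mF F0 FJ.
have [b /andP[b1 b2] Fb] := good_line (Re z + 1) mF F0 FJ.
have [c /andP[c1 c2] Gc] := good_line (Im z - 2) mG G0 GJ.
have [d /andP[d1 d2] Gd] := good_line (Im z + 1) mG G0 GJ.
have zab : a < Re z < b by apply/andP; split; clear -a2 b1; lra.
have zcd : c < Im z < d by apply/andP; split; clear -c2 d1; lra.
have wind : 1 / 4 <= normc (contour a b c d (fun w => (w - z)^-1)).
  by apply: winding_lower_bound; apply/andP; split => //;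
    clear -a2 b2 c2 d2; lra.
have cauchy := cauchy_formula zab zcd fe.
have [s1 s2 s3 s4] := edge_continuousM (pcontinuous_edge a b c d cf) (edge_continuousV zab zcd).
have kern w : 1 <= `|Re w - Re z| \/ 1 <= `|Im w - Im z| ->
    `|Re w - Re z| <= 2 -> `|Im w - Im z| <= 2 ->
    normc (f w * (w - z)^-1) <= E * (1 + Phi (Re w, Im w)).
  move=> far w1 w2; apply: le_trans (inbox w w1 w2).
  rewrite ComplexField.Normc.normcM ComplexField.Normc.normcV ler_piMr ?normc_ge0//.
  have n1 : 1 <= normc (w - z).
    case: far => far; apply: le_trans far _.
      by rewrite -ReN -ReD Re_le_normc.
    by rewrite -ImN -ImD Im_le_normc.
  by rewrite invf_le1// (lt_le_trans ltr01).
have mPx y : measurable_fun setT (fun x => Phi (x, y)) by exact: measurable_fun_pair1.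
have mPy x : measurable_fun setT (fun y => Phi (x, y)) by exact: measurable_fun_pair2.
move: (a1) (a2) (b1) (b2) (c1) (c2) (d1) (d2) =>
  ab1 ab2 ab3 ab4 cd1 cd2 cd3 cd4.
have E5 : 4 + (J + 1) = 5 + J by ring.
have farl (u v : R) : u <= v - 1 -> 1 <= `|u - v|.
  by move=> H; rewrite ler_normr; apply/orP; right; clear -H; lra.
have farr (u v : R) : v + 1 <= u -> 1 <= `|u - v|.
  by move=> H; rewrite ler_normr; apply/orP; left; clear -H; lra.
have close (u v : R) : v - 2 <= u -> u <= v + 2 -> `|u - v| <= 2.
  by move=> H1 H2; rewrite ler_norml; clear -H1 H2; lra.
have ab : a <= b by clear -ab2 ab3; lra.
have ab4' : b <= a + 4 by clear -ab1 ab4; lra.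
have cd : c <= d by clear -cd2 cd3; lra.
have cd4' : d <= c + 4 by clear -cd1 cd4; lra.
have Phi0 xy : 0 <= Phi xy by exact: fock_integrand_ge0.
rewrite -E5.
have B1 : normc (seg a b (fun x => f (x +i* c)%C * ((x +i* c)%C - z)^-1)) <= 2 * E * (4 + (J + 1)).
  apply: (@seg_dominated R _ _ E (J + 1) (fun x => Phi (x, c)) _ ab ab4' E0 (mPx c)
    (fun x => Phi0 (x, c)) Gc s1).
  move=> x xa xb; apply: (kern (x +i* c)%C) => /=;
    [right; apply: farl|apply: close|apply: close];
    clear -ab1 ab2 ab3 ab4 cd1 cd2 cd3 cd4 xa xb; lra.
have B2 : normc (seg a b (fun x => f (x +i* d)%C * ((x +i* d)%C - z)^-1)) <= 2 * E * (4 + (J + 1)).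
  apply: (@seg_dominated R _ _ E (J + 1) (fun x => Phi (x, d)) _ ab ab4' E0 (mPx d)
    (fun x => Phi0 (x, d)) Gd s2).
  move=> x xa xb; apply: (kern (x +i* d)%C) => /=;
    [right; apply: farr|apply: close|apply: close];
    clear -ab1 ab2 ab3 ab4 cd1 cd2 cd3 cd4 xa xb; lra.
have B3 : normc (seg c d (fun x => f (b +i* x)%C * ((b +i* x)%C - z)^-1)) <= 2 * E * (4 + (J + 1)).
  apply: (@seg_dominated R _ _ E (J + 1) (fun x => Phi (b, x)) _ cd cd4' E0 (mPy b)
    (fun x => Phi0 (b, x)) Fb s3).
  move=> x xa xb; apply: (kern (b +i* x)%C) => /=;
    [left; apply: farr|apply: close|apply: close];
    clear -ab1 ab2 ab3 ab4 cd1 cd2 cd3 cd4 xa xb; lra.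
have B4 : normc (seg c d (fun x => f (a +i* x)%C * ((a +i* x)%C - z)^-1)) <= 2 * E * (4 + (J + 1)).
  apply: (@seg_dominated R _ _ E (J + 1) (fun x => Phi (a, x)) _ cd cd4' E0 (mPy a)
    (fun x => Phi0 (a, x)) Fa s4).
  move=> x xa xb; apply: (kern (a +i* x)%C) => /=;
    [left; apply: farl|apply: close|apply: close];
    clear -ab1 ab2 ab3 ab4 cd1 cd2 cd3 cd4 xa xb; lra.
have BC : normc (contour a b c d (fun w => f w * (w - z)^-1)) <= 8 * E * (4 + (J + 1)).
  rewrite /contour (le_trans (normcD _ _))// ComplexField.Normc.normcM.
  have -> : normc ('i%C : R[i]) = 1.
    by rewrite normc_sqrt /= expr0n expr1n add0r sqrtr1.
  rewrite mul1r.
  have := lerD (le_trans (normcB _ _) (lerD B1 B2)) (le_trans (normcB _ _) (lerD B3 B4)).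
  move=> /le_trans; apply; clear; lra.
rewrite cauchy ComplexField.Normc.normcM in BC.
have H : normc (f z) * (1 / 4) <= 8 * E * (4 + (J + 1)).
  by apply: le_trans BC; rewrite ler_wpM2l ?normc_ge0.
have -> : 32 * (4 + (J + 1)) * expR (alpha / 2 * (1 + eps^-1) * 8) *
     expR (alpha / 2 * (1 + eps) * normc z ^+ 2) = 32 * (4 + (J + 1)) * E.
  by rewrite -mulrA -expRD /E; congr (_ * expR _); ring.
by clear -H; lra.
Qed.

End fock_growth.

(** * The Hausdorff operator on the Fock space *)

Section hausdorff_operator.
Context {R : realType}.
Implicit Types (f g : R[i] -> R[i]) (z w h : R[i]) (t : R).

(** Inversion is continuous off 0, and at 0 it has the conventional value 0, so the line is cut into
    two open half-lines and a point. *)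
Lemma measurable_invr : measurable_fun [set: R] (@GRing.inv R).
Proof.
have -> : [set: R] = `]0, +oo[%classic `|` (`]-oo, 0[%classic `|` [set 0]).
  apply/seteqP; split=> x // _; rewrite /= !in_itv/= andbT.
  by have [xlt|xgt|->] := ltgtP x 0; [right; left|left|right; right].
have oc (A : set R) : open A -> ~ A 0 -> measurable_fun A (@GRing.inv R).
  move=> oA A0; apply: open_continuous_measurable_fun => // x; rewrite inE => Ax.
  by apply: inv_continuous; apply: contra_notN A0 => /eqP <-.
apply/measurable_funU => //; first exact: measurableU.
split; first by apply: oc => //=; rewrite in_itv/= ltxx.
apply/measurable_funU => //; split; last exact: measurable_fun_set1.
by apply: oc => //=; rewrite in_itv/= ltxx.
Qed.

Lemma dilationE z t : z / t%:C%C = ((Re z * t^-1) +i* (Im z * t^-1))%C.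
Proof. by rewrite real_complexV complex_scale. Qed.

Lemma normc_dilation_le z t : 1 <= t -> normc (z / t%:C%C) <= normc z.
Proof.
move=> t1; have t0 : 0 < t by rewrite (lt_le_trans ltr01).
rewrite ComplexField.Normc.normcM real_complexV normc_real ger0_norm ?invr_ge0 ?(ltW t0)//.
by rewrite ler_piMr ?normc_ge0// invf_le1.
Qed.

Lemma measurable_dilation f (L : R[i] -> R) z : pcontinuous f ->
  (forall z w, `|L z - L w| <= normc (z - w)) ->
  measurable_fun setT (fun t => L (f (z / t%:C%C))).
Proof.
move=> cf L1; under eq_fun do rewrite dilationE.
apply: (measurableT_comp (lipschitz_comp_measurable cf L1)
   (g := fun t => (Re z * t^-1, Im z * t^-1))).
by apply: measurable_fun_pair; apply: measurable_funM => //; exact: measurable_invr.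
Qed.

Variables (mu : {measure set R -> \bar R}) (N : R).
Hypothesis mu01 : mu `]0, 1]%classic = 0%E.
Hypothesis muN : (\int[mu]_(t in `]1%R, +oo[) (t^-1)%:E <= N%:E)%E.
Let D : set R := `]1, +oo[%classic.

Let mD : measurable D. Proof. exact: measurable_itv. Qed.

Let Dgt1 t : D t -> 1 < t.
Proof. by rewrite /D /= in_itv/= andbT. Qed.

Let Dgt0 t : D t -> 0 < t.
Proof. by move=> /Dgt1; exact: lt_trans. Qed.

Lemma total_mass_ge0 : 0 <= N.
Proof.
rewrite -lee_fin; apply: le_trans muN; apply: integral_ge0 => t Dt.
by rewrite lee_fin invr_ge0 ltW// Dgt0.
Qed.

Lemma integrable_invr : mu.-integrable D (EFin \o (@GRing.inv R)).
Proof.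
apply/integrableP; split.
  by apply: measurable_funTS; apply/measurable_EFinP; exact: measurable_invr.
rewrite (eq_integral (fun t => (t^-1)%:E)).
  by apply: le_lt_trans muN _; rewrite ltry.
by move=> t /[!inE] Dt; rewrite /= ger0_norm// invr_ge0 ltW// Dgt0.
Qed.

Lemma integrable_invrM (B : R) :
  mu.-integrable D (EFin \o (fun t => B * t^-1)).
Proof. exact: (integrableZl mD B integrable_invr). Qed.

Lemma Rintegral_invr_le : Rintegral mu D (@GRing.inv R) <= N.
Proof.
rewrite /Rintegral -lee_fin fineK//.
have : (\int[mu]_(t in D) (t^-1)%:E < +oo)%E by apply: le_lt_trans muN _; rewrite ltry.
move=> H; rewrite ge0_fin_numE//.
by apply: integral_ge0 => t Dt; rewrite lee_fin invr_ge0 ltW// Dgt0.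
Qed.

Lemma integrable_dominated_invr (g : R -> R) (B : R) : measurable_fun D g ->
  (forall t, D t -> `|g t| <= B * t^-1) -> mu.-integrable D (EFin \o g).
Proof.
move=> mg gB; apply: le_integrable (integrable_invrM B) => //.
  exact/measurable_EFinP.
move=> t Dt /=; rewrite lee_fin (le_trans (gB _ Dt))// ler_norm//.
Qed.

Let posE : `]0, +oo[%classic = `]0, 1]%classic `|` D :> set R.
Proof. by rewrite /D -itv_bndbnd_setU ?bnd_simp. Qed.

Let dis01 : [disjoint `]0, 1]%classic & D].
Proof.
apply/disj_setPS => t [/=]; rewrite /D /= !in_itv/= andbT => /andP[_ t1] t2.
by move: (lt_le_trans t2 t1); rewrite ltxx.
Qed.

Lemma integrable_halfline (g : R -> R) : measurable_fun setT g ->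
  mu.-integrable D (EFin \o g) -> mu.-integrable `]0, +oo[ (EFin \o g).
Proof.
move=> mg /integrableP[_ ig]; apply/integrableP; split.
  by apply: measurable_funTS; exact/measurable_EFinP.
have ma : measurable_fun [set: R] (fun t => `|(EFin \o g) t|)%E.
  by apply: measurableT_comp => //; exact/measurable_EFinP.
rewrite posE ge0_integral_setU//; last exact: measurable_funTS.
by rewrite null_set_integral ?add0e//; exact: measurable_funTS.
Qed.

Lemma Rintegral_halfline (g : R -> R) : measurable_fun setT g ->
  mu.-integrable D (EFin \o g) ->
  Rintegral mu `]0, +oo[ g = Rintegral mu D g.
Proof.
move=> mg ig; have := integrable_halfline mg ig; rewrite posE => ig'.
rewrite Rintegral_setU// [X in X + _ = _](_ : _ = 0) ?add0r//.
rewrite /Rintegral null_set_integral//.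
by apply: measurable_funTS; exact/measurable_EFinP.
Qed.

Section bounded_function.
Variables (f : R[i] -> R[i]) (K : R -> R).
Hypothesis fc : pcontinuous f.
Hypothesis fK : forall z r, normc z <= r -> normc (f z) <= K r.

(** For t >= 1 the point z / t stays in the disc of radius |z|, so the integrand is dominated by
    K(|z|) t^-1. *)
Lemma hausdorff_defined_bounded : hausdorff_defined mu f.
Proof.
move=> z; have mg : measurable_fun setT
    (fun t => t^-1 * normc (f (z / t%:C%C))).
  apply: measurable_funM; first exact: measurable_invr.
  exact: measurable_dilation fc normc_lipschitz.
apply: (integrable_halfline mg).
apply: (integrable_dominated_invr (B := K (normc z))); first exact: measurable_funTS.
move=> t Dt; rewrite ger0_norm ?mulr_ge0 ?normc_ge0 ?invr_ge0 ?(ltW (Dgt0 Dt))//.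
rewrite mulrC ler_wpM2r ?invr_ge0 ?(ltW (Dgt0 Dt))// fK// normc_dilation_le//.
by rewrite ltW// Dgt1.
Qed.

Lemma hausdorff_cintegrable z :
  cintegrable mu D (fun t => (t^-1)%:C%C * f (z / t%:C%C)).
Proof.
apply: (dominated_cintegrable mD _ _ (integrable_invrM (K (normc z)))).
- under eq_fun do rewrite scale_real_complex /=.
  apply: measurable_funTS; apply: measurable_funM; first exact: measurable_invr.
  exact: measurable_dilation fc Re_lipschitz.
- under eq_fun do rewrite scale_real_complex /=.
  apply: measurable_funTS; apply: measurable_funM; first exact: measurable_invr.
  exact: measurable_dilation fc Im_lipschitz.
- move=> t Dt; rewrite ComplexField.Normc.normcM normc_real.
  rewrite ger0_norm ?invr_ge0 ?(ltW (Dgt0 Dt))// mulrC.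
  rewrite ler_wpM2r ?invr_ge0 ?(ltW (Dgt0 Dt))// fK// normc_dilation_le//.
  by rewrite ltW// Dgt1.
Qed.

Lemma hausdorffE z :
  hausdorff mu f z = cintegral mu D (fun t => (t^-1)%:C%C * f (z / t%:C%C)).
Proof.
have [rI iI] := hausdorff_cintegrable z.
have rE t : Re ((t^-1)%:C%C * f (z / t%:C%C)) = t^-1 * Re (f (z / t%:C%C)).
  by rewrite scale_real_complex.
have iE t : Im ((t^-1)%:C%C * f (z / t%:C%C)) = t^-1 * Im (f (z / t%:C%C)).
  by rewrite scale_real_complex.
apply: complex_ext => /=; rewrite Rintegral_halfline.
- by apply: eq_Rintegral => t _; rewrite rE.
- apply: measurable_funM; first exact: measurable_invr.
  exact: measurable_dilation fc Re_lipschitz.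
- by apply: eq_integrable rI => // t _ /=; rewrite rE.
- by apply: eq_Rintegral => t _; rewrite iE.
- apply: measurable_funM; first exact: measurable_invr.
  exact: measurable_dilation fc Im_lipschitz.
- by apply: eq_integrable iI => // t _ /=; rewrite iE.
Qed.

Lemma normc_hausdorff_le z :
  normc (hausdorff mu f z) <=
    2 * Rintegral mu D (fun t => t^-1 * normc (f (z / t%:C%C))).
Proof.
rewrite hausdorffE; apply: le_normc_cintegral => //.
- exact: hausdorff_cintegrable.
- apply: (integrable_dominated_invr (B := K (normc z))).
    apply: measurable_funTS; apply: measurable_funM; first exact: measurable_invr.
    exact: measurable_dilation fc normc_lipschitz.
  move=> t Dt; rewrite ger0_norm ?mulr_ge0 ?normc_ge0 ?invr_ge0 ?(ltW (Dgt0 Dt))//.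
  rewrite mulrC ler_wpM2r ?invr_ge0 ?(ltW (Dgt0 Dt))// fK// normc_dilation_le//.
  by rewrite ltW// Dgt1.
- move=> t Dt; rewrite ComplexField.Normc.normcM normc_real.
  by rewrite ger0_norm ?invr_ge0 ?(ltW (Dgt0 Dt)).
Qed.

(** The slope estimate of f at z / t with increments h / t and h' / t carries a factor t^-3 <= t^-1,
    so it can be integrated. The mean inherits a slope estimate with constant proportional to N,
    without differentiation under the integral sign. *)
Lemma hausdorff_entire : entire f -> entire (hausdorff mu f).
Proof.
move=> fe; pose C z := 2 * (20000 * K (normc z + 2) * N).
apply: (@slope_estimate_entire _ C) => z h h' hh hh'.
set S := fun t : R => h' * ((t^-1)%:C%C * f ((z + h) / t%:C%C) - (t^-1)%:C%C * f (z / t%:C%C)) -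
   h * ((t^-1)%:C%C * f ((z + h') / t%:C%C) - (t^-1)%:C%C * f (z / t%:C%C)).
have i0 := hausdorff_cintegrable z.
have i1 := cintegrableB mD (hausdorff_cintegrable (z + h)) i0.
have i2 := cintegrableB mD (hausdorff_cintegrable (z + h')) i0.
have iS : cintegrable mu D S.
  by apply: cintegrableB => //; apply: cintegrableZ.
have -> : h' * (hausdorff mu f (z + h) - hausdorff mu f z) -
    h * (hausdorff mu f (z + h') - hausdorff mu f z) = cintegral mu D S.
  rewrite !hausdorffE /S (cintegralB mD (cintegrableZ mD h' i1) (cintegrableZ mD h i2)).
  rewrite (cintegralZ mD h' i1) (cintegralZ mD h i2).
  by rewrite !(cintegralB mD (hausdorff_cintegrable _) i0).
pose B := 20000 * K (normc z + 2) * normc h * normc h' * (normc h + normc h').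
have KB : 0 <= K (normc z + 2).
  by apply: le_trans (normc_ge0 (f z)) _; apply: fK; rewrite lerDl.
have B0 : 0 <= B.
  rewrite /B; apply: mulr_ge0; last by rewrite addr_ge0 ?normc_ge0.
  apply: mulr_ge0; last exact: normc_ge0.
  apply: mulr_ge0; last exact: normc_ge0.
  by rewrite pmulr_rge0 ?ltr0n.
apply: le_trans (le_normc_cintegral mD iS (integrable_invrM B) _) _.
  move=> t Dt; have t1 := Dgt1 Dt; have t0 := Dgt0 Dt.
  have tC0 : t%:C%C != 0 :> R[i] by rewrite -normc_gt0 normc_real normr_gt0 gt_eqF.
  have ti0 : 0 <= t^-1 by rewrite invr_ge0 ltW.
  have ti1 : t^-1 <= 1 by rewrite invf_le1// ltW.
  have hk (k : R[i]) : normc k <= 1 / 2 -> normc (k / t%:C%C) <= 1 / 2.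
    by apply: le_trans; rewrite normc_dilation_le// ltW.
  have sub : forall w, normc (w - z / t%:C%C) <= 2 -> normc (f w) <= K (normc z + 2).
    move=> w wz; apply: fK; rewrite -(subrK (z / t%:C%C) w) (le_trans (normcD _ _))//.
    by rewrite addrC lerD// normc_dilation_le// ltW.
  have := entire_slope_estimate fe sub (hk _ hh) (hk _ hh').
  rewrite -!mulrDl => E.
  (* The factor t^-1 in the operator is just what turns the outer h and h' into the rescaled
     increments. *)
  have SE : S t = h' / t%:C%C * (f ((z + h) / t%:C%C) - f (z / t%:C%C)) -
      h / t%:C%C * (f ((z + h') / t%:C%C) - f (z / t%:C%C)).
    by rewrite /S -real_complexV; ring.
  rewrite SE; apply: le_trans E _.
  have nE (k : R[i]) : normc (k / t%:C%C) = normc k * t^-1.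
    by rewrite ComplexField.Normc.normcM real_complexV normc_real ger0_norm.
  rewrite !nE -mulrDl.
  have -> : 20000 * K (normc z + 2) * (normc h * t^-1) * (normc h' * t^-1) *
     ((normc h + normc h') * t^-1) = B * t^-1 * (t^-1 * t^-1) by rewrite /B; ring.
  by apply: ler_piMr; [exact: mulr_ge0 B0 ti0|exact: mulr_ile1].
rewrite RintegralZl//; last exact: integrable_invr.
have := ler_wpM2l B0 Rintegral_invr_le.
rewrite /C /B => H; apply: le_trans (ler_wpM2l _ H) _ => //.
by rewrite le_eqVlt; apply/orP; left; apply/eqP; ring.
Qed.

End bounded_function.

Lemma hausdorffB f g (K K' : R -> R) z : pcontinuous f -> pcontinuous g ->
  (forall z r, normc z <= r -> normc (f z) <= K r) ->
  (forall z r, normc z <= r -> normc (g z) <= K' r) ->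
  pcontinuous (fun z => f z - g z) ->
  hausdorff mu (fun z => f z - g z) z = hausdorff mu f z - hausdorff mu g z.
Proof.
move=> cf cg fK gK cfg.
have fgK w r : normc w <= r -> normc (f w - g w) <= K r + K' r.
  by move=> wr; rewrite (le_trans (normcB _ _))// lerD ?fK ?gK.
rewrite (hausdorffE cfg fgK) (hausdorffE cf fK) (hausdorffE cg gK).
rewrite -(cintegralB mD (hausdorff_cintegrable cf fK z) (hausdorff_cintegrable cg gK z)).
by congr cintegral; apply/funext => t; rewrite mulrBr.
Qed.

End hausdorff_operator.

(** * Hoelder's inequality and sigma-finiteness for the dilation parameter *)

Section hausdorff_norm.
Context {R : realType}.
Local Notation leb := (@lebesgue_measure R).
Variables (p alpha : R) (mu : {measure set R -> \bar R}) (N : R).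
Hypotheses (p1 : 1 < p) (alpha0 : 0 < alpha).
Hypothesis mu01 : mu `]0, 1]%classic = 0%E.
Hypothesis muN : (\int[mu]_(t in `]1%R, +oo[) (t^-1)%:E <= N%:E)%E.
Let D : set R := `]1, +oo[%classic.

Let mD : measurable D. Proof. exact: measurable_itv. Qed.

Let Dgt1 t : D t -> 1 < t.
Proof. by rewrite /D /= in_itv/= andbT. Qed.

Let Dgt0 t : D t -> 0 < t.
Proof. by move=> /Dgt1; exact: lt_trans. Qed.

Let p0 : 0 < p. Proof. exact: lt_trans p1. Qed.

(** Either a <= del, or (a / del)^(p - 1) >= 1 and the second term alone is at least a. The free
    scale del makes this a substitute for Young's inequality. *)
Lemma le_scaled_powR (a del : R) : 0 <= a -> 0 < del ->
  a <= del + del / del `^ p * a `^ p.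
Proof.
move=> a0 d0; have [ad|da] := leP a del.
  by rewrite (le_trans ad)// lerDl mulr_ge0 ?powR_ge0// divr_ge0 ?powR_ge0// ltW.
rewrite -[leLHS]add0r lerD ?(ltW d0)// mulrAC ler_pdivlMr ?powR_gt0//.
have a0' : 0 < a by exact: lt_trans da.
have E (x : R) : 0 < x -> x `^ p = x * x `^ (p - 1).
  by move=> x0; rewrite mulrC -[X in _ * X]powRr1 ?(ltW x0)// -powRD ?subrK// gt_eqF ?implybT// x0.
rewrite (E _ d0) (E _ a0') !mulrA (mulrC a) ler_wpM2l ?mulr_ge0 ?(ltW d0)//.
by rewrite ge0_ler_powR ?nnegrE ?(ltW d0)// ?subr_ge0 ltW.
Qed.

(* Hoelder's inequality with the constant N + 1 in place of N ^ (1 - 1/p),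
   from optimizing the scale in the previous lemma. *)
Lemma powR_mean_le (a : R -> R) (A0 : R) : measurable_fun setT a ->
  (forall t, 0 <= a t) -> (forall t, D t -> a t <= A0) ->
  Rintegral mu D (fun t => t^-1 * a t) `^ p <=
  (N + 1) `^ p * Rintegral mu D (fun t => t^-1 * a t `^ p).
Proof.
move=> ma a0 aA.
have N0 := total_mass_ge0 muN.
have iinv := integrable_invr muN.
have ia : mu.-integrable D (EFin \o (fun t => t^-1 * a t)).
  apply: (integrable_dominated_invr muN (B := A0)).
    apply: measurable_funTS; apply: measurable_funM => //; exact: measurable_invr.
  move=> t Dt; have ti : 0 <= t^-1 by rewrite invr_ge0 ltW// Dgt0.
  by rewrite ger0_norm ?mulr_ge0// mulrC ler_wpM2r// aA.
have iap : mu.-integrable D (EFin \o (fun t => t^-1 * a t `^ p)).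
  apply: (integrable_dominated_invr muN (B := A0 `^ p)).
    apply: measurable_funTS; apply: measurable_funM; first exact: measurable_invr.
    by apply: (measurableT_comp (f := fun x : R => x `^ p)) => //; exact: measurable_powR.
  move=> t Dt; have ti : 0 <= t^-1 by rewrite invr_ge0 ltW// Dgt0.
  rewrite ger0_norm ?mulr_ge0 ?powR_ge0// mulrC ler_wpM2r//.
  by rewrite ge0_ler_powR ?nnegrE ?(ltW p0)// ?aA// (le_trans (a0 t))// aA.
set A := Rintegral _ _ _; set B := Rintegral _ _ _.
have B0 : 0 <= B.
  by apply: Rintegral_ge0 => t Dt; rewrite mulr_ge0 ?powR_ge0// invr_ge0 ltW// Dgt0.
have A0' : 0 <= A.
  by apply: Rintegral_ge0 => t Dt; rewrite mulr_ge0// invr_ge0 ltW// Dgt0.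
have scale del : 0 < del -> A <= del * N + del / del `^ p * B.
  move=> d0; rewrite /A /B.
  have i1 := integrable_invrM muN del.
  have i2 : mu.-integrable D (EFin \o (fun t => del / del `^ p * (t^-1 * a t `^ p))).
    exact: (integrableZl mD _ iap).
  apply: (@le_trans _ _ (Rintegral mu D
      (fun t => del * t^-1 + del / del `^ p * (t^-1 * a t `^ p)))).
    apply: le_Rintegral => //; first exact: (integrableD mD i1 i2).
    move=> t Dt; have ti : 0 <= t^-1 by rewrite invr_ge0 ltW// Dgt0.
    rewrite [X in _ + X]mulrCA [X in X + _]mulrC -mulrDr ler_wpM2l//.
    exact: le_scaled_powR.
  rewrite RintegralD// RintegralZl// RintegralZl// lerD2r ler_wpM2l ?(ltW d0)//.
  exact: Rintegral_invr_le.
have powp (x : R) : 0 <= x -> (x `^ p^-1) `^ p = x.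
  by move=> x0; rewrite -powRrM mulVf ?gt_eqF// powRr1.
apply/ler_addgt0Pr => e e0.
have P0 : 0 < (N + 1) `^ p by rewrite powR_gt0// ltr_wpDl.
(* The scale will be del = B'^(1/p), for which the bound becomes A <= del (N + 1). The added term
   keeps del positive when B vanishes and costs exactly e in the end. *)
pose B' := B + e / (N + 1) `^ p.
have B'0 : 0 < B' by rewrite ltr_wpDl// divr_gt0.
have -> : (N + 1) `^ p * B + e = (N + 1) `^ p * B'.
  by rewrite mulrDr (mulrC _ (e / _)) divfK// gt_eqF.
have d0 : 0 < B' `^ p^-1 by rewrite powR_gt0.
rewrite -(powp B' (ltW B'0)) -powRM ?addr_ge0 ?(ltW d0)//.
rewrite ge0_ler_powR ?nnegrE ?(ltW p0)// ?mulr_ge0 ?addr_ge0 ?(ltW d0)//.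
apply: le_trans (scale _ d0) _; rewrite (powp B' (ltW B'0)) mulrC mulrDl lerD2l mul1r.
rewrite -mulrA ler_piMr ?(ltW d0)// mulrC ler_pdivrMr// mul1r /B' lerDl.
by rewrite divr_ge0 ?(ltW P0)// ltW.
Qed.

Lemma measurable_powR_comp d (T : measurableType d) (a : T -> R) (E : set T) :
  measurable_fun E a -> measurable_fun E (fun x => a x `^ p).
Proof.
move=> ma; apply: (measurableT_comp (f := fun x : R => x `^ p)) => //.
Qed.

(** The Gaussian weight depends on z only, so it can be moved under the integral in t before
    Hoelder's inequality is applied. *)
Lemma fock_integrand_hausdorff_le f (K : R -> R) xy : pcontinuous f ->
  (forall z r, normc z <= r -> normc (f z) <= K r) ->
  fock_integrand p alpha (hausdorff mu f) xy <=
  (2 * (N + 1)) `^ p * Rintegral mu D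
    (fun t => t^-1 * fock_integrand p alpha (fun z => f (z / t%:C%C)) xy).
Proof.
move=> cf fK; rewrite /fock_integrand; set z := (_ +i* _)%C; set W := expR _.
have N0 := total_mass_ge0 muN.
have W0 : 0 <= W by exact: expR_ge0.
have ma : measurable_fun setT (fun t : R => normc (f (z / t%:C%C)) * W).
  by apply: measurable_funM => //; exact: measurable_dilation cf normc_lipschitz.
have a0 (t : R) : 0 <= normc (f (z / t%:C%C)) * W by rewrite mulr_ge0 ?normc_ge0.
have aK (t : R) : D t -> normc (f (z / t%:C%C)) * W <= K (normc z) * W.
  by move=> Dt; rewrite ler_wpM2r// fK// normc_dilation_le// ltW// Dgt1.
rewrite powRM ?addr_ge0// -mulrA.
apply: le_trans (ler_wpM2l (powR_ge0 _ _) (powR_mean_le ma a0 aK)).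
rewrite -powRM//; last first.
  apply: Rintegral_ge0 => t Dt; rewrite mulr_ge0// invr_ge0 ltW// Dgt0//.
rewrite ge0_ler_powR ?nnegrE ?(ltW p0)// ?mulr_ge0 ?normc_ge0//.
  by apply: Rintegral_ge0 => t Dt; rewrite mulr_ge0// invr_ge0 ltW// Dgt0.
have -> : Rintegral mu D (fun t => t^-1 * (normc (f (z / t%:C%C)) * W)) =
   W * Rintegral mu D (fun t => t^-1 * normc (f (z / t%:C%C))).
  rewrite -RintegralZl//; first by apply: eq_Rintegral => t _; rewrite mulrA mulrC.
  apply: (integrable_dominated_invr muN (B := K (normc z))).
    apply: measurable_funTS; apply: measurable_funM; first exact: measurable_invr.
    exact: measurable_dilation cf normc_lipschitz.
  move=> t Dt; have ti : 0 <= t^-1 by rewrite invr_ge0 ltW// Dgt0.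
  rewrite ger0_norm ?mulr_ge0 ?normc_ge0// mulrC ler_wpM2r// fK// normc_dilation_le//.
  by rewrite ltW// Dgt1.
rewrite mulrCA [leLHS]mulrC ler_wpM2l//.
exact: (normc_hausdorff_le mu01 muN cf fK).
Qed.

(** Since 1 <= (n+1) t^-1 on ]1, n+1], that interval has measure at most (n+1) N. The restriction of
    mu thus qualifies for Tonelli's theorem. *)
Lemma restricted_sigma_finite : exists nu : {sigma_finite_measure set R -> \bar R},
  forall A, measurable A -> A `<=` D -> mu A = nu A.
Proof.
have rfin : sigma_finite setT (mrestr mu mD).
  exists (fun n => `]-oo, n.+1%:R]%classic : set R).
    apply/seteqP; split=> x // _; exists (Num.truncn x) => //=.
    by rewrite in_itv/= ltW// truncnS_gt.
  move=> n; split; first exact: measurable_itv.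
  rewrite /mrestr.
  set A := _ `&` D.
  have mA : measurable A by apply: measurableI => //; exact: measurable_itv.
  apply: (@le_lt_trans _ _ (n.+1%:R%:E * N%:E)%E); last by rewrite -EFinM ltry.
  rewrite -[leLHS]mul1e -integral_cst//.
  apply: le_trans (lee_wpmul2l _ muN); last by rewrite lee_fin.
  have mi : measurable_fun D (fun t : R => (t^-1)%:E).
    by apply: measurable_funTS; apply/measurable_EFinP; exact: measurable_invr.
  have i0 t : D t -> (0 <= (t^-1)%:E)%E.
    by move=> Dt; rewrite lee_fin invr_ge0 ltW// Dgt0.
  have n0 : (0 <= n.+1%:R%:E :> \bar R)%E by rewrite lee_fin.
  rewrite -(ge0_integralZl mu mD mi i0 n0).
  have mg : measurable_fun setT (fun t : R => (n.+1%:R%:E * (t^-1)%:E)%E).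
    apply/measurable_EFinP; apply: measurable_funM => //; exact: measurable_invr.
  have H1 : (\int[mu]_(t in A) (n.+1%:R%:E * (t^-1)%:E) <=
      \int[mu]_(t in D) (n.+1%:R%:E * (t^-1)%:E))%E.
    apply: ge0_subset_integral => //; [exact: measurable_funTS| |exact: subIsetr].
    by move=> t Dt; rewrite -EFinM lee_fin mulr_ge0// invr_ge0 ltW// Dgt0.
  apply: le_trans H1.
  apply: ge0_le_integral => //; first exact: measurable_funTS.
  move=> t [/= tn Dt]; rewrite -EFinM lee_fin ler_pdivlMr ?Dgt0// mul1r.
  by move: tn; rewrite in_itv.
exists (HB.pack_for {sigma_finite_measure set R -> \bar R} (mrestr mu mD)
  (Measure_isSigmaFinite.Build _ _ _ (mrestr mu mD) rfin)).
by move=> A mA AD /=; rewrite /mrestr setIidl.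
Qed.

End hausdorff_norm.

Section hausdorff_fock.
Context {R : realType}.
Local Notation leb := (@lebesgue_measure R).
Variables (p alpha : R) (mu : {measure set R -> \bar R}) (N : R).
Hypotheses (p1 : 1 < p) (alpha0 : 0 < alpha).
Hypothesis mu01 : mu `]0, 1]%classic = 0%E.
Hypothesis muN : (\int[mu]_(t in `]1%R, +oo[) (t^-1)%:E <= N%:E)%E.
Let D : set R := `]1, +oo[%classic.

Let mD : measurable D. Proof. exact: measurable_itv. Qed.

Let Dgt1 t : D t -> 1 < t.
Proof. by rewrite /D /= in_itv/= andbT. Qed.

Let Dgt0 t : D t -> 0 < t.
Proof. by move=> /Dgt1; exact: lt_trans. Qed.

Let p0 : 0 < p. Proof. exact: lt_trans p1. Qed.

Let dil f (t : R) : R[i] -> R[i] := fun z => f (z / t%:C%C).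

Lemma dilation_pcontinuous f (t : R) : 1 <= t -> pcontinuous f -> pcontinuous (dil f t).
Proof.
move=> t1 cf z e /(cf (z / t%:C%C))[r r0 fr]; exists r => // w wz.
by apply: fr; rewrite -mulrBl (le_lt_trans _ wz)// normc_dilation_le.
Qed.

Local Notation plane := (measurableTypeR R * measurableTypeR R)%type.

(** Exhaustion by the squares [-n, n]^2. The product measure is repackaged with this structure in
    order to enter a second product, with the measure in t. *)
Lemma plane_sigma_finite : exists P : {sigma_finite_measure set plane -> \bar R},
  forall A, measurable A -> (leb \x leb)%E A = P A.
Proof.
have fin : sigma_finite setT (leb \x leb)%E.
  pose I (n : nat) : set R := `[- n%:R, n%:R]%classic.
  exists (fun n => I n `*` I n).
    apply/seteqP; split=> [[x y] _|//].
    exists (Num.truncn (Num.max `|x| `|y|)).+1 => //.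
    have : Num.max `|x| `|y| <= (Num.truncn (Num.max `|x| `|y|)).+1%:R.
      by rewrite ltW// truncnS_gt.
    by rewrite ge_max => /andP[]; rewrite !ler_norml /I /= !in_itv.
  move=> n; have mI : measurable (I n) by exact: measurable_itv.
  split; first exact: measurableX.
  have lI : (leb (I n) < +oo)%E.
    by rewrite /I lebesgue_measure_itv/=; case: ifP => _; rewrite ltry.
  by rewrite product_measure1E// lte_mul_pinfty// ge0_fin_numE.
exists (HB.pack_for {sigma_finite_measure set plane -> \bar R} (leb \x leb)%E
  (Measure_isSigmaFinite.Build _ _ _ (leb \x leb)%E fin)).
by [].
Qed.

(** The integrand of the double integral over plane and dilation parameter, extended by 0 to all t
    so that measurability can be stated on the whole product. *)
Let kernel f (u : (R * R) * R) : R :=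
  \1_D u.2 * (u.2^-1 * fock_integrand p alpha (dil f u.2) u.1).

Let measurable_kernel f : pcontinuous f -> measurable_fun setT (kernel f).
Proof.
move=> cf; apply: measurable_funM.
  apply: (measurableT_comp (f := (\1_D : R -> R))); first exact: measurable_indic.
  exact: measurable_snd.
apply: measurable_funM.
  by apply: (measurableT_comp measurable_invr); exact: measurable_snd.
apply: measurable_powR_comp; apply: measurable_funM; last first.
  exact: (measurableT_comp (measurable_gauss_weight _)) measurable_fst.
rewrite /dil; under eq_fun do rewrite dilationE /=.
apply: (measurableT_comp (lipschitz_comp_measurable cf normc_lipschitz)
   (g := fun u : (R * R) * R => (u.1.1 * u.2^-1, u.1.2 * u.2^-1))).
apply: measurable_fun_pair; apply: measurable_funM.
- exact: measurableT_comp measurable_fst measurable_fst.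
- by apply: (measurableT_comp measurable_invr); exact: measurable_snd.
- exact: measurableT_comp measurable_snd measurable_fst.
- by apply: (measurableT_comp measurable_invr); exact: measurable_snd.
Qed.

Let kernel_ge0 f u : 0 <= kernel f u.
Proof.
rewrite /kernel indicE; case: (boolP (u.2 \in D)) => [|_]; last by rewrite mul0r.
rewrite inE => /Dgt0 u0; rewrite mul1r mulr_ge0 ?fock_integrand_ge0//.
by rewrite invr_ge0 ltW.
Qed.

Let kernelD f xy t : D t ->
  kernel f (xy, t) = t^-1 * fock_integrand p alpha (dil f t) xy.
Proof. by move=> Dt; rewrite /kernel indicE mem_set//= mul1r. Qed.

(** On ]1, +oo[ this function is a marginal of [kernel], hence measurable by Tonelli's theorem. *)
Lemma measurable_dilation_norms f : pcontinuous f ->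
  measurable_fun D (fun t => (t^-1)%:E * fock_integral p alpha (dil f t))%E.
Proof.
move=> cf.
have mK : measurable_fun setT (EFin \o kernel f).
  by apply/measurable_EFinP; exact: measurable_kernel.
have K0 u : (0 <= (EFin \o kernel f) u)%E by rewrite lee_fin kernel_ge0.
have [P HP] := plane_sigma_finite.
apply: (eq_measurable_fun (fubini_G P (EFin \o kernel f))).
  move=> t; rewrite inE => Dt; rewrite /fubini_G.
  rewrite -(eq_measure_integral P (fun A mA _ => HP A mA)).
  under eq_integral => xy _ do rewrite /= kernelD// EFinM.
  rewrite ge0_integralZl// ?lee_fin ?invr_ge0 ?(ltW (Dgt0 Dt))//.
    apply/measurable_EFinP; apply: measurable_fock_integrand.
    by apply: dilation_pcontinuous => //; rewrite ltW// Dgt1.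
  by move=> xy _; rewrite lee_fin fock_integrand_ge0.
apply: measurable_funTS.
exact: (@measurable_fun_fubini_tonelli_G _ _ _ _ R P _ mK K0).
Qed.

Lemma fock_integral_hausdorff_le f (K : R -> R) : entire f ->
  (forall z r, normc z <= r -> normc (f z) <= K r) ->
  (fock_integral p alpha (hausdorff mu f) <= ((2 * (N + 1)) `^ p)%:E *
    \int[mu]_(t in D) ((t^-1)%:E * fock_integral p alpha (dil f t)))%E.
Proof.
move=> fe fK; have cf := entire_pcontinuous fe.
have cH := entire_pcontinuous (hausdorff_entire mu01 muN cf fK fe).
have [nu Hnu] := restricted_sigma_finite muN.
have mK : measurable_fun setT (EFin \o kernel f).
  by apply/measurable_EFinP; exact: measurable_kernel.
have K0 u : (0 <= (EFin \o kernel f) u)%E by rewrite lee_fin kernel_ge0.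
have inner xy : fubini_F nu (EFin \o kernel f) xy = (Rintegral mu D
    (fun t => t^-1 * fock_integrand p alpha (dil f t) xy))%:E.
  have -> : fubini_F nu (EFin \o kernel f) xy =
      (\int[mu]_(t in D) (t^-1 * fock_integrand p alpha (dil f t) xy)%:E)%E.
    rewrite (eq_measure_integral nu) => [|A mA AD]; last exact: Hnu.
    rewrite integral_mkcond /fubini_F; apply: eq_integral => t _.
    rewrite patchE; case: ifPn => tD; first by rewrite /= kernelD//; rewrite inE in tD.
    by rewrite /= /kernel indicE (negbTE tD) mul0r.
  rewrite /Rintegral fineK//; apply: integrable_fin_num => //.
  set W := expR (- (alpha / 2) * (xy.1 ^+ 2 + xy.2 ^+ 2)).
  apply: (integrable_dominated_invr muN (B := (K (normc (xy.1 +i* xy.2)%C) * W) `^ p)).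
    apply: measurable_funTS; apply: measurable_funM; first exact: measurable_invr.
    apply: measurable_powR_comp; apply: measurable_funM => //.
    exact: measurable_dilation cf normc_lipschitz.
  move=> t Dt; have ti : 0 <= t^-1 by rewrite invr_ge0 ltW// Dgt0.
  rewrite ger0_norm ?mulr_ge0 ?fock_integrand_ge0// mulrC ler_wpM2r//.
  have Kt : normc (dil f t (xy.1 +i* xy.2)%C) <= K (normc (xy.1 +i* xy.2)%C).
    by apply: fK; rewrite normc_dilation_le// ltW// Dgt1.
  have W0 : 0 <= W by exact: expR_ge0.
  rewrite /fock_integrand ge0_ler_powR ?nnegrE ?(ltW p0)//.
  - by rewrite mulr_ge0 ?normc_ge0.
  - by rewrite mulr_ge0// (le_trans _ Kt)// normc_ge0.
  - by rewrite ler_wpM2r.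
have C0 : (0 <= ((2 * (N + 1)) `^ p)%:E :> \bar R)%E by rewrite lee_fin powR_ge0.
have mF : measurable_fun setT (fubini_F nu (EFin \o kernel f)).
  exact: (@measurable_fun_fubini_tonelli_F _ _ _ _ R nu _ mK K0).
have F0 xy : (0 <= fubini_F nu (EFin \o kernel f) xy)%E.
  by apply: integral_ge0 => t _; exact: K0.
have -> : (\int[mu]_(t in D) ((t^-1)%:E * fock_integral p alpha (dil f t)) =
    \int[leb \x leb]_xy fubini_F nu (EFin \o kernel f) xy)%E.
  have [P HP] := plane_sigma_finite.
  rewrite [RHS](eq_measure_integral P (fun A mA _ => HP A mA)).
  rewrite (@fubini_tonelli _ _ _ _ R P nu _ mK K0).
  rewrite (eq_measure_integral nu) => [|A mA AD]; last exact: Hnu.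
  rewrite integral_mkcond; apply: eq_integral => t _; rewrite patchE /fubini_G.
  rewrite -(eq_measure_integral P (fun A mA _ => HP A mA)).
  case: ifPn => tD; last first.
    by rewrite integral0_eq// => xy _; rewrite /= /kernel indicE (negbTE tD) mul0r.
  have Dt : D t by rewrite inE in tD.
  under [RHS]eq_integral => xy _ do rewrite /= kernelD// EFinM.
  rewrite ge0_integralZl// ?lee_fin ?invr_ge0 ?(ltW (Dgt0 Dt))//.
    apply/measurable_EFinP; apply: measurable_fock_integrand.
    by apply: dilation_pcontinuous => //; rewrite ltW// Dgt1.
  by move=> xy _; rewrite lee_fin fock_integrand_ge0.
rewrite -ge0_integralZl//.
apply: ge0_le_integral => //.
- by move=> xy _; rewrite lee_fin fock_integrand_ge0.
- by apply/measurable_EFinP; exact: measurable_fock_integrand.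
- exact: measurable_funeM.
- move=> xy _; rewrite inner -EFinM lee_fin.
  exact: (fock_integrand_hausdorff_le alpha p1 mu01 muN xy cf fK).
Qed.

(** The dilation divides the growth exponent by t^2, leaving at most kappa alpha/2 |z|^2 against the
    weight's alpha/2 |z|^2. The bound is integrable once kappa < 1; eps may be negative, as it is
    for monomials. *)
Lemma dilation_gauss_bound f (A eps kappa t : R) xy : 0 < t -> 0 <= A ->
  (forall w, normc (f w) <= A * expR (alpha / 2 * (1 + eps) * normc w ^+ 2)) ->
  1 + eps <= kappa * t ^+ 2 ->
  fock_integrand p alpha (dil f t) xy <=
    A `^ p * expR (- (p * (alpha / 2) * (1 - kappa)) * (xy.1 ^+ 2 + xy.2 ^+ 2)).
Proof.
move=> t0 A0 fA ek; rewrite /fock_integrand.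
set q := xy.1 ^+ 2 + xy.2 ^+ 2.
have q0 : 0 <= q by rewrite addr_ge0 ?sqr_ge0.
have nz : normc ((xy.1 +i* xy.2) / t%:C)%C ^+ 2 = q / t ^+ 2.
  by rewrite dilationE sqr_normcE /= !exprMn -mulrDl exprVn.
have -> : A `^ p * expR (- (p * (alpha / 2) * (1 - kappa)) * q) =
    (A * expR (- (alpha / 2) * (1 - kappa) * q)) `^ p.
  rewrite powRM ?expR_ge0// -expRM; congr (_ * expR _); ring.
rewrite ge0_ler_powR ?nnegrE ?(ltW p0) ?mulr_ge0 ?normc_ge0 ?expR_ge0//.
apply: le_trans (ler_wpM2r (expR_ge0 _) (fA _)) _.
rewrite nz -(mulrA A) -expRD ler_wpM2l// ler_expR.
have a2 : 0 < alpha / 2 by rewrite divr_gt0.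
have H : (1 + eps) * (q / t ^+ 2) <= kappa * q.
  rewrite mulrA ler_pdivrMr ?exprn_gt0// -mulrA [q * _]mulrC mulrA.
  by rewrite ler_wpM2r.
have -> : alpha / 2 * (1 + eps) * (q / t ^+ 2) + - (alpha / 2) * q =
   alpha / 2 * ((1 + eps) * (q / t ^+ 2) - q) by ring.
have -> : - (alpha / 2) * (1 - kappa) * q = alpha / 2 * (kappa * q - q) by ring.
by rewrite ler_pM2l// lerB.
Qed.

(** The weight at z is at most the weight at z / t, and the change of variables contributes t^2 <=
    4. This handles t near 1, where the Gaussian majorants blow up. *)
Lemma dilation_small f (t J : R) : 1 < t -> t <= 2 -> pcontinuous f ->
  (fock_integral p alpha f <= J%:E)%E ->
  (fock_integral p alpha (dil f t) <= (4 * J)%:E)%E.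
Proof.
move=> t1 t2 cf fJ; have t0 : 0 < t by exact: lt_trans t1.
have ti0 : 0 < t^-1 by rewrite invr_gt0.
have mP : measurable_fun setT (EFin \o fock_integrand p alpha f).
  by apply/measurable_EFinP; exact: measurable_fock_integrand.
have P0 xy : (0 <= (EFin \o fock_integrand p alpha f) xy)%E.
  by rewrite lee_fin fock_integrand_ge0.
have E := integral2_scale ti0 mP P0.
have H : (fock_integral p alpha (dil f t) <= \int[leb \x leb]_xy
    (EFin \o fock_integrand p alpha f) (xy.1 * t^-1, xy.2 * t^-1)%R)%E.
  apply: ge0_le_integral.
  - exact: measurableT.
  - by move=> xy _; rewrite lee_fin fock_integrand_ge0.
  - apply/measurable_EFinP; apply: measurable_fock_integrand.
    by apply: dilation_pcontinuous => //; rewrite ltW.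
  - apply: measurableT_comp mP _; apply: measurable_fun_pair; apply: measurable_funM => //.
  - move=> xy _; rewrite lee_fin /fock_integrand /dil dilationE /=.
    rewrite ge0_ler_powR ?nnegrE ?(ltW p0) ?mulr_ge0 ?normc_ge0 ?expR_ge0//.
    rewrite ler_wpM2l ?normc_ge0// ler_expR !exprMn -mulrDl !mulNr lerN2.
    rewrite ler_wpM2l ?divr_ge0 ?(ltW alpha0)// ler_piMr ?addr_ge0 ?sqr_ge0//.
    by rewrite exprn_ile1 ?(ltW ti0)// invf_le1// ltW.
apply: le_trans H _; rewrite E invrK; apply: le_trans (lee_wpmul2l _ fJ) _.
  by rewrite lee_fin exprn_ge0// ltW.
rewrite -EFinM lee_fin ler_wpM2r//.
  by rewrite -lee_fin; apply: le_trans fJ; exact: fock_integral_ge0.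
by rewrite (_ : 4 = 2 ^+ 2); [rewrite lerXn2r ?nnegrE ?(ltW t0)|ring].
Qed.

End hausdorff_fock.

(** * Convergence, differences and Fatou's lemma for the Fock integral *)

Section fock_space.
Context {R : realType}.
Local Notation leb := (@lebesgue_measure R).
Implicit Types (f g : R[i] -> R[i]).

(** For l > 0 the power is exp (q ln x) near l; l = 0 needs a direct argument, with threshold
    e^(1/q). *)
Lemma powR_cvg (u : nat -> R) (l q : R) : 0 < q -> (forall n, 0 <= u n) ->
  u @ \oo --> l -> (fun n => u n `^ q) @ \oo --> l `^ q.
Proof.
move=> q0 u0 ul.
have l0 : 0 <= l.
  have -> : l = limn u by apply/esym/cvg_lim.
  by apply: limr_ge; [apply/cvg_ex; exists l|exact: nearW].
move: l0; rewrite le_eqVlt => /predU1P[l0|l0].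
  rewrite -l0 powR0 ?gt_eqF//; apply/cvgrPdist_lt => e e0.
  rewrite -l0 in ul.
  have d0 : 0 < e `^ q^-1 by rewrite powR_gt0.
  move/cvgrPdist_lt : ul => /(_ _ d0) [n _ Hn]; exists n => // m /Hn /=.
  rewrite !sub0r !normrN !ger0_norm ?powR_ge0// => H.
  have -> : e = (e `^ q^-1) `^ q by rewrite -powRrM mulVf ?gt_eqF// powRr1// ltW.
  by rewrite gt0_ltr_powR ?nnegrE ?powR_ge0.
have -> : l `^ q = expR (q * ln l) by rewrite /powR gt_eqF.
have L : (fun n => expR (q * ln (u n))) @ \oo --> expR (q * ln l).
  apply: continuous_cvg; first exact: continuous_expR.
  apply: cvgM; first exact: cvg_cst.
  by apply: continuous_cvg ul; exact: continuous_ln.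
apply: cvg_trans L; apply: near_eq_cvg.
move/cvgrPdist_lt : (ul) => /(_ _ l0) [n _ Hn]; exists n => // m /Hn /= H.
rewrite /powR gt_eqF//; move: H; rewrite ltr_norml => /andP[_].
by rewrite ltrBlDr ltrDl.
Qed.

Variables (p alpha : R).
Hypotheses (p1 : 1 < p) (alpha0 : 0 < alpha).

Let p0 : 0 < p. Proof. exact: lt_trans p1. Qed.

Let c0 : 0 < alpha * p / (2 * pi) :> R.
Proof. by rewrite divr_gt0 ?mulr_gt0 ?pi_gt0. Qed.

Lemma fock_norm_cvg0 (h : nat -> R[i] -> R[i]) :
  (fun k => fock_integral p alpha (h k)) @ \oo --> 0%E ->
  (fun k => fock_norm p alpha (h k)) @ \oo --> 0.
Proof.
move=> /fine_cvg H; rewrite -(@powR0 _ p^-1) ?invr_eq0 ?gt_eqF//.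
apply: powR_cvg; first by rewrite invr_gt0.
  by move=> k; rewrite mulr_ge0 ?(ltW c0)// fine_ge0// fock_integral_ge0.
rewrite -(mulr0 (alpha * p / (2 * pi))); apply: cvgM; first exact: cvg_cst.
exact: H.
Qed.

Lemma fock_norm_le_integral f (M : R) : in_fock p alpha f ->
  fock_norm p alpha f <= M ->
  (fock_integral p alpha f <= (M `^ p / (alpha * p / (2 * pi)))%:E)%E.
Proof.
move=> [_ fin] fM.
have I0 := fock_integral_ge0 p alpha f.
rewrite -[leLHS]fineK ?ge0_fin_numE// lee_fin ler_pdivlMr// mulrC.
have x0 : 0 <= alpha * p / (2 * pi) * fine (fock_integral p alpha f).
  by rewrite mulr_ge0 ?(ltW c0)// fine_ge0.
have -> : alpha * p / (2 * pi) * fine (fock_integral p alpha f) =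
    fock_norm p alpha f `^ p.
  by rewrite /fock_norm -powRrM mulVf ?gt_eqF// powRr1.
by rewrite ge0_ler_powR ?nnegrE ?(ltW p0) ?powR_ge0// (le_trans _ fM)// powR_ge0.
Qed.

(** From a + b <= 2 max (a, b). This pointwise bound takes the place of Minkowski's inequality,
    since the arguments use only boundedness and smallness up to a constant. *)
Lemma fock_integrandB_le f g xy :
  fock_integrand p alpha (fun z => f z - g z) xy <=
  2 `^ p * (fock_integrand p alpha f xy + fock_integrand p alpha g xy).
Proof.
rewrite /fock_integrand; set z := (_ +i* _)%C; set W := expR _.
have W0 : 0 <= W by exact: expR_ge0.
set a := normc (f z) * W; set b := normc (g z) * W.
have a0 : 0 <= a by rewrite mulr_ge0 ?normc_ge0.
have b0 : 0 <= b by rewrite mulr_ge0 ?normc_ge0.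
have ab : normc (f z - g z) * W <= a + b.
  by rewrite -mulrDl ler_wpM2r// normcB.
have H : normc (f z - g z) * W <= 2 * Num.max a b.
  apply: le_trans ab _; rewrite mulr_natl mulr2n lerD// le_max lexx ?orbT//.
have m0 : 0 <= Num.max a b by rewrite le_max a0.
apply: (@le_trans _ _ ((2 * Num.max a b) `^ p)).
  by rewrite ge0_ler_powR ?nnegrE ?(ltW p0) ?mulr_ge0 ?normc_ge0.
rewrite powRM// ler_wpM2l ?powR_ge0//.
by case: (leP a b) => _; [rewrite lerDr|rewrite lerDl]; exact: powR_ge0.
Qed.

Lemma fock_integralB_le f g (J : R) : pcontinuous f -> pcontinuous g ->
  pcontinuous (fun z => f z - g z) ->
  (fock_integral p alpha f <= J%:E)%E -> (fock_integral p alpha g <= J%:E)%E ->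
  (fock_integral p alpha (fun z => f z - g z)%R <= (2 `^ p * (J + J))%:E)%E.
Proof.
move=> cf cg cfg fJ gJ.
have mE h : pcontinuous h -> measurable_fun setT (fun xy => (fock_integrand p alpha h xy)%:E).
  by move=> ch; apply/measurable_EFinP; exact: measurable_fock_integrand.
have E0 h xy : (0 <= (fock_integrand p alpha h xy)%:E)%E.
  by rewrite lee_fin fock_integrand_ge0.
have H : (fock_integral p alpha (fun z => f z - g z)%R <=
   \int[leb \x leb]_xy ((2 `^ p)%:E * ((fock_integrand p alpha f xy)%:E +
      (fock_integrand p alpha g xy)%:E)))%E.
  apply: ge0_le_integral.
  - exact: measurableT.
  - by move=> xy _; exact: E0.
  - exact: mE.
  - by apply: measurable_funeM; apply: emeasurable_funD; exact: mE.
  - by move=> xy _; rewrite -EFinD -EFinM lee_fin fock_integrandB_le.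
apply: le_trans H _.
have k0 : (0 <= (2 `^ p)%:E :> \bar R)%E by rewrite lee_fin powR_ge0.
rewrite (ge0_integralZl (leb \x leb)%E measurableT (emeasurable_funD (mE f cf) (mE g cg)) _ k0);
  last by move=> xy _; exact: adde_ge0.
rewrite (ge0_integralD (leb \x leb)%E measurableT _ (mE f cf) _ (mE g cg)); last 2 first.
- by move=> xy _; exact: E0.
- by move=> xy _; exact: E0.
rewrite [leRHS]EFinM lee_wpmul2l ?lee_fin ?powR_ge0// EFinD.
exact: (leeD fJ gJ).
Qed.

Lemma fock_integral_fatou (u : nat -> R[i] -> R[i]) f (J : R) :
  (forall k, pcontinuous (u k)) ->
  (forall z, normc (u k z - f z) @[k --> \oo] --> (0 : R)) ->
  (forall k, (fock_integral p alpha (u k) <= J%:E)%E) ->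
  (fock_integral p alpha f <= J%:E)%E.
Proof.
move=> cu uf uJ.
have mE k : measurable_fun setT (fun xy => (fock_integrand p alpha (u k) xy)%:E).
  by apply/measurable_EFinP; exact: measurable_fock_integrand.
have E0 k xy : setT xy -> (0 <= (fock_integrand p alpha (u k) xy)%:E)%E.
  by move=> _; rewrite lee_fin fock_integrand_ge0.
have := fatou (leb \x leb)%E measurableT mE E0.
have -> : (\int[leb \x leb]_xy
    limn_einf (fun k => (fock_integrand p alpha (u k) xy)%:E))%E =
    fock_integral p alpha f.
  apply: eq_integral => xy _; apply: (cvg_limn_einf_sup _).1.
  apply/fine_cvgP; split; first exact: nearW.
  rewrite /=; apply: powR_cvg => //.
    by move=> k; rewrite mulr_ge0 ?normc_ge0 ?expR_ge0.
  apply: cvgM; last exact: cvg_cst.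
  apply/cvgrPdist_lt => e e0; move/cvgrPdist_lt : (uf (xy.1 +i* xy.2)%C) => /(_ e e0).
  move=> [n _ Hn]; exists n => // m /Hn /=; rewrite sub0r normrN ger0_norm ?normc_ge0//.
  by apply: le_lt_trans; rewrite normcBC normc_lipschitz.
move=> /le_trans; apply; rewrite limn_einf_lim; apply: lime_le.
  exact: is_cvg_einfs.
apply: nearW => n; apply: le_trans (uJ n); apply: ereal_inf_lbound.
by exists n => //=.
Qed.

End fock_space.

(** * Vanishing moments imply compactness *)

Section sufficiency.
Context {R : realType}.
Local Notation leb := (@lebesgue_measure R).
Variables (p alpha : R) (mu : {measure set R -> \bar R}) (N : R).
Hypotheses (p1 : 1 < p) (alpha0 : 0 < alpha).
Hypothesis mu01 : mu `]0, 1]%classic = 0%E.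
Hypothesis muN : (\int[mu]_(t in `]1%R, +oo[) (t^-1)%:E <= N%:E)%E.
Let D : set R := `]1, +oo[%classic.

Let mD : measurable D. Proof. exact: measurable_itv. Qed.

Let Dgt1 t : D t -> 1 < t.
Proof. by rewrite /D /= in_itv/= andbT. Qed.

Let Dgt0 t : D t -> 0 < t.
Proof. by move=> /Dgt1; exact: lt_trans. Qed.

Let dil (f : R[i] -> R[i]) (t : R) : R[i] -> R[i] := fun z => f (z / t%:C%C).

Lemma fock_growth_exp (eps J : R) : 0 < eps -> 0 <= J -> exists2 A : R, 0 <= A &
  forall f, entire f -> (fock_integral p alpha f <= J%:E)%E ->
  forall z, normc (f z) <= A * expR (alpha / 2 * (1 + eps) * normc z ^+ 2).
Proof.
move=> e0 J0; exists (32 * (5 + J) * expR (alpha / 2 * (1 + eps^-1) * 8)).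
  by rewrite !mulr_ge0 ?expR_ge0// addr_ge0.
by move=> f fe fJ z; exact: (fock_growth p1 alpha0 z e0 fe fJ).
Qed.

Lemma fock_locally_bounded (J : R) : 0 <= J -> exists K : R -> R,
  forall f, entire f -> (fock_integral p alpha f <= J%:E)%E ->
  forall z r, normc z <= r -> normc (f z) <= K r.
Proof.
move=> J0; have [A A0 HA] := fock_growth_exp ltr01 J0.
exists (fun r => A * expR (alpha / 2 * (1 + 1) * r ^+ 2)) => f fe fJ z r zr.
apply: le_trans (HA f fe fJ z) _; rewrite ler_wpM2l// ler_expR ler_wpM2l//.
  by rewrite mulr_ge0 ?divr_ge0 ?(ltW alpha0)// addr_ge0.
by rewrite lerXn2r ?nnegrE ?normc_ge0// (le_trans _ zr)// normc_ge0.
Qed.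

(* The gain comes from the dilation: since t > 1, the weight beats the growth
   of f(z / t), uniformly in f. *)
Lemma dilation_dominated (t J : R) : 1 < t -> 0 <= J ->
  exists2 G : R * R -> R, (leb \x leb)%E.-integrable setT (EFin \o G) &
  forall f, entire f -> (fock_integral p alpha f <= J%:E)%E ->
  forall xy, fock_integrand p alpha (dil f t) xy <= G xy.
Proof.
move=> t1 J0; have t0 : 0 < t by exact: lt_trans t1.
have tt : 1 < t ^+ 2 by rewrite exprn_egt1.
(* The growth loss eps is half of the gain t^2 - 1, so that kappa stays below 1. *)
pose eps := (t ^+ 2 - 1) / 2; pose kappa := (1 + eps) / t ^+ 2.
have e0 : 0 < eps by rewrite divr_gt0// subr_gt0.
have k1 : kappa < 1.
  by rewrite /kappa ltr_pdivrMr ?exprn_gt0// mul1r /eps; lra.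
have [A A0 HA] := fock_growth_exp e0 J0.
pose k := p * (alpha / 2) * (1 - kappa).
have k0 : 0 < k by rewrite !mulr_gt0 ?invr_gt0 ?subr_gt0// (lt_trans ltr01).
exists (fun xy => A `^ p * expR (- k * (xy.1 ^+ 2 + xy.2 ^+ 2))).
  have iG : (leb \x leb)%E.-integrable setT
      (EFin \o (fun xy : R * R => expR (- k * (xy.1 ^+ 2 + xy.2 ^+ 2)))).
    apply/integrableP; split.
      by apply/measurable_EFinP; exact: measurable_gauss_weight.
    under eq_integral => xy _ do rewrite /= ger0_norm ?expR_ge0//.
    exact: integral2_gauss_lty.
  exact: (integrableZl _ (A `^ p) iG).
move=> f fe fJ xy; apply: (dilation_gauss_bound p1 alpha0 _ t0 A0 (HA f fe fJ)).
by rewrite /kappa divfK ?gt_eqF ?exprn_gt0.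
Qed.

(** For t <= 2 by change of variables. For t > 2 the growth bound with eps = 1 suffices: 1 + 1 <=
    (1/2) t^2, so kappa = 1/2 and one Gaussian serves all such t. *)
Lemma dilation_norm_bounded (J : R) : 0 <= J -> exists2 K : R, 0 <= K &
  forall f, entire f -> (fock_integral p alpha f <= J%:E)%E ->
  forall t, 1 < t -> (fock_integral p alpha (dil f t) <= K%:E)%E.
Proof.
move=> J0; have [A A0 HA] := fock_growth_exp ltr01 J0.
pose k := p * (alpha / 2) * (1 - 1 / 2).
have k0 : 0 < k.
  by rewrite !mulr_gt0 ?invr_gt0 ?subr_gt0// ?(lt_trans ltr01)// ltr_pdivrMr// mul1r ltr1n.
have Gfin := integral2_gauss_lty k0.
set G := (\int[_]_xy _)%E in Gfin.
have G0 : (0 <= G)%E by apply: integral_ge0 => xy _; rewrite lee_fin expR_ge0.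
have GE : G \is a fin_num by rewrite ge0_fin_numE.
exists (4 * J + A `^ p * fine G).
  by rewrite addr_ge0 ?mulr_ge0 ?powR_ge0 ?fine_ge0.
move=> f fe fJ t t1; have [t2|t2] := leP t 2.
  apply: le_trans (dilation_small p1 alpha0 t1 t2 (entire_pcontinuous fe) fJ) _.
  by rewrite lee_fin lerDl mulr_ge0 ?powR_ge0 ?fine_ge0.
have H : (fock_integral p alpha (dil f t) <=
    \int[leb \x leb]_xy ((A `^ p)%:E * (expR (- k * (xy.1 ^+ 2 + xy.2 ^+ 2)))%:E))%E.
  apply: ge0_le_integral.
  - exact: measurableT.
  - by move=> xy _; rewrite lee_fin fock_integrand_ge0.
  - apply/measurable_EFinP; apply: measurable_fock_integrand.
    by apply: dilation_pcontinuous; [exact: ltW|exact: entire_pcontinuous].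
  - by apply: measurable_funeM; apply/measurable_EFinP; exact: measurable_gauss_weight.
  - move=> xy _; rewrite -EFinM lee_fin.
    have t0 : 0 < t by exact: lt_trans t1.
    apply: (dilation_gauss_bound p1 alpha0 _ t0 A0 (HA f fe fJ)).
    have : 2 ^+ 2 <= t ^+ 2 by rewrite lerXn2r ?nnegrE ?(ltW t2) ?(ltW t0).
    lra.
apply: le_trans H _.
have mw : measurable_fun setT
    (fun xy : R * R => (expR (- k * (xy.1 ^+ 2 + xy.2 ^+ 2)))%:E).
  by apply/measurable_EFinP; exact: measurable_gauss_weight.
have Ap0 : (0 <= (A `^ p)%:E :> \bar R)%E by rewrite lee_fin powR_ge0.
rewrite (ge0_integralZl (leb \x leb)%E measurableT mw _ Ap0); last first.
  by move=> xy _; rewrite lee_fin expR_ge0.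
by rewrite -/G -(fineK GE) -EFinM lee_fin lerDr mulr_ge0.
Qed.

Lemma hausdorff_integral_bounded (K : R) f (B : R -> R) : entire f ->
  (forall z r, normc z <= r -> normc (f z) <= B r) ->
  (forall t, 1 < t -> (fock_integral p alpha (dil f t) <= K%:E)%E) -> 0 <= K ->
  (fock_integral p alpha (hausdorff mu f) < +oo)%E.
Proof.
move=> fe fB fK K0.
apply: le_lt_trans (fock_integral_hausdorff_le alpha p1 mu01 muN fe fB) _.
have H : (\int[mu]_(t in D) ((t^-1)%:E * fock_integral p alpha (dil f t)) <=
    \int[mu]_(t in D) (K%:E * (t^-1)%:E))%E.
  apply: ge0_le_integral.
  - exact: mD.
  - move=> t Dt; rewrite mule_ge0 ?fock_integral_ge0// lee_fin invr_ge0 ltW//.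
    exact: Dgt0.
  - exact: measurable_dilation_norms (entire_pcontinuous fe).
  - apply: measurable_funeM; apply: measurable_funTS; apply/measurable_EFinP.
    exact: measurable_invr.
  - move=> t Dt; rewrite muleC lee_wpmul2r ?lee_fin ?invr_ge0 ?(ltW (Dgt0 Dt))//.
    by rewrite fK// Dgt1.
have iK := integrable_invrM muN K.
have Kfin : (\int[mu]_(t in D) (K%:E * (t^-1)%:E) < +oo)%E.
  have /integrable_fin_num := iK => /(_ mD).
  rewrite ge0_fin_numE//; apply: integral_ge0 => t Dt.
  by rewrite /= lee_fin mulr_ge0// invr_ge0 ltW// Dgt0.
have : (\int[mu]_(t in D) ((t^-1)%:E * fock_integral p alpha (dil f t)) < +oo)%E.
  exact: le_lt_trans H Kfin.
set I := (\int[mu]_(t in _) _)%E => Ioo.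
have I0 : (0 <= I)%E.
  apply: integral_ge0 => t Dt; rewrite mule_ge0 ?fock_integral_ge0// lee_fin.
  by rewrite invr_ge0 ltW// Dgt0.
have If : I \is a fin_num by rewrite ge0_fin_numE.
by rewrite -(fineK If) -EFinM ltry.
Qed.

Lemma hausdorff_in_fock f : in_fock p alpha f ->
  hausdorff_defined mu f /\ in_fock p alpha (hausdorff mu f).
Proof.
move=> [fe ffin]; have I0 := fock_integral_ge0 p alpha f.
pose J := fine (fock_integral p alpha f).
have J0 : 0 <= J by rewrite fine_ge0.
have fJ : (fock_integral p alpha f <= J%:E)%E by rewrite fineK ?ge0_fin_numE.
have [B HB] := fock_locally_bounded J0.
have [K K0 HK] := dilation_norm_bounded J0.
have cf := entire_pcontinuous fe.
split; first exact: (hausdorff_defined_bounded mu01 muN cf (HB f fe fJ)).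
split; first exact: (hausdorff_entire mu01 muN cf (HB f fe fJ) fe).
exact: (hausdorff_integral_bounded fe (HB f fe fJ) (HK f fe fJ) K0).
Qed.

(** The g k themselves may fail to converge in norm; it is the dilations with t > 1 that turn
    bounded pointwise convergence into norm convergence. Dominated convergence is used in the plane
    for fixed t, and again in t with majorant K t^-1. *)
Lemma hausdorff_integral_cvg0 (g : nat -> R[i] -> R[i]) (J : R) : 0 <= J ->
  (forall k, entire (g k)) -> (forall k, (fock_integral p alpha (g k) <= J%:E)%E) ->
  (forall z, normc (g k z) @[k --> \oo] --> (0 : R)) ->
  (fun k => fock_integral p alpha (hausdorff mu (g k))) @ \oo --> 0%E.
Proof.
move=> J0 ge gJ g0.
have p0 : 0 < p by exact: lt_trans p1.
have [B HB] := fock_locally_bounded J0.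
have [K K0 HK] := dilation_norm_bounded J0.
pose C := (2 * (N + 1)) `^ p.
pose I k := (\int[mu]_(t in D) ((t^-1)%:E * fock_integral p alpha (dil (g k) t)))%E.
have dil0 t : 1 < t -> (fun k => fock_integral p alpha (dil (g k) t)) @ \oo --> 0%E.
  move=> t1; have [G iG HG] := dilation_dominated t1 J0.
  have -> : 0%E = (\int[leb \x leb]_(xy in setT) (cst 0 xy))%E.
    by rewrite integral_cst// mul0e.
  rewrite /fock_integral; refine (@dominated_cvg _ _ R (leb \x leb)%E setT measurableT
    (fun k xy => (fock_integrand p alpha (dil (g k) t) xy)%:E)
    (cst 0%E) (EFin \o G) _ _ _ iG _).
  - move=> k; apply/measurable_EFinP; apply: measurable_fock_integrand.
    by apply: dilation_pcontinuous; [exact: ltW|exact: entire_pcontinuous].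
  - move=> xy _; apply/fine_cvgP; split; first exact: nearW.
    rewrite -(@powR0 _ p) ?gt_eqF//; apply: powR_cvg => //.
      by move=> k; rewrite mulr_ge0 ?normc_ge0 ?expR_ge0.
    rewrite -[X in _ --> X](mul0r (expR (- (alpha / 2) * (xy.1 ^+ 2 + xy.2 ^+ 2)))).
    by apply: cvgM; [exact: g0|exact: cvg_cst].
  - by [].
  - move=> k xy _; rewrite /= lee_fin ger0_norm ?fock_integrand_ge0//.
    exact: HG.
have I0 : I @ \oo --> 0%E.
  have -> : 0%E = (\int[mu]_(t in D) (cst 0 t))%E.
    by rewrite integral_cst// mul0e.
  refine (@dominated_cvg _ _ R mu D mD
    (fun k t => ((t^-1)%:E * fock_integral p alpha (dil (g k) t))%E)
    (cst 0%E) (EFin \o (fun t => K * t^-1)) _ _ _ (integrable_invrM muN K) _).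
  - by move=> k; exact: measurable_dilation_norms (entire_pcontinuous (ge k)).
  - move=> t Dt; rewrite -[X in _ --> X](mule0 (t^-1)%:E).
    by apply: cvgeZl => //; exact: dil0 (Dgt1 Dt).
  - by [].
  - move=> k t Dt; have ti : 0 <= t^-1 by rewrite invr_ge0 ltW// Dgt0.
    rewrite gee0_abs ?mule_ge0 ?lee_fin ?fock_integral_ge0//.
    by rewrite /= EFinM muleC lee_wpmul2r ?lee_fin// HK// Dgt1.
apply: (@squeeze_cvge _ _ _ _ (cst 0%E) _ (fun k => (C%:E * I k)%E)).
- apply: nearW => k; rewrite fock_integral_ge0/=.
  exact: (fock_integral_hausdorff_le alpha p1 mu01 muN (ge k) (HB _ (ge k) (gJ k))).
- exact: cvg_cst.
- by rewrite -[X in _ --> X](mule0 C%:E); exact: cvgeZl.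
Qed.

Lemma hausdorff_compact : hausdorff_compact_on_fock p alpha mu.
Proof.
split; first exact: hausdorff_in_fock.
move=> u uF [M uM].
pose J := Num.max 0 (M `^ p / (alpha * p / (2 * pi))).
have J0 : 0 <= J by rewrite le_max lexx.
have uJ k : (fock_integral p alpha (u k) <= J%:E)%E.
  apply: le_trans (fock_norm_le_integral p1 alpha0 (uF k) (uM k)) _.
  by rewrite lee_fin le_max lexx orbT.
have ue k : entire (u k) by case: (uF k).
have [B HB] := fock_locally_bounded J0.
have [phi [f [phi_mono fe uf]]] := montel ue (fun k => HB _ (ue k) (uJ k)).
have fJ : (fock_integral p alpha f <= J%:E)%E.
  apply: (fock_integral_fatou p1 (u := u \o phi) _ uf (fun k => uJ (phi k))) => k.
  exact: entire_pcontinuous (ue _).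
have fF : in_fock p alpha f.
  by split; [exact: fe|apply: le_lt_trans fJ _; rewrite ltry].
exists phi, (hausdorff mu f); split; first exact: phi_mono.
split; first by case: (hausdorff_in_fock fF).
pose g k z := u (phi k) z - f z.
have ge k : entire (g k) := entireB (ue (phi k)) fe.
have cu k := entire_pcontinuous (ue k).
have cf := entire_pcontinuous fe.
have cg k := entire_pcontinuous (ge k).
have HE k : (fun z => hausdorff mu (u (phi k)) z - hausdorff mu f z) = hausdorff mu (g k).
  apply/funext => z.
  by rewrite (hausdorffB mu01 muN _ (cu _) cf (HB _ (ue _) (uJ _)) (HB f fe fJ) (cg k)).
under eq_fun do rewrite HE.
apply: (fock_norm_cvg0 p1 alpha0).
apply: (hausdorff_integral_cvg0 (J := 2 `^ p * (J + J)) _ ge _ uf).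
- by rewrite mulr_ge0 ?powR_ge0// addr_ge0.
- by move=> k; exact: (fock_integralB_le p1 (cu _) cf (cg k) (uJ _) fJ).
Qed.

End sufficiency.

(** * Compactness implies vanishing moments *)

Section necessity.
Context {R : realType}.
Local Notation leb := (@lebesgue_measure R).
Variables (p alpha : R).
Hypotheses (p1 : 1 < p) (alpha0 : 0 < alpha).
Implicit Types (f g : R[i] -> R[i]) (n : nat).

Let p0 : 0 < p. Proof. exact: lt_trans p1. Qed.

Lemma entire_cst (k : R[i]) : entire (fun=> k).
Proof. by move=> z; exact: derivable_cst. Qed.

Lemma entireM f g : entire f -> entire g -> entire (fun z => f z * g z).
Proof.
move=> ef eg z.
exact: (@derivableM _ _ (f : R[i]^o -> R[i]) (g : R[i]^o -> R[i]) z 1 (ef z) (eg z)).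
Qed.

Lemma entireX n : entire (fun z : R[i] => z ^+ n)%R.
Proof.
elim: n => [|n IH]; first exact: entire_cst.
have -> : (fun z : R[i] => z ^+ n.+1) = (fun z => z * z ^+ n).
  by apply/funext => z; rewrite exprS.
by apply: entireM IH => z; exact: derivable_id.
Qed.

Lemma fock_integralZ f (k : R[i]) : pcontinuous f ->
  fock_integral p alpha (fun z => k * f z) =
  ((normc k `^ p)%:E * fock_integral p alpha f)%E.
Proof.
move=> cf; rewrite /fock_integral.
have mw : measurable_fun setT (fun xy => (fock_integrand p alpha f xy)%:E).
  by apply/measurable_EFinP; exact: measurable_fock_integrand.
have k0 : (0 <= (normc k `^ p)%:E :> \bar R)%E by rewrite lee_fin powR_ge0.
rewrite -(ge0_integralZl (leb \x leb)%E measurableT mw _ k0); last first.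
  by move=> xy _; rewrite lee_fin fock_integrand_ge0.
apply: eq_integral => xy _; rewrite -EFinM; congr EFin.
rewrite /fock_integrand ComplexField.Normc.normcM -mulrA powRM ?normc_ge0//.
by rewrite mulr_ge0 ?normc_ge0 ?expR_ge0.
Qed.

(** For r >= 1 one has d r <= d r^2 <= exp (d r^2); the n-th power of r <= d^-1 exp (d r^2) has
    exponent n d r^2, and d is chosen so that n d <= alpha / 8. *)
Lemma monomial_growth n : exists2 A : R, 0 <= A &
  forall z : R[i], normc (z ^+ n) <= A * expR (alpha / 2 * (1 / 4) * normc z ^+ 2).
Proof.
pose d : R := alpha / (8 * n.+1%:R).
have d0 : 0 < d by rewrite divr_gt0// mulr_gt0.
exists (1 + d^-1 ^+ n); first by rewrite addr_ge0// exprn_ge0// invr_ge0 ltW.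
move=> z; rewrite normcX; set r := normc z; have r0 : 0 <= r := normc_ge0 z.
have e1 : 1 <= expR (alpha / 2 * (1 / 4) * r ^+ 2).
  by rewrite -expR0 ler_expR !mulr_ge0 ?invr_ge0 ?exprn_ge0// ltW.
set E := expR _ in e1 *; rewrite mulrDl mul1r; have [r1|/ltW r1] := leP r 1.
  rewrite -[leLHS]addr0 lerD//; first by apply: le_trans e1; exact: exprn_ile1.
  by rewrite mulr_ge0 ?expR_ge0// exprn_ge0// invr_ge0 ltW.
rewrite -[leLHS]add0r lerD ?expR_ge0//.
rewrite /E; have rr : r <= d^-1 * expR (d * r ^+ 2).
  rewrite mulrC ler_pdivlMr// mulrC.
  apply: (@le_trans _ _ (d * r ^+ 2)).
    by rewrite ler_wpM2l ?(ltW d0)// expr2 ler_peMr.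
  by apply: le_trans (expR_ge1Dx _); rewrite lerDr.
apply: (@le_trans _ _ ((d^-1 * expR (d * r ^+ 2)) ^+ n)).
  by rewrite lerXn2r ?nnegrE// mulr_ge0 ?expR_ge0// invr_ge0 ltW.
rewrite exprMn ler_wpM2l ?exprn_ge0 ?invr_ge0 ?(ltW d0)//.
rewrite -expRM_natl ler_expR mulrA ler_wpM2r ?exprn_ge0//.
rewrite /d mulrA ler_pdivrMr ?mulr_gt0//.
have -> : alpha / 2 * (1 / 4) * (8 * n.+1%:R) = n.+1%:R * alpha by field.
by rewrite ler_wpM2r ?(ltW alpha0)// ler_nat.
Qed.

Lemma monomial_integral_lty n :
  (fock_integral p alpha (fun z : R[i] => z ^+ n)%R < +oo)%E.
Proof.
have [A A0 HA] := monomial_growth n.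
pose k := p * (alpha / 2) * (1 - 1 / 4).
have k0 : 0 < k.
  by rewrite !mulr_gt0 ?invr_gt0 ?subr_gt0// ltr_pdivrMr// mul1r ltr1n.
have em : entire (fun z : R[i] => z ^+ n)%R by exact: entireX.
have mw : measurable_fun setT
    (fun xy : R * R => (expR (- k * (xy.1 ^+ 2 + xy.2 ^+ 2)))%:E).
  by apply/measurable_EFinP; exact: measurable_gauss_weight.
have Gfin := integral2_gauss_lty k0.
set G := (\int[_]_xy _)%E in Gfin.
have G0 : (0 <= G)%E by apply: integral_ge0 => xy _; rewrite lee_fin expR_ge0.
have GE : G \is a fin_num by rewrite ge0_fin_numE.
have H : (fock_integral p alpha (fun z : R[i] => z ^+ n)%R <=
    \int[leb \x leb]_xy ((A `^ p)%:E * (expR (- k * (xy.1 ^+ 2 + xy.2 ^+ 2)))%:E))%E.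
  apply: ge0_le_integral.
  - exact: measurableT.
  - by move=> xy _; rewrite lee_fin fock_integrand_ge0.
  - apply/measurable_EFinP; apply: measurable_fock_integrand.
    exact: entire_pcontinuous.
  - exact: measurable_funeM.
  - move=> xy _; rewrite -EFinM lee_fin.
    (* The growth rate 1/4 is written as 1 + eps with eps = -3/4, so that the dilation bound applies
       at t = 1. *)
    have HA' w : normc (w ^+ n : R[i]) <= A * expR (alpha / 2 * (1 + - (3 / 4)) * normc w ^+ 2).
      by rewrite (_ : 1 + - (3 / 4) = 1 / 4 :> R); [exact: HA|field].
    have e14 : 1 + - (3 / 4) <= 1 / 4 * 1 ^+ 2 :> R by rewrite expr1n mulr1; lra.
    have := dilation_gauss_bound p1 alpha0 xy ltr01 A0 HA' e14.
    by under [X in fock_integrand _ _ X]eq_fun do rewrite rmorph1 divr1.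
apply: le_lt_trans H _.
have Ap0 : (0 <= (A `^ p)%:E :> \bar R)%E by rewrite lee_fin powR_ge0.
rewrite (ge0_integralZl (leb \x leb)%E measurableT mw _ Ap0); last first.
  by move=> xy _; rewrite lee_fin expR_ge0.
by rewrite -/G -(fineK GE) -EFinM ltry.
Qed.

(** On the square [K, K + 1] x [0, 1], of area 1, one has |z| >= K and |z|^2 <= (K + 1)^2 + 1.
    Beside K^n the bound has a factor that does not depend on n. *)
Lemma monomial_integral_lower (K : R) n : 0 <= K ->
  (((K ^+ n * expR (- (alpha / 2) * ((K + 1) ^+ 2 + 1))) `^ p)%:E <=
   fock_integral p alpha (fun z : R[i] => z ^+ n)%R)%E.
Proof.
move=> K0; pose B : set (R * R) := `[K, K + 1]%classic `*` `[0, 1]%classic.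
have mB : measurable B by apply: measurableX; exact: measurable_itv.
have B1 : (leb \x leb)%E B = 1%E.
  have l1 (a : R) : leb `[a, a + 1]%classic = 1%E.
    by rewrite lebesgue_measure_itv/= lte_fin ltrDl ltr01 -EFinB addrAC subrr add0r.
  have l2 : leb `[0, 1]%classic = 1%E by have := l1 0; rewrite add0r.
  have m1 : measurable (`[K, K + 1]%classic : set R) by exact: measurable_itv.
  have m2 : measurable (`[0, 1]%classic : set R) by exact: measurable_itv.
  apply: etrans (product_measure1E leb leb m1 m2) _; rewrite -[RHS]mule1.
  by congr (_ * _)%E; [exact: l1|exact: l2].
set L := (_ `^ p)%:E.
have -> : L = (\int[leb \x leb]_(xy in B) L)%E.
  by rewrite integral_cst//= B1 mule1.
have cm : pcontinuous (fun z : R[i] => z ^+ n)%R.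
  by apply: entire_pcontinuous; exact: entireX.
have mw : measurable_fun setT (fun xy => (fock_integrand p alpha (fun z : R[i] => z ^+ n)%R xy)%:E).
  by apply/measurable_EFinP; exact: measurable_fock_integrand.
have H : (\int[leb \x leb]_(xy in B) (fock_integrand p alpha (fun z : R[i] => z ^+ n)%R xy)%:E <=
    fock_integral p alpha (fun z : R[i] => z ^+ n)%R)%E.
  apply: ge0_subset_integral; [exact: mB|exact: measurableT|exact: mw| |by []].
  by move=> xy _; rewrite lee_fin fock_integrand_ge0.
apply: le_trans H; apply: ge0_le_integral.
- exact: mB.
- by move=> xy _; rewrite lee_fin powR_ge0.
- exact: measurable_cst.
- exact: measurable_funTS.
- move=> [x y] []; rewrite /= !in_itv/= => /andP[x1 x2] /andP[y1 y2].
  have x0 : 0 <= x by exact: le_trans x1.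
  rewrite lee_fin /fock_integrand ge0_ler_powR ?nnegrE ?(ltW p0)//=.
  - by rewrite mulr_ge0 ?expR_ge0// exprn_ge0.
  - by rewrite mulr_ge0 ?normc_ge0 ?expR_ge0.
  apply: ler_pM; rewrite ?exprn_ge0 ?expR_ge0//.
    rewrite normcX lerXn2r ?nnegrE ?normc_ge0//.
    by apply: le_trans (le_trans x1 _) (Re_le_normc _); exact: ler_norm.
  rewrite ler_expR !mulNr lerN2 ler_wpM2l ?divr_ge0 ?(ltW alpha0)//.
  by rewrite lerD// ?lerXn2r ?nnegrE ?addr_ge0// exprn_ile1.
Qed.

(** Chosen to make [fock_integral], rather than [fock_norm], equal to 1; the norms of the scaled
    monomials then share one constant value. *)
Definition monomial_scale n : R :=
  (fine (fock_integral p alpha (fun z : R[i] => z ^+ n)%R)) `^ (- p^-1).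

Definition normalized_monomial n (z : R[i]) : R[i] :=
  (monomial_scale n)%:C%C * z ^+ n.

Let I n := fine (fock_integral p alpha (fun z : R[i] => z ^+ n)%R).

Let IE n : (I n)%:E = fock_integral p alpha (fun z : R[i] => z ^+ n)%R.
Proof.
rewrite /I fineK// ge0_fin_numE ?fock_integral_ge0//.
exact: monomial_integral_lty.
Qed.

Let I_lower (K : R) n : 0 <= K ->
  (K ^+ n * expR (- (alpha / 2) * ((K + 1) ^+ 2 + 1))) `^ p <= I n.
Proof. by move=> K0; rewrite -lee_fin IE; exact: monomial_integral_lower. Qed.

Let I_gt0 n : 0 < I n.
Proof.
apply: lt_le_trans (I_lower n ler01).
by rewrite expr1n mul1r powR_gt0// expR_gt0.
Qed.

Let scaleI n : monomial_scale n `^ p * I n = 1.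
Proof.
rewrite /monomial_scale -/(I n) -powRrM mulNr mulVf ?gt_eqF// powRN powRr1 ?ltW//.
by rewrite mulVf// gt_eqF.
Qed.

Lemma normalized_monomial_integral n :
  fock_integral p alpha (normalized_monomial n) = 1%E.
Proof.
rewrite /normalized_monomial fock_integralZ; last first.
  by apply: entire_pcontinuous; exact: entireX.
rewrite -IE normc_real ger0_norm ?powR_ge0// -EFinM.
by rewrite scaleI.
Qed.

Lemma normalized_monomial_entire n : entire (normalized_monomial n).
Proof.
exact: (@entireM (fun=> (monomial_scale n)%:C%C) (fun z => z ^+ n)
  (@entire_cst _) (@entireX n)).
Qed.

(** With K = |z| + 1 the lower bound on the integral keeps [monomial_scale n * K ^+ n] bounded in n,
    which leaves the geometric factor (|z| / K)^n. *)
Lemma normalized_monomial_cvg0 (z : R[i]) (phi : nat -> nat) :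
  (forall k, (k <= phi k)%N) ->
  normc (normalized_monomial (phi k) z) @[k --> \oo] --> (0 : R).
Proof.
move=> phik; pose K := normc z + 1.
have K0 : 0 < K by rewrite ltr_wpDl ?normc_ge0.
pose w := expR (- (alpha / 2) * ((K + 1) ^+ 2 + 1)).
have w0 : 0 < w by exact: expR_gt0.
have bound n : monomial_scale n * K ^+ n <= w^-1.
  rewrite -[leRHS]div1r ler_pdivlMr// -mulrA leNgt; apply/negP => H.
  have : 1 < (monomial_scale n * (K ^+ n * w)) `^ p.
    by rewrite -[ltLHS](congr1 (@^~ p) (powR1 R)) gt0_ltr_powR ?nnegrE// ltW// (lt_trans ltr01).
  rewrite powRM ?powR_ge0 ?mulr_ge0 ?exprn_ge0 ?(ltW K0) ?(ltW w0)//.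
  apply/negP; rewrite -leNgt -(scaleI n) ler_wpM2l ?powR_ge0//.
  exact: I_lower (ltW K0).
have q0 : 0 <= normc z / K by rewrite divr_ge0 ?normc_ge0 ?ltW.
have q1 : normc z / K < 1 by rewrite ltr_pdivrMr// mul1r /K ltrDl.
have L : w^-1 * (normc z / K) ^+ k @[k --> \oo] --> (0 : R).
  rewrite -[X in _ --> X](mulr0 w^-1); apply: cvgM; first exact: cvg_cst.
  by apply: cvg_expr; rewrite ger0_norm.
apply: (squeeze_cvgr _ (cvg_cst 0) L); apply: nearW => k; rewrite normc_ge0/=.
rewrite /normalized_monomial ComplexField.Normc.normcM normc_real normcX.
rewrite ger0_norm ?powR_ge0//.
have -> : monomial_scale (phi k) * normc z ^+ phi k =
    monomial_scale (phi k) * K ^+ phi k * (normc z / K) ^+ phi k.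
  by rewrite -mulrA -exprMn mulrC (mulrC K) divfK ?gt_eqF// mulrC.
apply: ler_pM; rewrite ?mulr_ge0 ?powR_ge0 ?exprn_ge0 ?(ltW K0)//.
by rewrite ler_wiXn2l// ltW.
Qed.

End necessity.

(** * Moments of mu and the diagonal action on monomials *)

Section tail_moments.
Context {R : realType}.
Variables (mu : {measure set R -> \bar R}) (M : R).
Hypothesis mu01 : mu `]0, 1[%classic = 0%E.
Hypothesis muM : forall n : nat,
  (\int[mu]_(t in `[1%R, +oo[) (t ^- n.+1)%:E <= M%:E)%E.
Implicit Types n : nat.
Let E : set R := `[1, +oo[%classic.

Let mE : measurable E. Proof. exact: measurable_itv. Qed.

Let posE : `]0, +oo[%classic = `]0, 1[%classic `|` E :> set R.
Proof. by rewrite /E -itv_bndbnd_setU ?bnd_simp. Qed.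

Let disE : [disjoint `]0, 1[%classic & E].
Proof.
apply/disj_setPS => t [/=]; rewrite /E /= !in_itv/= andbT => /andP[_ t1] t2.
by move: (lt_le_trans t1 t2); rewrite ltxx.
Qed.

Let Ege1 t : E t -> 1 <= t.
Proof. by rewrite /E /= in_itv/= andbT. Qed.

Let Egt0 t : E t -> 0 < t.
Proof. by move=> /Ege1; exact: lt_le_trans. Qed.

Let measurable_invX n : measurable_fun [set: R] (fun t : R => t ^- n).
Proof.
under eq_fun do rewrite -exprVn.
by apply: measurable_funX; exact: measurable_invr.
Qed.

Definition moment n : R := fine (\int[mu]_(t in E) (t ^- n.+1)%:E)%E.

Lemma moment_ge0 n : 0 <= moment n.
Proof.
apply: fine_ge0; apply: integral_ge0 => t Et.
by rewrite lee_fin invr_ge0 exprn_ge0// ltW// Egt0.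
Qed.

Lemma momentE n : (moment n)%:E = (\int[mu]_(t in E) (t ^- n.+1)%:E)%E.
Proof.
rewrite /moment fineK// ge0_fin_numE; last first.
  apply: integral_ge0 => t Et.
  by rewrite lee_fin invr_ge0 exprn_ge0// ltW// Egt0.
by apply: le_lt_trans (muM n) _; rewrite ltry.
Qed.

Lemma moment_nonincreasing : {homo moment : m n / (m <= n)%N >-> n <= m}.
Proof.
move=> m n mn; rewrite -lee_fin !momentE; apply: ge0_le_integral.
- exact: mE.
- by move=> t Et; rewrite lee_fin invr_ge0 exprn_ge0// ltW// Egt0.
- by apply: measurable_funTS; apply/measurable_EFinP; exact: measurable_invX.
- by apply: measurable_funTS; apply/measurable_EFinP; exact: measurable_invX.
- move=> t Et; rewrite lee_fin lef_pV2 ?posrE ?exprn_gt0 ?(Egt0 Et)//.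
  by rewrite ler_weXn2l ?(Ege1 Et).
Qed.

Let integrableE n : mu.-integrable E (EFin \o (fun t : R => t ^- n.+1)%R).
Proof.
apply/integrableP; split.
  by apply: measurable_funTS; apply/measurable_EFinP; exact: measurable_invX.
rewrite (eq_integral (fun t : R => (t ^- n.+1)%:E)).
  by apply: le_lt_trans (muM n) _; rewrite ltry.
move=> t /[!inE] Et.
by rewrite /= ger0_norm// invr_ge0 exprn_ge0// ltW// Egt0.
Qed.

Lemma integrable_invX n : mu.-integrable `]0, +oo[ (EFin \o (fun t : R => t ^- n.+1)%R).
Proof.
have mg := measurable_invX n.+1.
have /integrableP[_ ig] := integrableE n; apply/integrableP; split.
  by apply: measurable_funTS; exact/measurable_EFinP.
have ma : measurable_fun [set: R] (fun t => `|(EFin \o (fun t : R => t ^- n.+1)%R) t|)%E.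
  by apply: measurableT_comp => //; exact/measurable_EFinP.
rewrite posE ge0_integral_setU//; last exact: measurable_funTS.
by rewrite null_set_integral ?add0e//; exact: measurable_funTS.
Qed.

Lemma Rintegral_invX n : Rintegral mu `]0, +oo[ (fun t : R => t ^- n.+1)%R = moment n.
Proof.
have := integrable_invX n; rewrite posE => ig.
rewrite Rintegral_setU// [X in X + _ = _](_ : _ = 0) ?add0r//.
rewrite /Rintegral null_set_integral//.
by apply: measurable_funTS; apply/measurable_EFinP; exact: measurable_invX.
Qed.

Lemma hausdorff_monomial (k z : R[i]) n :
  hausdorff mu (fun w => k * w ^+ n) z = (moment n)%:C%C * (k * z ^+ n).
Proof.
have dilate t : t \in (`]0, +oo[%classic : set R) ->
    k * (z / t%:C%C) ^+ n = (t ^- n)%:C%C * (k * z ^+ n).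
  move=> _; rewrite exprMn exprVn -rmorphXn -fmorphV/=.
  by rewrite [in RHS]mulrC mulrA.
rewrite /hausdorff scale_real_complex -!Rintegral_invX; congr (_ +i* _)%C.
- rewrite mulrC -(RintegralZl _ (measurable_itv _) (integrable_invX n)).
  apply: eq_Rintegral => t t0; rewrite (dilate t t0) scale_real_complex /=.
  by rewrite mulrA -invfM -exprS mulrC.
- rewrite mulrC -(RintegralZl _ (measurable_itv _) (integrable_invX n)).
  apply: eq_Rintegral => t t0; rewrite (dilate t t0) scale_real_complex /=.
  by rewrite mulrA -invfM -exprS mulrC.
Qed.

Variables (p alpha : R).
Hypotheses (p1 : 1 < p) (alpha0 : 0 < alpha).
Hypothesis Hc : hausdorff_compact_on_fock p alpha mu.
Let p0 : 0 < p. Proof. exact: lt_trans p1. Qed.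

Let c0 : 0 < alpha * p / (2 * pi) :> R.
Proof. by rewrite divr_gt0 ?mulr_gt0 ?pi_gt0. Qed.

Let e n := normalized_monomial p alpha n.

Let eF n : in_fock p alpha (e n).
Proof.
split; first exact: normalized_monomial_entire.
by rewrite normalized_monomial_integral// ltry.
Qed.

Let HeE n : hausdorff mu (e n) = fun z => (moment n)%:C%C * e n z.
Proof. by apply/funext => z; rewrite /e /normalized_monomial hausdorff_monomial. Qed.

Let He_entire n : entire (hausdorff mu (e n)).
Proof. by have [/(_ _ (eF n))[_ []]] := Hc. Qed.

Let HeJ n : fock_integral p alpha (hausdorff mu (e n)) = (moment n `^ p)%:E.
Proof.
rewrite HeE fock_integralZ; last first.
  by apply: entire_pcontinuous; have [] := eF n.
by rewrite normalized_monomial_integral// mule1 normc_real ger0_norm ?moment_ge0.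
Qed.

(** Let g be the limit of a subsequence of H e_n. The differences h k = H e - g are eventually small
    in norm and tend pointwise to -g, so Fatou's lemma makes g as small as they are; then H e = h +
    g is small, and its Fock integral is the p-th power of a moment. *)
Lemma compact_moment_small (eta : R) : 0 < eta -> exists n, moment n <= eta.
Proof.
move=> eta0.
have nb : exists M' : R, forall k, fock_norm p alpha (e k) <= M'.
  exists (fock_norm p alpha (e 0%N)) => k.
  by rewrite /fock_norm !normalized_monomial_integral.
have [phi [g [phiS [gF cv]]]] := Hc.2 e eF nb.
have phik k : (k <= phi k)%N.
  by elim: k => // k IH; apply: leq_ltn_trans IH _; exact: phiS.
have [ge gfin] := gF.
pose h k := fun z => hausdorff mu (e (phi k)) z - g z.
have eh k : entire (h k) := entireB (@He_entire (phi k)) ge.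
have ch k : pcontinuous (h k) := entire_pcontinuous (@eh k).
have cg : pcontinuous g := entire_pcontinuous ge.
have cHe k : pcontinuous (hausdorff mu (e k)) := entire_pcontinuous (@He_entire k).
have hF k : in_fock p alpha (h k).
  split; first exact: eh.
  pose J := Num.max (moment (phi k) `^ p) (fine (fock_integral p alpha g)).
  have J1 : (fock_integral p alpha (hausdorff mu (e (phi k))) <= J%:E)%E.
    by rewrite HeJ lee_fin le_max lexx.
  have J2 : (fock_integral p alpha g <= J%:E)%E.
    rewrite -[leLHS]fineK ?ge0_fin_numE ?fock_integral_ge0//.
    by rewrite lee_fin le_max lexx orbT.
  have := fock_integralB_le p1 (cHe (phi k)) cg (ch k) J1 J2.
  by move=> /le_lt_trans; apply; rewrite ltry.
(* Solves 2^p (eps + eps) = eta^p, the final bound on the p-th power of the moment. *)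
pose eps := eta `^ p / (2 `^ p * 2).
have eps0 : 0 < eps by rewrite divr_gt0 ?mulr_gt0 ?powR_gt0.
(* The norm that corresponds to a Fock integral equal to eps. *)
pose d := (alpha * p / (2 * pi) * eps) `^ p^-1.
have d0 : 0 < d by rewrite powR_gt0// mulr_gt0.
have [n0 _ Hn0] : \forall k \near \oo, fock_norm p alpha (h k) <= d.
  move/cvgrPdist_le : cv => /(_ _ d0); apply: filterS => k.
  by rewrite sub0r normrN; apply: le_trans; exact: ler_norm.
have small k : (fock_integral p alpha (h (k + n0)%N) <= eps%:E)%E.
  have := fock_norm_le_integral p1 alpha0 (hF (k + n0)%N) (Hn0 _ (leq_addl _ _)).
  rewrite /d -powRrM mulVf ?gt_eqF// powRr1; last by rewrite mulr_ge0// ltW.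
  by rewrite mulrAC divff ?gt_eqF// mul1r.
(* The pointwise limit of h k. The sign lets H e be written as the difference h - g', to which
   [fock_integralB_le] applies. *)
pose g' := fun z => 0 - g z.
have eg' : entire g' := entireB (@entire_cst R 0) ge.
have small' : (fock_integral p alpha g' <= eps%:E)%E.
  apply: (fock_integral_fatou p1 (u := fun k => h (k + n0)%N) (fun k => @ch _) _ small) => z.
  pose psi k := phi (k + n0)%N.
  have psik k : (k <= psi k)%N by apply: leq_trans (phik _); exact: leq_addr.
  have L := normalized_monomial_cvg0 p1 alpha0 z psik.
  have L2 : M * normc (e (psi k) z) @[k --> \oo] --> (0 : R).
    by rewrite -[X in _ --> X](mulr0 M); apply: cvgM L; exact: cvg_cst.
  apply: (squeeze_cvgr _ (cvg_cst 0) L2); apply: nearW => k.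
  rewrite normc_ge0/= /h /g' sub0r opprK subrK HeE.
  rewrite ComplexField.Normc.normcM normc_real ger0_norm ?moment_ge0//.
  by rewrite ler_wpM2r ?normc_ge0// -lee_fin momentE.
have J0 : (fock_integral p alpha (hausdorff mu (e (phi n0))) <= (2 `^ p * (eps + eps))%:E)%E.
  have -> : hausdorff mu (e (phi n0)) = (fun z => h (0 + n0)%N z - g' z).
    by apply/funext => z; rewrite /h /g' add0n sub0r opprK subrK.
  have c' := entire_pcontinuous (entireB (@eh (0 + n0)%N) eg').
  exact: (fock_integralB_le p1 (@ch _) (entire_pcontinuous eg') c' (small 0%N) small').
exists (phi n0); move: J0; rewrite HeJ lee_fin /eps.
have -> : 2 `^ p * (eta `^ p / (2 `^ p * 2) + eta `^ p / (2 `^ p * 2)) = eta `^ p.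
  by have : 2 `^ p != 0 :> R by [rewrite gt_eqF// powR_gt0]; move=> ?; field.
rewrite leNgt => /negP H; rewrite leNgt; apply/negP => lt_eta; apply: H.
by rewrite gt0_ltr_powR ?nnegrE ?moment_ge0// ltW.
Qed.

End tail_moments.

(** * Equivalence of compactness and vanishing moments *)

Theorem theorem3 (R : realType) (p alpha : R) (mu : {measure set R -> \bar R}) :
  1 < p -> 0 < alpha ->
  mu `]0, 1[%classic = 0%E ->
  (exists M : R, forall n : nat,
     (\int[mu]_(t in `[1%R, +oo[) (t ^- n.+1)%:E <= M%:E)%E) ->
  (hausdorff_compact_on_fock p alpha mu <->
   (fun n : nat => (\int[mu]_(t in `[1%R, +oo[) (t ^- n.+1)%:E)%E) @ \oo --> 0%E).
Proof.
move=> p1 alpha0 mu01 [M muM]; split => [Hc|cv].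
- have -> : (fun n : nat => (\int[mu]_(t in `[1%R, +oo[) (t ^- n.+1)%:E)%E) =
      EFin \o moment mu by apply/funext => n /=; rewrite (momentE muM).
  apply: cvg_EFin; first exact: nearW.
  apply/cvgrPdist_le => eta eta0.
  have [n0 Hn0] := compact_moment_small mu01 muM p1 alpha0 Hc eta0.
  exists n0 => // n /= n0n.
  rewrite sub0r normrN ger0_norm ?moment_ge0//.
  exact: le_trans (moment_nonincreasing muM n0n) Hn0.
- have mf n : measurable_fun [set: R] (fun t : R => (t ^- n)%:E).
    apply/measurable_EFinP; under eq_fun do rewrite -exprVn.
    by apply: measurable_funX; exact: measurable_invr.
  have f0 n (t : R) : 1 <= t -> (0 <= (t ^- n)%:E)%E.
    by move=> t1; rewrite lee_fin invr_ge0 exprn_ge0// (le_trans ler01).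
  have sub (A : set R) n : measurable A -> A `<=` `[1, +oo[%classic ->
      (\int[mu]_(t in A) (t ^- n)%:E <= \int[mu]_(t in `[1%R, +oo[) (t ^- n)%:E)%E.
    move=> mA A1; apply: ge0_subset_integral => //.
      exact: measurable_funTS.
    by move=> t; rewrite /= in_itv/= andbT => t1; exact: f0.
  (* The integrand t^-(n+1) equals 1 at t = 1, so every moment is at least the mass of this
     point. *)
  have mu1 : mu [set 1] = 0%E.
    apply/eqP; rewrite eq_le measure_ge0 andbT.
    rewrite -(cvg_lim _ cv)//; apply: lime_ge; first by apply/cvg_ex; exists 0%E.
    apply: nearW => n.
    have -> : mu [set 1] = (\int[mu]_(t in [set 1%R]) (t ^- n.+1)%:E)%E.
      rewrite (eq_integral (cst 1%E)); first by rewrite integral_cst// mul1e.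
      by move=> t /[!inE] ->; rewrite expr1n invr1.
    by apply: sub => // t ->; rewrite /= in_itv/= lexx.
  have mu01' : mu `]0, 1]%classic = 0%E.
    rewrite -(setUitv1 true) ?bnd_simp//.
    by rewrite measureU0.
  (* The moment of index 0 bounds the total mass of t^-1 dmu. *)
  have muN : (\int[mu]_(t in `]1%R, +oo[) (t^-1)%:E <= M%:E)%E.
    apply: le_trans (muM 0%N).
    have := sub `]1, +oo[%classic 1%N (measurable_itv _).
    apply=> t; rewrite /= !in_itv/= !andbT; exact: ltW.
  exact: hausdorff_compact p1 alpha0 mu01' muN.
Qed.
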